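(* There exists an infinite set $\mathbb A \subseteq (0,\infty)$ of positive Hausdorff dimension with the following property. Let $C \subseteq \mathbb R^4$ be a symmetric convex body of revolution containing the centered closed unit Euclidean ball $\mathbb B_4$ in its interior, and suppose there is a constant $A$ such that $|C \cap H|_3 = A$ for every hyperplane $H$ tangent to $\mathbb B_4$. If $A \in \mathbb A$, then $C$ is a Euclidean ball.
   Context: A convex body is a compact convex set with non-empty interior. Symmetric means $C=-C$. A body of revolution in $\mathbb R^4$ is a body invariant under all rotations fixing pointwise some line (the axis of revolution); for a symmetric body this line passes through the origin. $|\cdot|_3$ denotes the $3$-dimensional Lebesgue measure in the hyperplane $H$. *)

(* Defs.v *)
From HB Require Import structures.
From mathcomp Require Import all_boot all_order all_algebra.
From mathcomp Require Import all_classical all_reals all_analysis.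

Set Implicit Arguments.
Unset Strict Implicit.
Unset Printing Implicit Defensive.

Import Order.TTheory GRing.Theory Num.Theory.
Import numFieldNormedType.Exports.

Local Open Scope classical_set_scope.
Local Open Scope ring_scope.

(* Points of R^n are row vectors. The library norm on 'rV[R]_n is the sup norm:
   it is used below only through the topology (compact, interior), and all
   metric notions go through the Euclidean inner product [dotr]. *)

Definition dotr (R : realType) (n : nat) (x y : 'rV[R]_n) : R :=
  \sum_(i < n) x ord0 i * y ord0 i.

Definition enorm (R : realType) (n : nat) (x : 'rV[R]_n) : R :=
  Num.sqrt (dotr x x).

Definition eball (R : realType) (n : nat) (c : 'rV[R]_n) (r : R) :
    set 'rV[R]_n :=
  [set x | enorm (x - c) <= r].

Definition euclidean_ball (R : realType) (n : nat) (C : set 'rV[R]_n) : Prop :=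
  exists (c : 'rV[R]_n) (r : R), 0 < r /\ C = eball c r.

Definition convex_body (R : realType) (n : nat) (C : set 'rV[R]_n) : Prop :=
  [/\ compact C, convex_set C & C° !=set0].

Definition symmetric_set (R : realType) (n : nat) (C : set 'rV[R]_n) : Prop :=
  [set - x | x in C] = C.

Definition rotation_mx (R : realType) (n : nat) (Q : 'M[R]_n) : Prop :=
  Q *m Q^T = 1%:M /\ \det Q = 1.

(* The axis is the affine line p + R e. The rotations of R^n fixing it pointwise
   are the maps x |-> p + (x - p) Q with Q in SO(n) and e Q = e. *)
Definition of_revolution (R : realType) (n : nat) (C : set 'rV[R]_n) : Prop :=
  exists p e : 'rV[R]_n, e != 0 /\
    forall Q : 'M[R]_n, rotation_mx Q -> e *m Q = e ->
      [set p + (x - p) *m Q | x in C] = C.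

Definition hyperplane (R : realType) (n : nat) (H : set 'rV[R]_n) : Prop :=
  exists (a : 'rV[R]_n) (b : R), a != 0 /\ H = [set x | dotr x a = b].

(* Tangency of a hyperplane to a convex body, i.e. H supports K. *)
Definition tangent_to (R : realType) (n : nat) (H K : set 'rV[R]_n) : Prop :=
  H `&` K !=set0 /\ H `&` K° = set0.

Definition lebesgue3 (R : realType) (S : set (R * R * R)) : \bar R :=
  ((@lebesgue_measure R \x @lebesgue_measure R) \x @lebesgue_measure R)%E S.

(* The affine map (t0, t1, t2) |-> o + t0 f0 + t1 f1 + t2 f2, where the pair
   F = (o, f) gives the origin o and the rows f0, f1, f2 of f. *)
Definition frame_map (R : realType) (F : 'rV[R]_4 * 'M[R]_(3, 4))
    (t : R * R * R) : 'rV[R]_4 :=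
  F.1 + (\row_(i < 3) [:: t.1.1; t.1.2; t.2]`_i) *m F.2.

Definition orthonormal_frame (R : realType) (H : set 'rV[R]_4)
    (F : 'rV[R]_4 * 'M[R]_(3, 4)) : Prop :=
  F.2 *m F.2^T = 1%:M /\ range (frame_map F) = H.

(* 3-dimensional Lebesgue measure in the hyperplane H of R^4: the Lebesgue
   measure of R^3 carried to H by an orthonormal coordinate system of H. A fixed
   one is chosen; the measure does not depend on the choice, by invariance of
   Lebesgue measure under isometries. *)
Definition hyperplane_measure (R : realType) (H S : set 'rV[R]_4) : \bar R :=
  lebesgue3 (frame_map (xget (0, 0) (orthonormal_frame H)) @^-1` S).

Definition ediam (R : realType) (U : set R) : \bar R :=
  maxe 0%E (ereal_sup [set (`|z.1 - z.2|)%:E | z in U `*` U]).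

Definition hausdorff_premeasure (R : realType) (s delta : R) (E : set R) :
    \bar R :=
  ereal_inf [set (\sum_(0 <= i <oo) poweR (ediam (U i)) s)%E
    | U in [set U : nat -> set R |
        E `<=` \bigcup_i U i /\ forall i, (ediam (U i) <= delta%:E)%E]].

Definition hausdorff_measure (R : realType) (s : R) (E : set R) : \bar R :=
  ereal_sup [set hausdorff_premeasure s delta E
    | delta in [set delta : R | 0 < delta]].

(* Restricting to s > 0 does not change the infimum, and avoids the value
   0 `^ 0 = 1, which would miscount the empty sets of a covering. *)
Definition hausdorff_dim (R : realType) (E : set R) : \bar R :=
  ereal_inf [set s%:E | s in [set s : R | 0 < s /\ hausdorff_measure s E = 0%E]].

(* Main.v *)
(* The planar section of C through the axis is a convex body K, symmetric in both axes, and C is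
   recovered from the profile F x = max {y^2 | (x, y) in K}. By Fubini, the section of C by a
   hyperplane tangent to the ball at a point of abscissa c has volume proportional to (1 -
   c^2)^(-1/2) times the integral of max (F x - (1 - c x)^2 / (1 - c^2)) 0. As this volume does
   not depend on c, differentiating in c gives an algebraic relation between the lengths a and b
   of the two pieces of the chord that K cuts on the tangent line c x + s y = 1, namely 3 s (b^2
   - a^2) + 2 c (a^3 + b^3 - 2 r^3) = 0, where r depends only on A.

   Write r = cot (pi y / 2) and rho = (1 + r^2)^(1/2) = 1 / sin (pi y / 2). The section
   orthogonal to the axis shows that the boundary of K is at distance rho from the origin in the
   direction of the point (1, r). If a = r, the relation forces b = r or a second equation in b;
   the first alternative, iterated and combined with the symmetries of K, propagates the
   distance rho along the orbit of a rotation by pi y. If y is badly approximable, in the sense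
   that |q y - p| >= 1 / (100 q^(4/3)), then the directions already reached are so evenly spread
   that, by convexity, the second alternative would confine the next direction to a
   neighbourhood of pi / 2 so small that y would be too well approximated. Hence the orbit stays
   at distance rho, it is dense, and K is a disc.

   The badly approximable y in a short interval have positive Lebesgue measure, since the
   excluded set has small measure, and A |-> y is Lipschitz; hence the set of the corresponding
   A has Hausdorff dimension at least 1. *)

Require Import Defs.
From HB Require Import structures.
From mathcomp Require Import all_boot all_order all_algebra.
From mathcomp Require Import all_classical all_reals all_analysis.
From mathcomp Require Import measurable_realfun.
From mathcomp Require Import ring lra zify.

Set Implicit Arguments.
Unset Strict Implicit.
Unset Printing Implicit Defensive.

Import Order.TTheory GRing.Theory Num.Theory.
Import numFieldNormedType.Exports.

Local Open Scope classical_set_scope.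
Local Open Scope ring_scope.

(** * Diophantine approximation *)

(** Pigeonhole: the [N + 1] fractional parts of [j y], [0 <= j <= N], fall into [N] boxes of width
    [1 / N], so two of them share a box, and the difference of their indices serves as [q]. *)
Lemma dirichlet (R : realType) (y : R) (N : nat) : 0 <= y -> (0 < N)%N ->
  exists p q : nat, [/\ (0 < q <= N)%N & `|q%:R * y - p%:R| < N%:R^-1].
Proof.
move=> y0 N0.
have NR : 0 < N%:R :> R by rewrite ltr0n.
pose fr (j : nat) : R := j%:R * y - (Num.truncn (j%:R * y))%:R.
have frP j : 0 <= fr j < 1.
  have /truncn_itv : 0 <= j%:R * y by rewrite mulr_ge0.
  rewrite /fr -natr1 => /andP[h1 h2]; apply/andP; split; lra.
have boxP j : (Num.truncn (N%:R * fr j) < N)%N.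
  have /andP[h1 h2] := frP j.
  rewrite truncn_lt_nat; last by rewrite mulr_ge0 // ltW.
  by rewrite -[ltRHS]mulr1 ltr_pM2l.
pose box (j : 'I_N.+1) : 'I_N := Ordinal (boxP j).
have /injectivePn[i [j ij bij]] : ~~ injectiveb box.
  by apply/negP => /injectiveP /leq_card; rewrite !card_ord ltnn.
wlog ltij : i j ij bij / (i < j)%N.
  move=> W; case: (ltngtP i j) => h; first exact: (W i j).
  - by apply: (W j i) => //; rewrite eq_sym.
  - by case/eqP: ij; apply: val_inj.
exists (Num.truncn (j%:R * y) - Num.truncn (i%:R * y))%N, (j - i)%N; split.
  by rewrite subn_gt0 ltij (leq_trans (leq_subr _ _)) // -ltnS.
have le1 : (Num.truncn (i%:R * y) <= Num.truncn (j%:R * y))%N.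
  by apply: le_truncn; rewrite ler_wpM2r // ler_nat ltnW.
rewrite (natrB _ le1) (natrB _ (ltnW ltij)).
have -> : (j%:R - i%:R) * y -
  ((Num.truncn (j%:R * y))%:R - (Num.truncn (i%:R * y))%:R) = fr j - fr i.
  by rewrite /fr; ring.
have e : Num.truncn (N%:R * fr j) = Num.truncn (N%:R * fr i).
  by have [] := congr1 val bij.
have /andP[fi0 _] := frP i; have /andP[fj0 _] := frP j.
have /truncn_itv/andP[a1 a2] : 0 <= N%:R * fr i by rewrite mulr_ge0 // ltW.
have /truncn_itv/andP[b1 b2] : 0 <= N%:R * fr j by rewrite mulr_ge0 // ltW.
rewrite e in b1 b2; rewrite -natr1 in a2 b2.
rewrite -(ltr_pM2l NR) divff ?gt_eqF // -[X in X * `|_|](gtr0_norm NR) -normrM.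
by rewrite ltr_norml mulrBr; apply/andP; split; lra.
Qed.

(** Dividing [p] and [q] by their gcd also divides the error. Coprimality is what lets
    [coprime_residue] invert [p] modulo [q]. *)
Lemma dirichlet_coprime (R : realType) (y : R) (N : nat) : 0 <= y -> (0 < N)%N ->
  exists p q : nat,
    [/\ (0 < q <= N)%N, coprime p q & `|q%:R * y - p%:R| < N%:R^-1].
Proof.
move=> y0 N0; have [p [q [/andP[q0 qN] h]]] := dirichlet y0 N0.
have d0 : (0 < gcdn p q)%N by rewrite gcdn_gt0 q0 orbT.
exists (p %/ gcdn p q)%N, (q %/ gcdn p q)%N; split.
- rewrite divn_gt0 // dvdn_leq ?dvdn_gcdr //=.
  exact: leq_trans (leq_div _ _) qN.
- by rewrite /coprime -(eqn_pmul2r d0) mul1n muln_gcdl !divnK ?dvdn_gcdl ?dvdn_gcdr.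
- apply: le_lt_trans h.
  have -> : q%:R = (q %/ gcdn p q)%:R * (gcdn p q)%:R :> R by rewrite -natrM divnK // dvdn_gcdr.
  have -> : p%:R = (p %/ gcdn p q)%:R * (gcdn p q)%:R :> R by rewrite -natrM divnK // dvdn_gcdl.
  set d := (gcdn p q)%:R; set a := (q %/ _)%:R; set b := (p %/ _)%:R.
  rewrite (_ : a * d * y - b * d = (a * y - b) * d); last by ring.
  rewrite normrM ler_peMr // ger0_norm ?ler0n //.
  by rewrite ler1n.
Qed.

(** The window [[-n, n)] holds [2 n >= q] consecutive integers, hence every class modulo [q]; the
    class wanted is that of [u m], where [u] is a Bezout inverse of [p]. *)
Lemma coprime_residue (p q n : nat) (m : int) : coprime p q -> (0 < q)%N ->
  (q <= n.*2)%N -> exists j l : int,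
  [/\ - n%:Z <= j, j < n%:Z & j * p%:Z = m + l * q%:Z].
Proof.
move=> cpq q0 qn.
have [u [v uv]] := Bezoutz p q.
have e1 : u * p + v * q = 1 by rewrite uv /gcdz /= (eqP cpq).
have qz : q%:Z != 0 by lia.
(* The shift by [n] is undone after reduction: the remainder of [j0] minus [n] is congruent to [u m]
   and is at least [-n]. *)
pose j0 := u * m + n%:Z.
have h0 := modz_ge0 j0 qz.
have h1 : (j0 %% q%:Z)%Z < q%:Z by have := ltz_mod j0 qz; rewrite gtr0_norm.
have h2 := divz_eq j0 q%:Z.
exists ((j0 %% q%:Z)%Z - n%:Z), (- (v * m) - (j0 %/ q%:Z)%Z * p%:Z).
split; [lia|lia|].
have -> : (j0 %% q%:Z)%Z = j0 - (j0 %/ q%:Z)%Z * q%:Z by apply/eqP; rewrite eq_sym subr_eq addrC -h2.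
rewrite /j0.
have -> : m + (- (v * m) - ((u * m + n%:Z) %/ q%:Z)%Z * p%:Z) * q%:Z =
  (u * p + v * q) * m + (- (v * m) - ((u * m + n%:Z) %/ q%:Z)%Z * p%:Z) * q%:Z.
  by rewrite e1 mul1r.
ring.
Qed.

Lemma round_int (R : realType) (x : R) : exists m : int, `|m%:~R - x| <= 2^-1.
Proof.
exists (Num.floor (x + 2^-1)).
have := floor_itv (x + 2^-1); rewrite intrD => /andP[h1 h2].
rewrite ler_norml; apply/andP; split; lra.
Qed.

Definition cbrt_nat (R : realType) (q : nat) : R := q%:R `^ (3^-1).

Lemma cbrt_natX (R : realType) q : (cbrt_nat R q) ^+ 3 = q%:R.
Proof.
rewrite /cbrt_nat -powR_mulrn ?powR_ge0 // -powRrM mulVf ?pnatr_eq0 //.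
by rewrite powRr1.
Qed.

Lemma cbrt_nat_gt0 (R : realType) q : (0 < q)%N -> 0 < cbrt_nat R q.
Proof. by move=> q0; rewrite powR_gt0 // ltr0n. Qed.

(* The exponent 4/3 is greater than 1, so that the sum over q converges, and small enough for
   [resonance_power_bound]. *)
Definition dioph (R : realType) (q : nat) : R := (100 * cbrt_nat R q ^+ 4)^-1.

Lemma dioph_gt0 (R : realType) q : (0 < q)%N -> 0 < dioph R q.
Proof. by move=> q0; rewrite invr_gt0 mulr_gt0 // exprn_gt0 // cbrt_nat_gt0. Qed.

(** Cubing removes the fractional exponent, so that later estimates involve integer powers only. *)
Lemma diophX (R : realType) q : (0 < q)%N ->
  (dioph R q) ^+ 3 = (100 ^+ 3 * q%:R ^+ 4)^-1.
Proof.
move=> q0; rewrite /dioph exprVn exprMn; congr (_ * _)^-1.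
by rewrite -exprM mulnC exprM cbrt_natX.
Qed.

(** The bound is [1 / 100] times [1] plus the integral of [x^(-4/3)] from [1] to [n + 1], and is
    proved by telescoping. *)
Lemma sum_dioph (R : realType) n :
  \sum_(1 <= q < n.+2) dioph R q <= (4 - 3 / cbrt_nat R n.+1) / 100.
Proof.
elim: n => [|n IH].
  by rewrite big_nat1 /dioph /cbrt_nat powR1 expr1n; lra.
rewrite big_nat_recr //=; apply: le_trans (lerD IH (lexx _)) _.
have u0 := cbrt_nat_gt0 R (ltn0Sn n); have v0 := cbrt_nat_gt0 R (ltn0Sn n.+1).
have e : cbrt_nat R n.+2 ^+ 3 = cbrt_nat R n.+1 ^+ 3 + 1.
  by rewrite !cbrt_natX natr1.
rewrite /dioph; move: (cbrt_nat R n.+1) (cbrt_nat R n.+2) u0 v0 e => u v u0 v0 e.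
have uv : u < v.
  rewrite ltNge; apply/negP => vu.
  have : v ^+ 3 <= u ^+ 3 by rewrite lerXn2r // nnegrE ltW.
  lra.
(* For consecutive cube roots [u], [v] the induction step amounts to [u <= 3 v^3 (v - u)], where
   [v - u] is the inverse of [v^2 + u v + u^2]. *)
have -> : (4 - 3 / u) / 100 + (100 * v ^+ 4)^-1 =
  (4 - 3 / v) / 100 - (3 * v ^+ 3 * (v - u) - u) / (100 * u * v ^+ 4).
  field; rewrite !gt_eqF //.
rewrite gerBl; apply: divr_ge0; last first.
  by rewrite !mulr_ge0 ?exprn_ge0 ?ltW.
rewrite subr_ge0.
have e2 : (v - u) * (v ^+ 2 + u * v + u ^+ 2) = 1 by rewrite (_ : _ * _ = v ^+ 3 - u ^+ 3); [rewrite e|]; ring.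
have e3 : u * 1 <= 3 * v ^+ 3 * (v - u).
  rewrite -{1}e2 [leRHS](_ : _ = (v - u) * (3 * v ^+ 3)); last by ring.
  rewrite mulrCA ler_pM2l ?subr_gt0 //.
  have : u * v ^+ 2 <= v * v ^+ 2 by rewrite ler_pM2r ?exprn_gt0 // ltW.
  have : u * (u * v) <= v * (v * v).
    by apply: ler_pM; rewrite ?mulr_ge0 1?ltW // ltr_pM2r.
  have : u * (u * u) <= v * (v * v).
    apply: ler_pM; rewrite ?mulr_ge0 1?ltW //; apply: ltr_pM; rewrite ?ltW //.
  rewrite !exprS expr0; lra.
by rewrite mulr1 in e3.
Qed.

(** The numerator [0] is left out, since [q = 1], [p = 0] would exclude the small [y] to which this
    is applied. *)
Definition badly_dioph (R : realType) (y : R) : Prop :=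
  forall p q : nat, (0 < p)%N -> (0 < q)%N -> dioph R q <= `|q%:R * y - p%:R|.

(** [D] bounds the distance modulo 1 from any point to the nearest [(j + 1/2) y] with [-n <= j < n].
    A Dirichlet approximation [p / q] of [y] with [q <= 2 n] and [p > 0] yields [D = 1 / q], and bad
    approximability forces [100 q^(4/3) > 2 n], which is the power bound. *)
Lemma gap_dioph (R : realType) (y : R) (n : nat) :
  0 < y -> y <= 4^-1 -> badly_dioph y -> (0 < n)%N -> 1 - 2 * y <= n.*2%:R * y ->
  exists D : R, [/\ 0 < D,
    forall psi : R, exists j m : int,
      [/\ - n%:Z <= j, j < n%:Z & `|(j%:~R + 2^-1) * y - m%:~R - psi| <= D]
    & D ^+ 12 * n.*2%:R ^+ 9 <= 100 ^+ 9].
Proof.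
move=> y0 y4 yb n0 ny.
have N0 : (0 < n.*2)%N by rewrite double_gt0.
have NR : 0 < n.*2%:R :> R by rewrite ltr0n.
have N2 : n.*2%:R = 2 * n%:R :> R by rewrite -mul2n natrM.
have [p [q [/andP[q0 qN] cpq h]]] := dirichlet_coprime (ltW y0) N0.
have qR : 0 < q%:R :> R by rewrite ltr0n.
(* If [p = 0] then [q = 1] and [2 n y < 1]: the points advance by [y] without wrapping around the
   circle, and the last hypothesis limits the remaining arc, so [D = 2 y] works. *)
case: (posnP p) => [p0|p0].
  have q1 : q = 1%N by move: cpq; rewrite p0 /coprime gcd0n => /eqP.
  have Ny : n.*2%:R * y < 1.
    move: h; rewrite p0 q1 mul1r subr0 gtr0_norm // => h.
    by rewrite mulrC -ltr_pdivlMr // mul1r.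
  have ny' : 1 - 2 * y <= 2 * (n%:R * y) by rewrite mulrA -N2.
  exists (2 * y); split; [by rewrite mulr_gt0| |].
  - move=> psi; have [m0 hm] := round_int psi.
    have := floor_itv ((psi - m0%:~R) / y).
    set j := Num.floor _; rewrite intrD => /andP[].
    rewrite ler_pdivlMr // ltr_pdivrMr // => h1 h2.
    move: hm; rewrite ler_norml => /andP[m1 m2].
    (* The index is clamped to [[-n, n - 1]]; the error at the ends is controlled by
       [n y >= 1/2 - y]. *)
    have [jn|jn] := ltP j (- n%:Z).
      exists (- n%:Z), (- m0); split; [by []|by clear -n0; lia|].
      have : j%:~R <= - n%:R - 1 :> R.
        have -> : - n%:R - 1 = (- n%:Z - 1)%:~R :> R by rewrite intrB mulrNz.
        by rewrite ler_int; clear -jn; lia.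
      rewrite !mulrNz -[n%:Z%:~R]/(n%:R); rewrite -(ler_pM2r y0) => h3.
      by rewrite ler_norml; apply/andP; split; lra.
    have [nj|nj] := leP n%:Z j.
      exists (n%:Z - 1), (- m0); split; [by clear -n0; lia|by clear; lia|].
      have : n%:R <= j%:~R :> R by rewrite -[n%:R]/(n%:Z%:~R) ler_int.
      rewrite intrB mulrNz -[n%:Z%:~R]/(n%:R); rewrite -(ler_pM2r y0) => h3.
      by rewrite ler_norml; apply/andP; split; lra.
    exists j, (- m0); split => //.
    rewrite mulrNz; rewrite ler_norml; apply/andP; split; lra.
  - have -> : (2 * y) ^+ 12 * n.*2%:R ^+ 9 = (2 ^+ 12 * y ^+ 3) * (n.*2%:R * y) ^+ 9 by ring.
    apply: (@le_trans _ _ ((2 ^+ 12 * 1) * 1)).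
      apply: ler_pM.
      - by rewrite mulr_ge0 // exprn_ge0 // ltW.
      - by rewrite exprn_ge0 // mulr_ge0 // ltW.
      - rewrite ler_pM2l ?exprn_gt0 //; apply: exprn_ile1; [exact: ltW|].
        by clear -y4; lra.
      - apply: exprn_ile1; last exact: ltW.
        by rewrite mulr_ge0 // ltW.
    rewrite !mulr1; apply: (@le_trans _ _ (100 ^+ 3)); last by rewrite ler_weXn2l // ler1n.
    by clear; lra.
exists q%:R^-1; split; [by rewrite invr_gt0| |].
(* With [j p] congruent to [m] modulo [q], the error multiplied by [q] splits into [j (q y - p)] and
   a rounding error, each at most [1/2]. *)
- move=> psi; have [m hm] := round_int (q%:R * (psi - y / 2)).
  have [j [l [j1 j2 jl]]] := coprime_residue m cpq q0 qN.
  exists j, l; split => //.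
  have e : j%:~R * p%:R = m%:~R + l%:~R * q%:R :> R.
    by rewrite -[p%:R]/(p%:Z%:~R) -[q%:R]/(q%:Z%:~R) -!intrM jl intrD.
  rewrite -(ler_pM2l qR) divff ?gt_eqF // -[X in X * `|_|](gtr0_norm qR) -normrM.
  have -> : q%:R * ((j%:~R + 2^-1) * y - l%:~R - psi) =
     j%:~R * (q%:R * y - p%:R) + (m%:~R - q%:R * (psi - y / 2)).
    by rewrite [j%:~R * (_ - _)]mulrBr e; field.
  apply: le_trans (ler_normD _ _) _.
  have jn : `|j%:~R| <= n%:R :> R.
    rewrite -[n%:R]/(n%:Z%:~R) -intr_norm ler_int ler_norml; lia.
  rewrite normrM.
  have : `|j%:~R| * `|q%:R * y - p%:R| <= n%:R * (n.*2%:R)^-1 :> R.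
    by rewrite ler_pM // ltW.
  have -> : n%:R * (n.*2%:R)^-1 = 2^-1 :> R.
    by rewrite N2; field; rewrite pnatr_eq0 -lt0n.
  lra.
- have hq : dioph R q * n.*2%:R < 1.
    by rewrite -ltr_pdivlMr // mul1r; apply: le_lt_trans (yb _ _ p0 q0) h.
  have : (dioph R q * n.*2%:R) ^+ 9 < 1.
    by rewrite exprn_ilt1 // mulr_ge0 ?ltW // dioph_gt0.
  rewrite exprMn [dioph _ _ ^+ 9](_ : _ = (dioph R q ^+ 3) ^+ 3); last by rewrite -exprM.
  rewrite diophX // => h9; rewrite -(ler_pM2l (_ : 0 < (100 ^+ 9)^-1 :> R)) ?invr_gt0 ?exprn_gt0 //.
  rewrite mulVf ?expf_neq0 ?pnatr_eq0 //; apply: le_trans (ltW h9).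
  have E (c x : R) : c != 0 -> x != 0 ->
      (c ^+ 9)^-1 * x^-1 ^+ 12 = (c ^+ 3 * x ^+ 4)^-1 ^+ 3.
    by move=> c0 x0; field; rewrite x0 c0.
  by rewrite mulrA E ?gt_eqF // exprVn.
Qed.

(** Doubling turns a multiple close to a half-integer into [(2 n + 1) y] close to the odd integer
    [2 m + 1], which is positive, so bad approximability applies. *)
Lemma odd_multiple_dist (R : realType) (y d : R) (n : nat) (m : int) :
  0 < y -> badly_dioph y -> `|d| < 2^-1 ->
  (n%:R + 2^-1) * y = m%:~R + 2^-1 + d -> dioph R n.*2.+1 <= 2 * `|d|.
Proof.
move=> y0 yb dl e.
have m0 : 0 <= m.
  rewrite leNgt; apply/negP => m0.
  have : m%:~R <= -1 :> R by rewrite -[-1]/((-1)%:~R) ler_int; lia.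
  have : 0 < (n%:R + 2^-1) * y by rewrite mulr_gt0 // ltr_wpDl.
  move: dl; rewrite ltr_norml; lra.
case: m m0 e => // m _; rewrite -[m%:Z%:~R]/(m%:R) => e.
have := yb m.*2.+1 n.*2.+1 isT isT.
have -> : n.*2.+1%:R * y - m.*2.+1%:R = 2 * d.
  rewrite -!natr1 -!mul2n !natrM.
  have -> : (2 * n%:R + 1) * y = 2 * ((n%:R + 2^-1) * y) by field.
  by rewrite e; field.
by rewrite normrM ger0_norm.
Qed.

(** * Planar bodies *)

Lemma sin_le_id (R : realType) (x : R) : 0 <= x -> sin x <= x.
Proof.
rewrite le_eqVlt => /predU1P[<-|x0]; first by rewrite sin0.
have [|c _] := @MVT R sin cos 0 x x0 (fun _ _ => is_derive_sin _).
  by apply/continuous_subspaceT => ?; exact: continuous_sin.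
by rewrite sin0 !subr0 => ->; rewrite ler_piMl ?cos_le1 // ltW.
Qed.

(** The mean value theorem on [[0, x / 2]] and the doubling formula give [sin x >= x cos (x / 2)^2],
    and [cos (x / 2)^2 >= 1/2]. *)
Lemma half_le_sin (R : realType) (x : R) : 0 <= x -> x <= pi / 2 -> x / 2 <= sin x.
Proof.
rewrite le_eqVlt => /predU1P[<-|x0] xp; first by rewrite sin0 mul0r.
have p0 := pi_gt0 R.
have z0 : 0 < x / 2 by lra.
have [|c] := @MVT R sin cos 0 (x / 2) z0 (fun _ _ => is_derive_sin _).
  by apply/continuous_subspaceT => ?; exact: continuous_sin.
rewrite in_itv /= sin0 !subr0 => /andP[c0 cz] e.
have cc : cos (x / 2) <= cos c.
  by rewrite leNgt ltr_cos ?in_itv /= -?leNgt; [exact: ltW| |]; apply/andP; split; lra.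
have c2 : 0 <= cos x by apply: cos_ge0_pihalf; apply/andP; split; lra.
have cz0 : 0 < cos (x / 2) by apply: cos_gt0_pihalf; apply/andP; split; lra.
have ex : x = (x / 2) *+ 2 by rewrite mulr2n; lra.
have := sin_mulr2n (x / 2); rewrite -ex e => ->.
move: c2; rewrite {1}ex cos_mulr2n => c2.
have h1 : (cos (x / 2)) ^+ 2 <= cos (x / 2) * cos c by rewrite expr2 ler_pM2l.
have h2 : 2^-1 <= cos (x / 2) * cos c by lra.
have : 2^-1 * (x / 2) <= cos (x / 2) * cos c * (x / 2) by rewrite ler_pM2r.
lra.
Qed.

Lemma closed_ub_max (R : realType) (S : set R) (B : R) : closed S -> S !=set0 ->
  (forall x, S x -> x <= B) -> exists2 m, S m & forall x, S x -> x <= m.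
Proof.
move=> cS S0 hB; have ub : has_ubound S by exists B.
exists (sup S); last by move=> x Sx; exact: ub_le_sup.
by have := closure_sup S0 ub; rewrite -(proj1 (closure_id S) cS).
Qed.

(** The first coordinate runs along the axis of revolution. [pb_circle] expresses that the unit
    circle is interior to the body, and closedness is stated along lines, where extremal points are
    taken. *)
Record planar_body (R : realType) (K : R -> R -> Prop) : Prop := PlanarBody {
  pb_convex : forall t x y x' y', 0 <= t -> t <= 1 -> K x y -> K x' y' ->
    K ((1 - t) * x + t * x') ((1 - t) * y + t * y');
  pb_negx : forall x y, K x y -> K (- x) y;
  pb_negy : forall x y, K x y -> K x (- y);
  pb_disc : forall x y, x ^+ 2 + y ^+ 2 <= 1 -> K x y;
  pb_circle : forall x y, x ^+ 2 + y ^+ 2 = 1 ->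
    exists2 mu, 1 < mu & K (mu * x) (mu * y);
  pb_bounded : exists B, forall x y, K x y -> x ^+ 2 + y ^+ 2 <= B;
  pb_closed : forall a b a' b' : R, closed [set t | K (a + t * b) (a' + t * b')] }.

(** The angle [chi] is measured from the second coordinate axis, so [chi = pi / 2] is the direction
    of the axis of revolution. *)
Definition boundary_at (R : realType) (K : R -> R -> Prop) (rho chi : R) : Prop :=
  K (rho * sin chi) (rho * cos chi) /\
  forall l, rho < l -> ~ K (l * sin chi) (l * cos chi).

Lemma pb_scale (R : realType) (K : R -> R -> Prop) (x y t : R) : planar_body K ->
  0 <= t -> t <= 1 -> K x y -> K (t * x) (t * y).
Proof.
move=> pb t0 t1 Kxy.
have K0 : K 0 0 by apply: (pb_disc pb); rewrite expr0n addr0 ler01.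
by have := pb_convex pb t0 t1 K0 Kxy; rewrite !mulr0 !add0r.
Qed.

Lemma boundary_exists (R : realType) (K : R -> R -> Prop) (chi : R) :
  planar_body K -> exists2 rho, 1 <= rho & boundary_at K rho chi.
Proof.
move=> pb; have [B hB] := pb_bounded pb.
have e (l : R) : (l * sin chi) ^+ 2 + (l * cos chi) ^+ 2 = l ^+ 2.
  by rewrite !exprMn -mulrDr addrC cos2Dsin2 mulr1.
have := @closed_ub_max R _ (B + 1) (@pb_closed _ _ pb 0 (sin chi) 0 (cos chi)).
case.
- by exists 0 => /=; rewrite !mul0r !add0r; apply: (pb_disc pb); rewrite expr0n addr0 ler01.
- move=> t /=; rewrite !add0r => /hB; rewrite e => h.
  rewrite leNgt; apply/negP => Bt.
  have := sqr_ge0 (t - 1); have := sqr_ge0 t.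
  rewrite !expr2 in h *; nra.
- move=> m /=; rewrite !add0r => Km hm.
  exists m; last by split=> // l ml; move=> Kl; have := hm l; rewrite /= !add0r => /(_ Kl); rewrite leNgt ml.
  by apply: hm; rewrite /= !add0r; apply: (pb_disc pb); rewrite e expr1n.
Qed.

Lemma boundaryN (R : realType) (K : R -> R -> Prop) (rho chi : R) :
  planar_body K -> boundary_at K rho chi -> boundary_at K rho (- chi).
Proof.
move=> pb [k1 h1]; split=> [|l /h1 h]; rewrite sinN cosN mulrN.
  exact: (pb_negx pb).
by move/(pb_negx pb); rewrite opprK.
Qed.

Lemma boundaryDpi (R : realType) (K : R -> R -> Prop) (rho chi : R) :
  planar_body K -> boundary_at K rho chi -> boundary_at K rho (chi + pi).
Proof.
move=> pb [k1 h1]; split=> [|l /h1 h]; rewrite sinDpi cosDpi !mulrN.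
  by apply/(pb_negx pb)/(pb_negy pb).
by move/(pb_negx pb)/(pb_negy pb); rewrite !opprK.
Qed.

Lemma boundaryDnpi (R : realType) (K : R -> R -> Prop) (rho chi : R) (m : int) :
  planar_body K -> boundary_at K rho chi -> boundary_at K rho (chi + m%:~R * pi).
Proof.
move=> pb h.
have pos (n : nat) x : boundary_at K rho x -> boundary_at K rho (x + n%:R * pi).
  elim: n => [|n IH] hx; first by rewrite mul0r addr0.
  by rewrite -natr1 mulrDl mul1r addrA; apply: boundaryDpi => //; exact: IH.
case: m => n; first exact: pos.
rewrite NegzE mulrNz; have := pos n.+1 _ (boundaryN pb h) => /(boundaryN pb).
by rewrite opprD opprK mulNr.
Qed.

(** The segment between the points in directions [x1] and [x3] crosses the ray of direction [x2] at
    the distance obtained by dividing the left side by the factor of [r2]; by convexity this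
    distance is at most [r2]. *)
Lemma boundary_three (R : realType) (K : R -> R -> Prop) (r1 r2 r3 x1 x2 x3 : R) :
  planar_body K -> x1 < x2 -> x2 < x3 -> x3 < x1 + pi -> 0 < r1 -> 0 < r3 ->
  boundary_at K r2 x2 ->
  K (r1 * sin x1) (r1 * cos x1) -> K (r3 * sin x3) (r3 * cos x3) ->
  r1 * r3 * sin (x3 - x1) <= r2 * (r3 * sin (x3 - x2) + r1 * sin (x2 - x1)).
Proof.
move=> pb h12 h23 h31 r10 r30 [_ hb] K1 K3.
have s32 : 0 < sin (x3 - x2) by apply: sin_gt0_pi; apply/andP; split; lra.
have s21 : 0 < sin (x2 - x1) by apply: sin_gt0_pi; apply/andP; split; lra.
have s31 : 0 < sin (x3 - x1) by apply: sin_gt0_pi; apply/andP; split; lra.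
have d0 : 0 < r3 * sin (x3 - x2) + r1 * sin (x2 - x1) by rewrite addr_gt0 ?mulr_gt0.
set d := _ + _ in d0 *.
rewrite leNgt; apply/negP => hlt.
have /hb : r2 < r1 * r3 * sin (x3 - x1) / d by rewrite ltr_pdivlMr.
have t0 : 0 <= r1 * sin (x2 - x1) / d by rewrite divr_ge0 ?mulr_ge0 ?ltW.
have t1 : r1 * sin (x2 - x1) / d <= 1.
  by rewrite ler_pdivrMr // mul1r lerDr mulr_ge0 // ltW.
apply; have := pb_convex pb t0 t1 K1 K3.
have e1 : sin (x3 - x2) * sin x1 + sin (x2 - x1) * sin x3 = sin (x3 - x1) * sin x2.
  by rewrite !sinB; ring.
have e2 : sin (x3 - x2) * cos x1 + sin (x2 - x1) * cos x3 = sin (x3 - x1) * cos x2.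
  by rewrite !sinB; ring.
have dE : d = r3 * sin (x3 - x2) + r1 * sin (x2 - x1) by [].
have e (a1 a2 a3 : R) : sin (x3 - x2) * a1 + sin (x2 - x1) * a3 = sin (x3 - x1) * a2 ->
    (1 - r1 * sin (x2 - x1) / d) * (r1 * a1) + r1 * sin (x2 - x1) / d * (r3 * a3) =
    r1 * r3 * sin (x3 - x1) / d * a2.
  move=> ea; apply: (mulIf (lt0r_neq0 d0)).
  have -> : r1 * r3 * sin (x3 - x1) / d * a2 * d = r1 * r3 * (sin (x3 - x1) * a2).
    by field; rewrite gt_eqF.
  transitivity ((d - r1 * sin (x2 - x1)) * (r1 * a1) + r1 * sin (x2 - x1) * (r3 * a3)).
    by field; rewrite gt_eqF.
  by rewrite -ea dE; ring.
by rewrite (e _ _ _ e1) (e _ _ _ e2).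
Qed.

Lemma sinB_half (R : realType) (a b : R) :
  sin a - sin b = 2 * cos ((a + b) / 2) * sin ((a - b) / 2).
Proof.
have ea : a = (a + b) / 2 + (a - b) / 2 by lra.
have eb : b = (a + b) / 2 - (a - b) / 2 by lra.
by rewrite {1}ea {3}eb sinD sinB; ring.
Qed.

Lemma sin_half2 (R : realType) (a : R) : sin a = 2 * cos (a / 2) * sin (a / 2).
Proof.
have {1}-> : a = (a / 2) *+ 2 by rewrite mulr2n; lra.
by rewrite sin_mulr2n -mulr_natl mulrA.
Qed.

Lemma cos_le_cos (R : realType) (a b : R) : 0 <= a -> a <= b -> b <= pi -> cos b <= cos a.
Proof.
move=> a0 ab bp; rewrite leNgt ltr_cos ?in_itv /= -?leNgt //.
  by rewrite (le_trans a0 ab).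
by rewrite a0 (le_trans ab bp).
Qed.

(** Once boundary points at distance [rho] occur within [D] of every direction, convexity pins down
    all other boundary points to second order in [D]. *)
Lemma boundary_bracket (R : realType) (K : R -> R -> Prop) (rho r chi D : R) :
  planar_body K -> 0 < D -> 10 * D <= 1 -> 0 < rho -> 0 < r ->
  (forall psi, exists2 e, `|e - psi| <= D & boundary_at K rho e) ->
  boundary_at K r chi ->
  rho * cos (5 * D) <= r /\ r * cos (5 * D) <= rho.
Proof.
move=> pb D0 D1 rho0 r0 hD hr; have p2 := pi_ge2 R.
split.
(* [chi] lies between two known directions, so its boundary point is not below their chord. *)
- have [e1] := hD (chi - 2 * D); rewrite ler_norml => /andP[a1 a2] [Ke1 _].
  have [e2] := hD (chi + 2 * D); rewrite ler_norml => /andP[b1 b2] [Ke2 _].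
  have := boundary_three pb (_ : e1 < chi) (_ : chi < e2) (_ : e2 < e1 + pi) rho0 rho0 hr Ke1 Ke2.
  move=> /(_ ltac:(lra) ltac:(lra) ltac:(lra)).
  rewrite -mulrDr mulrCA -!mulrA ler_pM2l // => h.
  have s0 : 0 < sin ((e2 - e1) / 2) by apply: sin_gt0_pi; apply/andP; split; lra.
  have e : sin (e2 - chi) + sin (chi - e1) =
      2 * cos ((e2 + e1 - 2 * chi) / 2) * sin ((e2 - e1) / 2).
    rewrite -[chi - e1]opprB sinN -[X in _ + X]opprK opprK sinB_half.
    by congr (2 * cos _ * sin _); lra.
  move: h; rewrite e (sin_half2 (e2 - e1)).
  rewrite [rho * _](_ : _ = (2 * sin ((e2 - e1) / 2)) * (rho * cos ((e2 - e1) / 2))); last by ring.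
  rewrite [r * _](_ : _ = (2 * sin ((e2 - e1) / 2)) * (r * cos ((e2 + e1 - 2 * chi) / 2))); last by ring.
  rewrite ler_pM2l ?mulr_gt0 // => h.
  apply: le_trans (_ : r * cos ((e2 + e1 - 2 * chi) / 2) <= r); last first.
    by rewrite ler_piMr ?cos_le1 // ltW.
  apply: le_trans h; rewrite ler_pM2l //; apply: cos_le_cos; lra.
(* A known direction now lies between [chi] and another known one, which bounds [r] from above. The
   targets [chi + 2 D] and [chi + 6 D] keep the three directions in order, and their mean deviation
   from [chi] is at most [5 D]. *)
- have [e1] := hD (chi + 2 * D); rewrite ler_norml => /andP[a1 a2] be1.
  have [e2] := hD (chi + 6 * D); rewrite ler_norml => /andP[b1 b2] [Ke2 _].
  have := boundary_three pb (_ : chi < e1) (_ : e1 < e2) (_ : e2 < chi + pi) r0 rho0 be1 hr.1 Ke2.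
  move=> /(_ ltac:(lra) ltac:(lra) ltac:(lra)).
  rewrite [r * rho * _](_ : _ = rho * (r * sin (e2 - chi))); last by ring.
  rewrite ler_pM2l // -lerBlDr -mulrBr sinB_half.
  have s0 : 0 < sin ((e2 - e1) / 2) by apply: sin_gt0_pi; apply/andP; split; lra.
  rewrite (sin_half2 (e2 - e1)).
  have -> : e2 - chi - (e1 - chi) = e2 - e1 by lra.
  rewrite [rho * _](_ : _ = (2 * sin ((e2 - e1) / 2)) * (rho * cos ((e2 - e1) / 2))); last by ring.
  have [m mE] : exists m : R, m = (e2 - chi + (e1 - chi)) / 2 by eexists.
  rewrite -mE.
  rewrite (mulrAC 2 (cos m)) (mulrCA r).
  rewrite ler_pM2l ?mulr_gt0 // => h.
  apply: le_trans (_ : rho * cos ((e2 - e1) / 2) <= rho); last first.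
    by rewrite ler_piMr ?cos_le1 // ltW.
  apply: le_trans h; rewrite ler_pM2l //; apply: cos_le_cos; rewrite ?mE; lra.
Qed.

(** * Chords cut on tangent lines *)

(* The point of the line [c x + s y = 1] with abscissa [x] is [(x, (1 - c x)/s)]; the point of
   tangency has [x = c]. *)
Definition chord (R : realType) (K : R -> R -> Prop) (c s x1 x2 : R) : Prop :=
  [/\ x1 <= c, c <= x2 & forall x, K x ((1 - c * x) / s) <-> x1 <= x <= x2].

Lemma chord_exists (R : realType) (K : R -> R -> Prop) (c s : R) :
  planar_body K -> 0 < s -> c ^+ 2 + s ^+ 2 = 1 -> exists x1 x2, chord K c s x1 x2.
Proof.
move=> pb s0 cs; have [B hB] := pb_bounded pb.
have s0' : s != 0 by rewrite gt_eqF.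
have lin x : (1 - c * x) / s = 1 / s + x * (- c / s) by field.
have cl : closed [set x | K x ((1 - c * x) / s)].
  have := @pb_closed _ _ pb 0 1 (1 / s) (- c / s).
  by congr closed; apply/seteqP; split => x /=; rewrite add0r mulr1 lin.
have Kc : K c ((1 - c * c) / s).
  have -> : (1 - c * c) / s = s by rewrite -cs; field.
  by apply: (pb_disc pb); rewrite cs.
have bd x : K x ((1 - c * x) / s) -> - (B + 1) <= x <= B + 1.
  move=> /hB h; have := sqr_ge0 ((1 - c * x) / s) => h2.
  by apply/andP; split; nra.
have [x2 K2 h2] : exists2 m, K m ((1 - c * m) / s) & forall x, K x ((1 - c * x) / s) -> x <= m.
  apply: (@closed_ub_max _ _ (B + 1) cl); first by exists c.
  by move=> x /bd/andP[].
have [m K1 h1] : exists2 m, K (- m) ((1 - c * - m) / s) &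
    forall x, K (- x) ((1 - c * - x) / s) -> x <= m.
  have cl' : closed [set x | K (- x) ((1 - c * - x) / s)].
    have E x : (K (- x) ((1 - c * - x) / s)) = (K (0 + x * -1) (1 / s + x * (c / s))).
      by congr K; [ring|field].
    rewrite (_ : [set x | _] = [set t | K (0 + t * -1) (1 / s + t * (c / s))]).
      exact: pb_closed.
    by apply/seteqP; split => x /=; rewrite E.
  apply: (@closed_ub_max _ _ (B + 1) cl'); first by exists (- c) => /=; rewrite opprK.
  by move=> x /bd/andP[]; rewrite lerN2.
exists (- m), x2; split; [by rewrite lerNl; apply: h1; rewrite opprK|exact: h2|].
move=> x; split.
  move=> Kx; apply/andP; split; last exact: h2.
  by rewrite lerNl; apply: h1; rewrite opprK.
move=> /andP[a1 a2].
have [e|ne] := eqVneq x2 (- m).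
  by have -> : x = x2 by apply/eqP; rewrite eq_le a2 e.
have d0 : 0 < x2 + m by rewrite lt_neqAle eq_sym addr_eq0 ne /=; lra.
have t0 : 0 <= (x + m) / (x2 + m) by rewrite divr_ge0; lra.
have t1 : (x + m) / (x2 + m) <= 1 by rewrite ler_pdivrMr //; lra.
have := pb_convex pb t0 t1 K1 K2.
have -> : (1 - (x + m) / (x2 + m)) * - m + (x + m) / (x2 + m) * x2 = x.
  by field; rewrite gt_eqF.
suff -> : (1 - (x + m) / (x2 + m)) * ((1 - c * - m) / s) + (x + m) / (x2 + m) * ((1 - c * x2) / s) = (1 - c * x) / s by [].
by field; rewrite s0' gt_eqF.
Qed.

(** The vector [(-s, c)] directs the tangent line and lies in the disc. A point of [K] farther on
    the ray, averaged with it, would give a point of the chord past its left end. *)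
Lemma chord_end_boundary (R : realType) (K : R -> R -> Prop) (c s x1 x2 rho chi : R) :
  planar_body K -> 0 < s -> c ^+ 2 + s ^+ 2 = 1 -> chord K c s x1 x2 ->
  0 < rho -> x1 = rho * sin chi -> (1 - c * x1) / s = rho * cos chi ->
  boundary_at K rho chi.
Proof.
move=> pb s0 cs [x1c cx2 hK] rho0 ex ey.
have s0' : s != 0 by rewrite gt_eqF.
split; first by rewrite -ex -ey; apply/hK; rewrite lexx (le_trans x1c).
move=> l rl Kl; have l0 : 0 < l by exact: lt_trans rl.
have t0 : 0 <= rho / l by rewrite divr_ge0 ?ltW.
have t1 : rho / l < 1 by rewrite ltr_pdivrMr // mul1r.
have Kw : K (- s) c by apply: (pb_disc pb); rewrite sqrrN addrC cs.
have := pb_convex pb t0 (ltW t1) Kw Kl.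
have e a : rho / l * (l * a) = rho * a by field; rewrite gt_eqF.
rewrite !e -ex -ey.
have -> : (1 - rho / l) * c + (1 - c * x1) / s =
    (1 - c * ((1 - rho / l) * - s + x1)) / s by field; rewrite s0' gt_eqF.
move=> /hK/andP[+ _]; rewrite leNgt => /negP; apply.
by rewrite gtrDr mulrN oppr_lt0 mulr_gt0 // subr_gt0.
Qed.

(** A chord point further right, joined to a point [mu (c, s)] of [K] beyond the point of tangency,
    would give a point of [K] at distance more than [rho] in direction [chi]. *)
Lemma chord_boundary_end (R : realType) (K : R -> R -> Prop) (c s x1 x2 rho chi : R) :
  planar_body K -> 0 < s -> c ^+ 2 + s ^+ 2 = 1 -> chord K c s x1 x2 ->
  0 < rho -> boundary_at K rho chi -> c < rho * sin chi ->
  (1 - c * (rho * sin chi)) / s = rho * cos chi -> x2 = rho * sin chi.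
Proof.
move=> pb s0 cs [x1c cx2 hK] rho0 [KP hP] cx ey.
have s0' : s != 0 by rewrite gt_eqF.
set x := rho * sin chi in KP cx ey *; set y := rho * cos chi in KP ey *.
have /andP[_ xx2] : x1 <= x <= x2 by apply/hK; rewrite ey.
apply/eqP; rewrite eq_le xx2 andbT leNgt; apply/negP => xlt.
have [mu mu1 Kmu] := pb_circle pb cs.
have KB : K x2 ((1 - c * x2) / s) by apply/hK; rewrite lexx (le_trans x1c).
have mu0 : 0 < mu by exact: lt_trans mu1.
pose t := (x - c) / (x2 - c).
have d0 : 0 < x2 - c by lra.
have t0 : 0 < t by rewrite divr_gt0 // subr_gt0.
have t1 : t < 1 by rewrite ltr_pdivrMr // mul1r; lra.
pose d := (1 - t) / mu + t.
have dp : 0 < d by rewrite addr_gt0 // divr_gt0 // subr_gt0.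
have d1 : d < 1.
  have : (1 - t) / mu < 1 - t by rewrite ltr_pdivrMr // ltr_pMr // subr_gt0.
  rewrite /d; lra.
have /hP : rho < rho / d by rewrite ltr_pdivlMr // gtr_pMr.
apply.
have tt0 : 0 <= t / d by rewrite divr_ge0 ?ltW.
have tt1 : t / d <= 1 by rewrite ler_pdivrMr // mul1r lerDr divr_ge0 ?ltW // subr_gt0.
have := pb_convex pb tt0 tt1 Kmu KB.
have dE : d != 0 by rewrite gt_eqF.
have e a : (1 - t / d) * (mu * a) = (1 - t) * a / d.
  have -> : 1 - t / d = (d - t) / d by field.
  have -> : d - t = (1 - t) / mu by rewrite /d addrK.
  by field; rewrite dE gt_eqF.
have ex : c + t * (x2 - c) = x by rewrite /t; field; rewrite gt_eqF.
have sE : s = (1 - c * c) / s by rewrite -cs; field.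
rewrite !e.
have -> : (1 - t) * c / d + t / d * x2 = rho / d * sin chi.
  have -> : rho / d * sin chi = x / d by rewrite /x; field.
  by rewrite -ex; field.
suff -> : (1 - t) * s / d + t / d * ((1 - c * x2) / s) = rho / d * cos chi by [].
have -> : rho / d * cos chi = y / d by rewrite /y; field.
rewrite -ey -ex {1}sE; field; by rewrite dE s0'.
Qed.

(* [a] and [b] are the lengths of the two pieces into which the point of tangency [(c, s)]
   divides the chord. *)
Definition section_relation (R : realType) (K : R -> R -> Prop) (r : R) : Prop :=
  forall c s a b, 0 < s -> c ^+ 2 + s ^+ 2 = 1 -> 0 <= a -> 0 <= b ->
    chord K c s (c - b * s) (c + a * s) ->
    3 * s * (b ^+ 2 - a ^+ 2) + 2 * c * (a ^+ 3 + b ^+ 3 - 2 * r ^+ 3) = 0.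

Lemma sin_atan (R : realType) (x : R) : sin (atan x) = x / Num.sqrt (1 + x ^+ 2).
Proof.
have c0 : cos (atan x) != 0.
  by rewrite gt_eqF // cos_gt0_pihalf // atan_gtNpi2 atan_ltpi2.
by rewrite -cos_atan -{2}(atanK x) /tan divfK.
Qed.

(* [w - h] and [w + h] are the directions of the two ends of a chord bisected by its point of
   tangency; with [a = r] the section relation is [(b - r)] times the difference of the two
   sides of the last equation. *)
Lemma boundary_step (R : realType) (K : R -> R -> Prop) (h w : R) :
  planar_body K -> section_relation K (cos h / sin h) ->
  0 < h -> h < pi / 2 -> 0 < sin w ->
  boundary_at K (sin h)^-1 (w - h) ->
  boundary_at K (sin h)^-1 (w + h) \/
  exists b chi, [/\ 0 <= b, boundary_at K (Num.sqrt (1 + b ^+ 2)) chi &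
    3 * sin w * (b + cos h / sin h) =
    2 * cos w * (b ^+ 2 + b * (cos h / sin h) + (cos h / sin h) ^+ 2)].
Proof.
move=> pb; set r := cos h / sin h => rel h0 h1 w0 bP.
have p0 := pi_gt0 R.
have sh : 0 < sin h by apply: sin_gt0_pi; apply/andP; split; lra.
have ch : 0 < cos h by apply: cos_gt0_pihalf; apply/andP; split; lra.
have r0 : 0 < r by rewrite divr_gt0.
have sh' : sin h != 0 by rewrite gt_eqF.
have w0' : sin w != 0 by rewrite gt_eqF.
have cs : (- cos w) ^+ 2 + sin w ^+ 2 = 1 by rewrite sqrrN cos2Dsin2.
have cw : 1 - cos w ^+ 2 = sin w ^+ 2 by rewrite -(cos2Dsin2 w); ring.
(* The line is tangent at [(- cos w, sin w)]. The right end of its chord is the given boundary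
   point, at distance [r] from the tangency; when [b = r] the left end has direction
   [w + h + pi]. *)
have [x1 [x2 hc]] := chord_exists pb w0 cs.
have [x1c cx2 _] := hc.
have eP : (sin h)^-1 * sin (w - h) = - cos w + r * sin w.
  by rewrite sinB /r; field.
have ePc : (sin h)^-1 * cos (w - h) = sin w + r * cos w.
  by rewrite cosB /r; field.
have x2E : x2 = - cos w + r * sin w.
  rewrite -eP; apply: (chord_boundary_end pb w0 cs hc _ bP); first by rewrite invr_gt0.
    by rewrite eP ltrDl mulr_gt0.
  rewrite eP ePc; apply: (mulIf w0'); rewrite divfK //.
  by rewrite [LHS](_ : _ = (1 - cos w ^+ 2) + r * cos w * sin w); [rewrite cw|]; ring.
pose b := (- cos w - x1) / sin w.
have b0 : 0 <= b by apply: divr_ge0; [rewrite subr_ge0|exact: ltW].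
have x1E : x1 = - cos w - b * sin w by rewrite /b; field.
have := rel (- cos w) (sin w) r b w0 cs (ltW r0) b0.
rewrite -x2E -x1E => /(_ hc) eq.
have {eq} : (b - r) * (3 * sin w * (b + r) - 2 * cos w * (b ^+ 2 + b * r + r ^+ 2)) = 0.
  by rewrite -[RHS]eq; ring.
move/eqP; rewrite mulf_eq0 !subr_eq0 => /orP[/eqP br|/eqP e].
  left; have -> : w + h = w + h + pi + (-1)%:~R * pi by rewrite mulN1r addrK.
  apply: boundaryDnpi => //; apply: (chord_end_boundary pb w0 cs hc).
  - by rewrite invr_gt0.
  - by rewrite sinDpi x1E br sinD /r; field.
  - rewrite cosDpi x1E br cosD; apply: (mulIf w0'); rewrite divfK //.
    rewrite [LHS](_ : _ = (1 - cos w ^+ 2) - r * cos w * sin w); last by ring.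
    by rewrite cw /r; field.
right; exists b, (w - atan b - pi / 2); split => //.
have d0 : 0 < 1 + b ^+ 2 by rewrite ltr_pwDl // sqr_ge0.
have q0 : 0 < Num.sqrt (1 + b ^+ 2) by rewrite sqrtr_gt0.
have ca := cos_atan b.
have sa := sin_atan b.
apply: (chord_end_boundary pb w0 cs hc) => //.
- by rewrite sinBpihalf cosB ca sa x1E; field; rewrite gt_eqF.
- rewrite cosBpihalf sinB ca sa x1E; apply: (mulIf w0'); rewrite divfK //.
  rewrite [LHS](_ : _ = (1 - cos w ^+ 2) - b * cos w * sin w); last by ring.
  by rewrite cw; field; rewrite gt_eqF.
Qed.

(** The equation is equivalent to [3 (b + r) (S - r C) = C (b - r) (2 b + r)]. Hence the closeness
    of [b] to [r], expressed by [k], bounds [S - r C], which for [S = sin w] and [C = cos w] is a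
    multiple of [cos (w + h)]. *)
Lemma spurious_root_bounds (R : realType) (S C b r k : R) :
  0 < S -> S ^+ 2 + C ^+ 2 = 1 -> 0 <= b -> 2 <= r ->
  3 * S * (b + r) = 2 * C * (b ^+ 2 + b * r + r ^+ 2) -> 0 < k -> k <= 1 ->
  Num.sqrt (1 + r ^+ 2) * k <= Num.sqrt (1 + b ^+ 2) ->
  Num.sqrt (1 + b ^+ 2) * k <= Num.sqrt (1 + r ^+ 2) ->
  [/\ 0 < C, 2 * r * C <= 3 &
    `|S - r * C| * k ^+ 2 <= Num.sqrt (1 + r ^+ 2) * (1 - k ^+ 2)].
Proof.
move=> S0 SC b0 r2 e k0 k1 h1 h2.
have q0 : 0 < b ^+ 2 + b * r + r ^+ 2 by nra.
have C0 : 0 < C.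
  have : 0 < 2 * C * (b ^+ 2 + b * r + r ^+ 2) by rewrite -e !mulr_gt0 //; lra.
  by rewrite pmulr_lgt0 // pmulr_rgt0.
have S1 : S <= 1 by nra.
have Cr : 2 * r * C <= 3.
  have br : 0 < b + r by lra.
  rewrite -(ler_pM2r br); apply: (@le_trans _ _ (3 * S * (b + r))).
    rewrite e [leLHS](_ : _ = 2 * C * (r * (b + r))); last by ring.
    rewrite ler_pM2l ?mulr_gt0 //; nra.
  by rewrite ler_pM2r //; lra.
split => //.
set rho := Num.sqrt (1 + r ^+ 2) in h1 h2 *; set rb := Num.sqrt (1 + b ^+ 2) in h1 h2.
have rho2 : rho ^+ 2 = 1 + r ^+ 2 by rewrite sqr_sqrtr //; nra.
have rb2 : rb ^+ 2 = 1 + b ^+ 2 by rewrite sqr_sqrtr //; nra.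
have rho0 : 0 <= rho by exact: sqrtr_ge0.
have rb0 : 0 <= rb by exact: sqrtr_ge0.
have k2 : 0 < k ^+ 2 by rewrite exprn_gt0.
have H1 : (1 + r ^+ 2) * k ^+ 2 <= 1 + b ^+ 2.
  rewrite -rho2 -rb2 -exprMn ler_sqr ?nnegrE //; exact: mulr_ge0 (ltW k0).
have H2 : (1 + b ^+ 2) * k ^+ 2 <= 1 + r ^+ 2.
  rewrite -rho2 -rb2 -exprMn ler_sqr ?nnegrE //; exact: mulr_ge0 (ltW k0).
have k21 : k ^+ 2 <= 1 by rewrite expr_le1 // ltW.
have H3 : `|b ^+ 2 - r ^+ 2| * k ^+ 2 <= (1 + r ^+ 2) * (1 - k ^+ 2).
  by rewrite -[X in _ * X <= _](gtr0_norm k2) -normrM ler_norml; apply/andP; split; nra.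
have br : 0 < b + r by lra.
have H4 : `|b - r| * r * k ^+ 2 <= (1 + r ^+ 2) * (1 - k ^+ 2).
  apply: le_trans H3; rewrite ler_pM2r // subr_sqr normrM (gtr0_norm br).
  by rewrite ler_wpM2l //; lra.
have H5 : `|S - r * C| * 3 <= 2 * C * `|b - r|.
  rewrite -(ler_pM2r br).
  have E : 3 * (b + r) * (S - r * C) = C * ((b - r) * (2 * b + r)).
    by rewrite [LHS](_ : _ = 3 * S * (b + r) - 3 * (b + r) * (r * C)); [rewrite e|]; ring.
  have -> : `|S - r * C| * 3 * (b + r) = `|3 * (b + r) * (S - r * C)|.
    by rewrite !normrM (gtr0_norm br) ger0_norm //; ring.
  rewrite E !normrM (gtr0_norm C0) (ger0_norm (_ : 0 <= 2 * b + r)); last by lra.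
  have := mulr_ge0 (mulr_ge0 (ltW C0) (normr_ge0 (b - r))) b0.
  have rr : 0 <= r by lra.
  have := mulr_ge0 (mulr_ge0 (ltW C0) (normr_ge0 (b - r))) rr.
  lra.
have rr : 0 < r by lra.
have H6 : `|S - r * C| * r * k ^+ 2 <= `|b - r| * k ^+ 2.
  rewrite ler_pM2r //.
  have : 2 * r * C * `|b - r| <= 3 * `|b - r| by rewrite ler_wpM2r.
  have : `|S - r * C| * 3 * r <= 2 * C * `|b - r| * r by rewrite ler_pM2r.
  lra.
have H7 : `|S - r * C| * k ^+ 2 * r ^+ 2 <= rho ^+ 2 * (1 - k ^+ 2).
  rewrite rho2; apply: le_trans H4.
  have : `|S - r * C| * r * k ^+ 2 * r <= `|b - r| * k ^+ 2 * r by rewrite ler_pM2r.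
  rewrite expr2; lra.
have r2p : 0 < r ^+ 2 by rewrite exprn_gt0.
have H8 : rho <= r ^+ 2.
  rewrite -ler_sqr ?nnegrE // ?ltW // rho2.
  have : 4 <= r ^+ 2 by clear -r2; nra.
  by clear; move: (r ^+ 2) => u; nra.
rewrite -(ler_pM2r r2p); apply: le_trans H7 _.
rewrite expr2 -!mulrA ler_wpM2l // mulrC ler_wpM2l // subr_ge0 //.
Qed.

(** * Propagation of the boundary distance along the orbit *)

Lemma norm_cosDnpi (R : realType) (x : R) (k : int) : `|cos (x + k%:~R * pi)| = `|cos x|.
Proof.
have pos (n : nat) (z : R) : `|cos (z + n%:R * pi)| = `|cos z|.
  elim: n => [|n IH]; first by rewrite mul0r addr0.
  by rewrite -natr1 mulrDl mul1r addrA cosDpi normrN.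
case: k => n; first exact: pos.
rewrite NegzE mulrNz -[n.+1%:Z%:~R]/(n.+1%:R) -[LHS](pos n.+1).
by congr (`|cos _|); ring.
Qed.

(** By the symmetries of [K], directions count modulo [pi] and up to sign, so the [n] known
    directions provide the multiples [(j + 1/2) pi y] for all [-n <= j < n]. *)
Lemma known_gap (R : realType) (K : R -> R -> Prop) (rho y D : R) (n : nat) :
  planar_body K ->
  (forall k, (k < n)%N -> boundary_at K rho ((k%:R + 2^-1) * (pi * y))) ->
  (forall psi : R, exists j m : int,
      [/\ - n%:Z <= j, j < n%:Z & `|(j%:~R + 2^-1) * y - m%:~R - psi| <= D]) ->
  forall psi, exists2 e, `|e - psi| <= pi * D & boundary_at K rho e.
Proof.
move=> pb hk hD psi; have p0 := pi_gt0 R.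
have [j [m [j1 j2 h]]] := hD (psi / pi).
exists ((j%:~R + 2^-1) * (pi * y) + (- m)%:~R * pi).
  have -> : (j%:~R + 2^-1) * (pi * y) + (- m)%:~R * pi - psi =
      pi * ((j%:~R + 2^-1) * y - m%:~R - psi / pi).
    have e : psi = pi * (psi / pi) by rewrite mulrC divfK // gt_eqF.
    by rewrite {1}e mulrNz; ring.
  by rewrite normrM (gtr0_norm p0) ler_pM2l.
apply: boundaryDnpi => //.
case: j j1 j2 {h} => k j1 j2; first by apply: hk; rewrite -ltz_nat.
rewrite NegzE mulrNz -[k.+1%:Z%:~R]/(k.+1%:R).
have -> : (- k.+1%:R + 2^-1) * (pi * y) = - ((k%:R + 2^-1) * (pi * y)).
  by rewrite -natr1; field.
by apply: boundaryN => //; apply: hk; move: j1; rewrite NegzE; clear; lia.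
Qed.

Lemma sin_cos_small (R : realType) (h : R) : 0 < h -> h <= 10^-1 ->
  [/\ 0 < sin h, 0 < cos h, sin h <= h & 1 - h ^+ 2 <= cos h ^+ 2].
Proof.
move=> h0 h1; have p2 := pi_ge2 R.
have s0 : 0 < sin h by apply: sin_gt0_pi; apply/andP; split; lra.
have sh : sin h <= h by exact: sin_le_id (ltW h0).
split => //; first by apply: cos_gt0_pihalf; apply/andP; split; lra.
have := cos2Dsin2 h; have : sin h ^+ 2 <= h ^+ 2 by apply: lerXn2r; rewrite ?nnegrE // ltW.
lra.
Qed.

Lemma pi_lt4 (R : realType) : pi < 4 :> R.
Proof. by have := pihalf_lt2 R; lra. Qed.

(** The known points bracket [sqrt (1 + b^2)] with ratio [k = cos (5 D)]. Then
    [spurious_root_bounds] gives [|cos (w + h)| <= (1 - k^2) / k^2], which is at most [34 D^2]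
    because [k^2 >= 1 - 25 D^2 >= 3/4]. *)
Lemma spurious_root_dist (R : realType) (K : R -> R -> Prop) (h w b chi D : R) :
  planar_body K -> 0 < h -> h <= 10^-1 -> 0 < sin w -> 0 <= b ->
  boundary_at K (Num.sqrt (1 + b ^+ 2)) chi ->
  3 * sin w * (b + cos h / sin h) =
    2 * cos w * (b ^+ 2 + b * (cos h / sin h) + (cos h / sin h) ^+ 2) ->
  0 < D -> 10 * D <= 1 ->
  (forall psi, exists2 e, `|e - psi| <= D & boundary_at K (sin h)^-1 e) ->
  `|cos (w + h)| <= 34 * D ^+ 2.
Proof.
move=> pb h0 h1 w0 b0 bd e D0 D1 hD; have p2 := pi_ge2 R.
have [sh ch shh chh] := sin_cos_small h0 h1.
have sh' : sin h != 0 by rewrite gt_eqF.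
set r := cos h / sin h in e.
have r2 : 2 <= r.
  rewrite ler_pdivlMr // -ler_sqr ?nnegrE ?mulr_ge0 ?(ltW sh) ?(ltW ch) // exprMn.
  by clear -h0 h1 sh shh chh; nra.
have rhoE : Num.sqrt (1 + r ^+ 2) = (sin h)^-1.
  rewrite -[RHS]ger0_norm ?invr_ge0 ?ltW // -sqrtr_sqr; congr Num.sqrt.
  have := cos2Dsin2 h; rewrite /r exprMn exprVn => E.
  have -> : 1 + cos h ^+ 2 * (sin h ^+ 2)^-1 = (cos h ^+ 2 + sin h ^+ 2) / sin h ^+ 2 by field.
  by rewrite E div1r.
have rho0 : 0 < (sin h)^-1 by rewrite invr_gt0.
have rb0 : 0 < Num.sqrt (1 + b ^+ 2) by rewrite sqrtr_gt0 ltr_pwDl // sqr_ge0.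
have [b1 b2] := boundary_bracket pb D0 D1 rho0 rb0 hD bd.
have k0 : 0 < cos (5 * D) by apply: cos_gt0_pihalf; apply/andP; split; lra.
have D5 : 0 <= 5 * D by lra.
have k2 : 1 - 25 * D ^+ 2 <= cos (5 * D) ^+ 2.
  have s5 := sin_le_id D5.
  have s50 : 0 <= sin (5 * D) by apply: sin_ge0_pi; apply/andP; split; lra.
  have : sin (5 * D) ^+ 2 <= (5 * D) ^+ 2 by rewrite ler_sqr ?nnegrE.
  have := cos2Dsin2 (5 * D); rewrite exprMn; lra.
have cs : sin w ^+ 2 + cos w ^+ 2 = 1 by rewrite addrC cos2Dsin2.
have [_ _] := spurious_root_bounds w0 cs b0 r2 e k0 (cos_le1 _)
  ltac:(by rewrite rhoE) ltac:(by rewrite rhoE).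
rewrite rhoE.
have -> : sin w - r * cos w = - ((sin h)^-1 * cos (w + h)).
  by rewrite cosD /r; field.
rewrite normrN normrM (gtr0_norm rho0) -mulrA ler_pM2l //.
have D2 : 100 * D ^+ 2 <= 1 by clear -D0 D1; nra.
have cc : 0 <= `|cos (w + h)| by [].
clear -k2 D2 cc; move: (cos (5 * D) ^+ 2) (D ^+ 2) k2 D2 cc => k d; nra.
Qed.

Lemma archi_nat (R : realType) (x : R) : exists2 n, (0 < n)%N & x < n%:R.
Proof.
exists (Num.truncn `|x|).+1 => //.
by apply: le_lt_trans (ler_norm x) _; have /truncn_itv/andP[] := normr_ge0 x.
Qed.

Lemma gap_small (R : realType) (D X e : R) : 0 < D -> 0 < e -> 1 <= X ->
  D ^+ 12 * X ^+ 9 <= 100 ^+ 9 -> 100 ^+ 9 / e ^+ 12 < X -> D <= e.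
Proof.
move=> D0 e0 X1 h hX; rewrite leNgt; apply/negP => eD.
have e12 : 0 < e ^+ 12 by rewrite exprn_gt0.
move: hX; rewrite ltr_pdivrMr // => hX.
have : X * e ^+ 12 <= D ^+ 12 * X ^+ 9.
  rewrite mulrC; apply: ler_pM; [exact: ltW|exact: le_trans X1| |].
  - by apply: lerXn2r; rewrite ?nnegrE; exact: ltW.
  - by rewrite -{1}(expr1 X) ler_weXn2l.
by rewrite leNgt (le_lt_trans h hX).
Qed.

(** Up to constants [E] is [q^(-4/3)] with [q] at most of order [X], and [D] is at most [X^(-3/4)].
    So [E <= k D^2] forces [X^(-4/3) <= X^(-3/2)] up to a constant, which bounds [X]; sixth powers
    keep the exponents integral. *)
Lemma resonance_power_bound (R : realType) (c k X q D E : R) :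
  1 <= c -> 0 <= k -> k <= c ^+ 2 -> 0 < X -> 0 < q -> 0 < D -> 0 <= E ->
  q ^+ 8 <= c ^+ 2 * X ^+ 8 -> E ^+ 6 = (c ^+ 6 * q ^+ 8)^-1 ->
  E <= k * D ^+ 2 -> D ^+ 12 * X ^+ 9 <= c ^+ 9 -> X <= c ^+ 29.
Proof.
move=> c1 k0 kc X0 q0 D0 E0 hq hE hD hX.
have c0 : 0 < c by exact: lt_le_trans c1.
have h1 : E ^+ 6 <= c ^+ 12 * D ^+ 12.
  rewrite (exprM c 2 6) (exprM D 2 6) -exprMn; apply: lerXn2r; rewrite ?nnegrE //.
    by rewrite mulr_ge0 // exprn_ge0 // ltW.
  by apply: le_trans hD _; rewrite ler_pM2r // exprn_gt0.
have h2 : 1 <= c ^+ 6 * q ^+ 8 * (c ^+ 12 * D ^+ 12).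
  by rewrite -ler_pdivrMl ?mulr1 -?hE // mulr_gt0 // exprn_gt0.
have X8 : 0 < X ^+ 8 by rewrite exprn_gt0.
rewrite -(ler_pM2r X8) -exprS.
apply: (@le_trans _ _ (c ^+ 6 * q ^+ 8 * (c ^+ 12 * D ^+ 12) * X ^+ 9)).
  by rewrite ler_peMl // exprn_ge0 // ltW.
have -> : c ^+ 6 * q ^+ 8 * (c ^+ 12 * D ^+ 12) * X ^+ 9 =
  c ^+ 18 * (q ^+ 8 * (D ^+ 12 * X ^+ 9)) by ring.
have -> : c ^+ 29 * X ^+ 8 = c ^+ 18 * (c ^+ 2 * X ^+ 8 * c ^+ 9) by ring.
apply: ler_wpM2l; first by rewrite exprn_ge0 // ltW.
apply: ler_pM => //; first by rewrite exprn_ge0 // ltW.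
by rewrite mulr_ge0 // exprn_ge0 // ltW.
Qed.

(** Strong induction: [boundary_step] carries each direction to the next unless the spurious root
    occurs. That root would place the next direction within order [D^2] of [pi / 2] modulo [pi],
    closer than bad approximability allows. *)
Lemma boundary_orbit (R : realType) (K : R -> R -> Prop) (y : R) :
  planar_body K -> 0 < y -> y * 100 ^+ 30 <= 1 -> badly_dioph y ->
  section_relation K (cos (pi * y / 2) / sin (pi * y / 2)) ->
  boundary_at K (sin (pi * y / 2))^-1 (pi * y / 2) ->
  forall n : nat, boundary_at K (sin (pi * y / 2))^-1 ((n%:R + 2^-1) * (pi * y)).
Proof.
move=> pb y0 yM yb rel start; set h := pi * y / 2; set rho := (sin h)^-1.
have p0 := pi_gt0 R; have p2 := pi_ge2 R; have p4 := pi_lt4 R.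
have ysmall : y <= 1000^-1.
  have : y * 1000 <= y * 100 ^+ 30 by rewrite ler_pM2l //; clear; lra.
  clear -yM; lra.
have h0 : 0 < h by rewrite divr_gt0 // mulr_gt0.
have h1 : h <= 10^-1.
  have : pi * y <= 4 * 1000^-1 by apply: ler_pM => //; exact: ltW.
  rewrite /h; lra.
have [sh ch shh chh] := sin_cos_small h0 h1.
elim/ltn_ind => -[|n] IH.
  by rewrite add0r (_ : 2^-1 * (pi * y) = h) // /h; field.
have n0 : 0 < n.+1%:R :> R by rewrite ltr0n.
(* Reduction modulo [pi] puts [w] in [(0, pi)], where [sin w > 0]; the fractional part is nonzero by
   bad approximability. *)
pose m := Num.truncn (n.+1%:R * y).
have /truncn_itv : 0 <= n.+1%:R * y by rewrite ltW // mulr_gt0.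
rewrite -/m => /andP[m1]; rewrite -[m.+1%:R]natr1 => m2.
have m3 : m%:R < n.+1%:R * y.
  rewrite lt_neqAle m1 andbT; apply/eqP => e.
  have m0 : (0 < m)%N by rewrite -(ltr0n R) e mulr_gt0.
  have := yb m n.+1 m0 isT; rewrite -e subrr normr0.
  by rewrite leNgt dioph_gt0.
pose w := (n.+1%:R * y - m%:R) * pi.
have w0 : 0 < sin w.
  apply: sin_gt0_pi; rewrite /w mulr_gt0 ?subr_gt0 //= -[ltRHS]mul1r ltr_pM2r //; lra.
have wE : w = n.+1%:R * (pi * y) + (- m%:Z)%:~R * pi.
  by rewrite /w mulrNz -[m%:Z%:~R]/(m%:R); ring.
have bP : boundary_at K rho (w - h).
  have -> : w - h = (n%:R + 2^-1) * (pi * y) + (- m%:Z)%:~R * pi.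
    by rewrite wE /h -natr1; field.
  by apply: boundaryDnpi => //; exact: IH.
have hp : h < pi / 2 by lra.
have [bQ|[b [chi [b0 bd e]]]] := boundary_step pb rel h0 hp w0 bP.
  have -> : (n.+1%:R + 2^-1) * (pi * y) = w + h + m%:Z%:~R * pi.
    by rewrite wE /h mulrNz; field.
  exact: boundaryDnpi.
exfalso.
(* For [w] below [pi / 2 - 2 h] the spurious equation fails: it gives [2 r cos w <= 3], whereas
   [2 r cos (pi / 2 - 2 h) = 4 cos h^2 > 3]. Hence [2 (n + 1) y >= 1 - 2 y], as [gap_dioph]
   requires. *)
have wlow : 2^-1 - y <= n.+1%:R * y - m%:R.
  rewrite leNgt; apply/negP => hlt.
  have c1 : cos (pi / 2 - 2 * h) <= cos w.
    apply: cos_le_cos.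
    - by rewrite mulr_ge0 ?ltW // subr_gt0.
    - have -> : pi / 2 - 2 * h = (2^-1 - y) * pi by rewrite /h; field.
      by rewrite ler_pM2r // ltW.
    - lra.
  have c2 : cos (pi / 2 - 2 * h) = 2 * sin h * cos h.
    rewrite cosB cos_pihalf sin_pihalf mul0r add0r mul1r (sin_half2 (2 * h)).
    by rewrite (_ : 2 * h / 2 = h); [ring|field].
  have r0 : 0 < cos h / sin h by rewrite divr_gt0.
  have bp : 0 < b + cos h / sin h by rewrite ltr_wpDl.
  have cw0 : 0 < cos w by apply: lt_le_trans c1; rewrite c2 !mulr_gt0.
  have Cr : 2 * (cos h / sin h) * cos w <= 3.
    have w1 := sin_le1 w.
    rewrite -(ler_pM2r bp); apply: (@le_trans _ _ (3 * sin w * (b + cos h / sin h))).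
      rewrite e; move: (cos h / sin h) r0 {bp} => r r0.
      have : 0 <= cos w * (b * b) by rewrite mulr_ge0 ?(ltW cw0) // -expr2 sqr_ge0.
      rewrite !expr2; clear; lra.
    by rewrite ler_pM2r //; clear -w1; lra.
  have : 2 * (cos h / sin h) * (2 * sin h * cos h) <= 3.
    rewrite -c2; apply: le_trans Cr; apply: ler_wpM2l => //.
    by rewrite mulr_ge0 // ltW.
  have -> : 2 * (cos h / sin h) * (2 * sin h * cos h) = 4 * cos h ^+ 2.
    by field; rewrite gt_eqF.
  clear -h0 h1 chh; nra.
pose X := n.+1.*2%:R : R.
have XE : X = 2 * n.+1%:R by rewrite /X -mul2n natrM.
have Xy : 1 - 2 * y <= X * y.
  have : 0 <= m%:R :> R by [].
  rewrite XE; clear -wlow; lra.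
have y4 : y <= 4^-1 by clear -ysmall; lra.
have [D [D0 hD hDX]] := gap_dioph y0 y4 yb (ltn0Sn n) Xy.
rewrite -/X in hDX.
(* The smallness of [y] pushes [X] beyond the bound of [resonance_power_bound]. *)
have Xbig : 100 ^+ 29 < X.
  rewrite -(ltr_pM2r y0); apply: lt_le_trans Xy.
  have -> : 100 ^+ 29 * y = (y * 100 ^+ 30) / 100 by rewrite exprSr; field.
  clear -yM ysmall; move: (y * _) yM => z; lra.
have X1 : 1 <= X by apply: ltW (le_lt_trans _ Xbig); rewrite exprn_ege1 // ler1n.
have Dsmall : D <= 100^-1.
  apply: (gap_small D0 _ X1 hDX); first by rewrite invr_gt0.
  apply: lt_trans Xbig.
  by rewrite exprVn invrK -exprD ltr_eXn2l // ltr1n.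
have hgap := known_gap pb IH hD.
have pD0 : 0 < pi * D by rewrite mulr_gt0.
have pD : pi * D <= 4 * D by rewrite ler_pM2r // ltW.
have pD1 : 10 * (pi * D) <= 1 by clear -pD Dsmall; lra.
have := spurious_root_dist pb h0 h1 w0 b0 bd e pD0 pD1 hgap.
(* [d] is the offset of the next direction, in units of [pi], from the nearest odd multiple of
   [pi / 2]; so [|cos (w + h)| = |sin (pi d)| >= |d|]. *)
have [m' hm'] := round_int ((n.+1%:R + 2^-1) * y - 2^-1).
pose d := (n.+1%:R + 2^-1) * y - 2^-1 - m'%:~R.
have dE : (n.+1%:R + 2^-1) * y = m'%:~R + 2^-1 + d by rewrite /d; ring.
have d1 : `|d| <= 2^-1 by rewrite /d distrC.
have -> : w + h = pi * d + pi / 2 + (m' - m%:Z)%:~R * pi.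
  rewrite wE /h mulrNz intrB.
  have -> : pi * d = ((n.+1%:R + 2^-1) * y - 2^-1 - m'%:~R) * pi by rewrite mulrC.
  by field.
rewrite norm_cosDnpi cosDpihalf normrN => hs.
have ds : `|d| <= `|sin (pi * d)|.
  have -> : `|sin (pi * d)| = `|sin (pi * `|d|)|.
    case: (ger0P d) => // _; by rewrite mulrN sinN normrN.
  have pd0 : 0 <= pi * `|d| by rewrite mulr_ge0 // ltW.
  have pd1 : pi * `|d| <= pi / 2 by rewrite ler_pM2l.
  apply: le_trans (ler_norm _); apply: le_trans (half_le_sin pd0 pd1).
  rewrite ler_pdivlMr // mulrC ler_wpM2r //.
(* [544 = 34 * 16], from [pi < 4]. *)
have dD : `|d| <= 544 * D ^+ 2.
  apply: le_trans ds _; apply: le_trans hs _.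
  have : (pi * D) ^+ 2 <= (4 * D) ^+ 2 by apply: lerXn2r; rewrite ?nnegrE //; [exact: ltW|rewrite mulr_ge0 // ltW].
  rewrite [(4 * D) ^+ 2]exprMn; clear; lra.
have D2 : D ^+ 2 <= 100^-1 ^+ 2 by apply: lerXn2r; rewrite ?nnegrE ?invr_ge0 // ltW.
have d2 : `|d| < 2^-1.
  by apply: le_lt_trans dD _; clear -D2; lra.
have hE := odd_multiple_dist y0 yb d2 dE.
set q := n.+1.*2.+1 in hE.
have hE2 : dioph R q <= 1088 * D ^+ 2 by clear -hE dD; lra.
have qX : q%:R = X + 1 :> R by rewrite /q -natr1.
have E6 : dioph R q ^+ 6 = (100 ^+ 6 * q%:R ^+ 8)^-1.
  by rewrite (exprM _ 3 2) diophX // exprVn exprMn -!exprM.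
have X0 : 0 < X by exact: lt_le_trans X1.
have q8 : (q%:R) ^+ 8 <= 100 ^+ 2 * X ^+ 8 :> R.
  apply: (@le_trans _ _ ((2 * X) ^+ 8)).
    by apply: lerXn2r; rewrite ?nnegrE ?(ltW (mulr_gt0 _ X0)) // qX; clear -X1; lra.
  rewrite exprMn; apply: ler_wpM2r; first by rewrite exprn_ge0 // ltW.
  by clear; lra.
have k2 : 1088 <= 100 ^+ 2 :> R by clear; lra.
have q0 : 0 < q%:R :> R by rewrite ltr0n.
have c1 : 1 <= 100 :> R by rewrite ler1n.
have k0 : 0 <= 1088 :> R by rewrite ler0n.
have E0 := ltW (dioph_gt0 R (ltn0Sn n.+1.*2)).
have := resonance_power_bound c1 k0 k2 X0 q0 D0 E0 q8 E6 hE2 hDX.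
by rewrite leNgt Xbig.
Qed.

(** The orbit comes arbitrarily close to every direction, so [boundary_bracket] squeezes the radius
    in direction [chi] to [rho]. *)
Lemma planar_rigidity (R : realType) (K : R -> R -> Prop) (y : R) :
  planar_body K -> 0 < y -> y * 100 ^+ 30 <= 1 -> badly_dioph y ->
  section_relation K (cos (pi * y / 2) / sin (pi * y / 2)) ->
  boundary_at K (sin (pi * y / 2))^-1 (pi * y / 2) ->
  forall chi, boundary_at K (sin (pi * y / 2))^-1 chi.
Proof.
move=> pb y0 yM yb rel start chi; set rho := (sin _)^-1.
have p0 := pi_gt0 R; have p2 := pi_ge2 R; have p4 := pi_lt4 R.
have orb := boundary_orbit pb y0 yM yb rel start; rewrite -/rho in orb.
have [r r1 br] := boundary_exists chi pb.
have y1 : y <= 4^-1.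
  have : y * 4 <= y * 100 ^+ 30 by rewrite ler_pM2l //; clear; lra.
  clear -yM; lra.
have rho0 : 0 < rho.
  rewrite invr_gt0; apply: sin_gt0_pi; rewrite divr_gt0 ?mulr_gt0 //=.
  by rewrite ltr_pdivrMr // ltr_pM2l //; lra.
have small e : 0 < e -> 10 * e <= 1 ->
    rho * (1 - 25 * e ^+ 2) <= r /\ r * (1 - 25 * e ^+ 2) <= rho.
  move=> e0 e1.
  (* [n] must meet the hypothesis of [gap_dioph] and make [D <= e / 4], so that [pi D <= e]. *)
  have [n n0 hn] := archi_nat (Num.max y^-1 (100 ^+ 9 / (e / 4) ^+ 12)).
  move: hn; rewrite gt_max => /andP[n1 n2].
  have n2n : n%:R <= n.*2%:R :> R by rewrite ler_nat -addnn leq_addr.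
  have nR : 1 <= n%:R :> R by rewrite ler1n.
  have hy : 1 - 2 * y <= n.*2%:R * y.
    have : 1 < n%:R * y by rewrite -ltr_pdivrMr // div1r.
    have : n%:R * y <= n.*2%:R * y by rewrite ler_pM2r.
    lra.
  have [D [D0 hD hDX]] := gap_dioph y0 y1 yb n0 hy.
  have e4 : 0 < e / 4 by rewrite divr_gt0.
  have De : D <= e / 4.
    by apply: (gap_small D0 e4 _ hDX); [exact: le_trans nR n2n|exact: lt_le_trans n2n].
  have pD0 : 0 < pi * D by rewrite mulr_gt0.
  have pDe : pi * D <= e.
    have : pi * D <= 4 * D by rewrite ler_pM2r // ltW.
    lra.
  have pD1 : 10 * (pi * D) <= 1 by clear -pDe e1; lra.
  have r0 : 0 < r by exact: lt_le_trans r1.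
  have [b1 b2] := boundary_bracket pb pD0 pD1 rho0 r0 (known_gap pb (fun k _ => orb k) hD) br.
  have D5 : 0 <= 5 * (pi * D) by rewrite mulr_ge0 // ltW.
  have D5p : 5 * (pi * D) < pi / 2 by clear -pD1 p2; lra.
  have k0 : 0 < cos (5 * (pi * D)).
    by apply: cos_gt0_pihalf; rewrite D5p andbT; clear -D5 p0; lra.
  have k2 : 1 - 25 * e ^+ 2 <= cos (5 * (pi * D)).
    have s5 := sin_le_id D5.
    have s50 : 0 <= sin (5 * (pi * D)).
      by apply: sin_ge0_pi; rewrite D5; clear -D5p p0; lra.
    have : sin (5 * (pi * D)) ^+ 2 <= (5 * e) ^+ 2.
      by apply: lerXn2r; rewrite ?nnegrE //; clear -s5 s50 pDe e0; lra.
    have := cos2Dsin2 (5 * (pi * D)).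
    have : cos (5 * (pi * D)) ^+ 2 <= cos (5 * (pi * D)).
      by rewrite expr2 ler_piMr ?cos_le1 // ltW.
    rewrite exprMn; clear; lra.
  split; [apply: le_trans b1|apply: le_trans b2].
    by rewrite ler_pM2l.
  by rewrite ler_pM2l.
suff -> : rho = r by [].
have lim (u v : R) : 0 < u -> 0 < v ->
    (forall e, 0 < e -> 10 * e <= 1 -> u * (1 - 25 * e ^+ 2) <= v) -> u <= v.
  move=> u0 v0 H; rewrite leNgt; apply/negP => vu.
  pose e := (u - v) / (10 * u).
  have e0 : 0 < e by rewrite divr_gt0 ?subr_gt0 ?mulr_gt0.
  have ue : u * e = (u - v) / 10 by rewrite /e; field; rewrite gt_eqF.
  have e1 : 10 * e <= 1 by rewrite -(ler_pM2l u0); lra.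
  have := H e e0 e1.
  have e10 : e <= 10^-1 by rewrite -[10^-1]mul1r ler_pdivlMr // mulrC.
  have : u * e * e <= u * e * 10^-1 by apply: ler_wpM2l => //; exact: ltW (mulr_gt0 u0 e0).
  rewrite [u * (1 - _)](_ : _ = u - 25 * (u * e * e)); last by ring.
  rewrite ue; move: ((u - v) / 10 * e) => z; clear -vu; lra.
have r0 : 0 < r by exact: lt_le_trans r1.
by apply/eqP; rewrite eq_le; apply/andP; split; apply: lim => // e e0 e1; have [] := small e e0 e1.
Qed.

Lemma polar (R : realType) (x y : R) :
  exists chi, x = Num.sqrt (x ^+ 2 + y ^+ 2) * sin chi /\ y = Num.sqrt (x ^+ 2 + y ^+ 2) * cos chi.
Proof.
set l := Num.sqrt _.
have l2 : l ^+ 2 = x ^+ 2 + y ^+ 2 by rewrite sqr_sqrtr // addr_ge0 // sqr_ge0.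
have l0 : 0 <= l := sqrtr_ge0 _.
have [l00|ln0] := eqVneq l 0.
  move: l2; rewrite l00 expr0n /= => /esym/eqP.
  rewrite paddr_eq0 ?sqr_ge0 // !sqrf_eq0 => /andP[/eqP-> /eqP->].
  by exists 0; rewrite !mul0r.
have xl : -1 <= y / l <= 1.
  have lp : 0 < l by rewrite lt_neqAle eq_sym ln0.
  rewrite ler_pdivlMr // ler_pdivrMr // mulN1r mul1r -ler_norml -(ger0_norm l0).
  by rewrite -ler_sqr ?nnegrE // !real_normK ?num_real // l2 lerDr sqr_ge0.
have ca : cos (acos (y / l)) = y / l by apply: acosK; rewrite in_itv.
have sa : sin (acos (y / l)) = `|x| / l.
  rewrite sin_acos // -(ger0_norm (_ : 0 <= `|x| / l)) ?divr_ge0 // -sqrtr_sqr.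
  congr Num.sqrt; rewrite !exprMn exprVn l2 real_normK ?num_real //.
  by field; rewrite -l2 sqrf_eq0.
have [x0|x0] := leP 0 x.
  exists (acos (y / l)); rewrite ca sa ger0_norm //; split; by field.
by exists (- acos (y / l)); rewrite cosN sinN ca sa ltr0_norm //; split; field.
Qed.

Lemma boundary_disc (R : realType) (K : R -> R -> Prop) (rho : R) :
  planar_body K -> 0 < rho -> (forall chi, boundary_at K rho chi) ->
  forall x y, K x y <-> x ^+ 2 + y ^+ 2 <= rho ^+ 2.
Proof.
move=> pb rho0 h x y; have [chi [ex ey]] := polar x y.
set l := Num.sqrt _ in ex ey.
have l0 : 0 <= l := sqrtr_ge0 _.
have l2 : l ^+ 2 = x ^+ 2 + y ^+ 2 by rewrite sqr_sqrtr // addr_ge0 // sqr_ge0.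
have [K1 K2] := h chi.
rewrite -l2 ler_sqr ?nnegrE // ?(ltW rho0) //; split.
  by rewrite ex ey => Kl; rewrite leNgt; apply/negP => /K2.
move=> lr; rewrite ex ey.
have t0 : 0 <= l / rho by rewrite divr_ge0 // ltW.
have t1 : l / rho <= 1 by rewrite ler_pdivrMr // mul1r.
have := pb_scale pb t0 t1 K1.
by rewrite !mulrA divfK ?gt_eqF.
Qed.

(** * Affine changes of variable *)

(** Uniqueness of Lebesgue measure: [|h|] times the image measure agrees with it on half-open
    intervals. *)
Lemma lebesgue_measure_affine (R : realType) (h c : R) (A : set (measurableTypeR R)) :
  h != 0 -> measurable A ->
  lebesgue_measure ((fun x : measurableTypeR R => h * x + c : measurableTypeR R) @^-1` A) =
  (`|h|^-1%:E * lebesgue_measure A)%E.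
Proof.
move=> h0 mA.
have nh : 0 < `|h| by rewrite normr_gt0.
pose f : measurableTypeR R -> measurableTypeR R := fun x => h * x + c.
have mf : measurable_fun setT f.
  by apply: measurable_funD => //; apply: measurable_funM.
suff -> : lebesgue_measure A = (`|h|%:E * lebesgue_measure (f @^-1` A))%E.
  by rewrite muleA -EFinM mulVf ?mul1e // gt_eqF.
have := @lebesgue_measure_unique R
  (mscale (NngNum (ltW nh)) (pushforward (@lebesgue_measure R) f)).
apply => // _ [[a b] _ <-] /=.
rewrite /mscale /= /pushforward lebesgue_measure_itv /= lte_fin.
have [h1|h1] := ltP 0 h.
  have -> : f @^-1` `]a, b] = `](a - c) / h, (b - c) / h]%classic.
    apply/seteqP; split => x /=; rewrite !in_itv /= ltr_pdivrMr // ler_pdivlMr //;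
    by rewrite ltrBlDr lerBrDr /f mulrC.
  rewrite lebesgue_measure_itv /= lte_fin ltr_pM2r ?invr_gt0 // ltrBlDr subrK.
  case: ifP => _; last by rewrite mule0.
  by rewrite -!EFinD -EFinM gtr0_norm //; congr EFin; field.
have h2 : h < 0 by rewrite lt_neqAle h0.
(* For negative [h] the closed end of the interval changes side. *)
have -> : f @^-1` `]a, b] = `[(b - c) / h, (a - c) / h[%classic.
  apply/seteqP; split => x /=; rewrite !in_itv /= ler_ndivrMr // ltr_ndivlMr // andbC;
  by rewrite ltrBlDr lerBrDr /f mulrC.
rewrite lebesgue_measure_itv /= lte_fin ltr_nM2r ?invr_lt0 // ltrBlDr subrK.
case: ifP => _; last by rewrite mule0.
by rewrite -!EFinD -EFinM ltr0_norm //; congr EFin; field.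
Qed.

Lemma integral_affine (R : realType) (h c : R) (f : R -> \bar R) :
  h != 0 -> measurable_fun setT f -> (forall x, 0 <= f x)%E ->
  (\int[@lebesgue_measure R]_x f (h * x + c)%R = `|h|^-1%:E * \int[@lebesgue_measure R]_x f x)%E.
Proof.
move=> h0 mf f0.
have nh : 0 < `|h| by rewrite normr_gt0.
pose g : measurableTypeR R -> measurableTypeR R := fun x => h * x + c.
have mg : measurable_fun setT g.
  by apply: measurable_funD => //; apply: measurable_funM.
have := ge0_integral_pushforward mg (@lebesgue_measure R) measurableT mf (fun y _ => f0 y).
rewrite preimage_setT => <-.
have nh' : 0 <= `|h|^-1 by rewrite invr_ge0 ltW.
rewrite -[`|h|^-1]/((NngNum nh')%:num) -ge0_integral_mscale //.
apply: eq_measure_integral => A mA _.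
exact: lebesgue_measure_affine.
Qed.

(** * Volumes of sections *)

(** The factor [k] is that of preimages, the inverse of the absolute Jacobian. *)
Definition scales (d : measure_display) (T : measurableType d) (R : realType)
    (mu : set T -> \bar R) (f : T -> T) (k : R) : Prop :=
  measurable_fun setT f /\
  forall A, measurable A -> mu (f @^-1` A) = (k%:E * mu A)%E.

Lemma scales_comp (d : measure_display) (T : measurableType d) (R : realType)
    (mu : set T -> \bar R) (f g : T -> T) (k l : R) :
  scales mu f k -> scales mu g l -> scales mu (f \o g) (l * k).
Proof.
move=> [mf hf] [mg hg]; split; first exact: measurableT_comp.
move=> A mA; rewrite comp_preimage hg; first by rewrite hf // muleA EFinM.
by rewrite -[X in measurable X]setTI; exact: mf.
Qed.

(** Tonelli: a map preserving the first coordinate scales the product measure by the common factor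
    of its fibres. *)
Lemma scales_fiber1 (d1 d2 : measure_display) (T1 : measurableType d1)
    (T2 : measurableType d2) (R : realType) (m1 : {measure set T1 -> \bar R})
    (m2 : {sigma_finite_measure set T2 -> \bar R}) (f : T1 -> T2 -> T2) (k : R) :
  0 <= k -> measurable_fun setT (fun p : T1 * T2 => (p.1, f p.1 p.2)) ->
  (forall x A, measurable A -> m2 (f x @^-1` A) = (k%:E * m2 A)%E) ->
  scales (m1 \x m2)%E (fun p => (p.1, f p.1 p.2)) k.
Proof.
move=> k0 mf hf; split=> // A mA; rewrite /product_measure1.
rewrite -ge0_integralZl //; last exact: measurable_fun_xsection.
apply: eq_integral => x _ /=; rewrite -(hf x); last exact: measurable_xsection.
by congr (m2 _); apply/seteqP; split => y; rewrite /xsection /= !inE.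
Qed.

(** Here the integration is iterated in the other order, which defines the same measure by
    uniqueness of the product measure. *)
Lemma scales_fiber2 (d1 d2 : measure_display) (T1 : measurableType d1)
    (T2 : measurableType d2) (R : realType) (m1 : {sigma_finite_measure set T1 -> \bar R})
    (m2 : {sigma_finite_measure set T2 -> \bar R}) (f : T2 -> T1 -> T1) (k : R) :
  0 <= k -> measurable_fun setT (fun p : T1 * T2 => (f p.2 p.1, p.2)) ->
  (forall y A, measurable A -> m1 (f y @^-1` A) = (k%:E * m1 A)%E) ->
  scales (m1 \x m2)%E (fun p => (f p.2 p.1, p.2)) k.
Proof.
move=> k0 mf hf; split=> // A mA.
have E B : measurable B -> (m1 \x m2)%E B = (m1 \x^ m2)%E B.
  by move=> mB; apply: (product_measure_unique (m1 := m1) (m2 := m2) (m' := (m1 \x^ m2)%E)) => // X Y mX mY; exact: product_measure2E.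
rewrite !E //; last by rewrite -[X in measurable X]setTI; exact: mf.
rewrite /product_measure2 -ge0_integralZl //; last exact: measurable_fun_ysection.
apply: eq_integral => y _ /=; rewrite -(hf y); last exact: measurable_ysection.
by congr (m1 _); apply/seteqP; split => x; rewrite /ysection /= !inE.
Qed.

Lemma measurable_fst1 (d1 d2 d3 : measure_display) (T1 : measurableType d1)
    (T2 : measurableType d2) (T3 : measurableType d3) :
  measurable_fun setT (fun p : T1 * T2 * T3 => p.1.1).
Proof. exact: (measurableT_comp measurable_fst measurable_fst). Qed.

Lemma measurable_snd1 (d1 d2 d3 : measure_display) (T1 : measurableType d1)
    (T2 : measurableType d2) (T3 : measurableType d3) :
  measurable_fun setT (fun p : T1 * T2 * T3 => p.1.2).
Proof. exact: (measurableT_comp measurable_snd measurable_fst). Qed.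

Ltac measurable_poly := repeat first
  [ exact: measurable_fst1 | exact: measurable_snd1 | exact: measurable_fst
  | exact: measurable_snd | exact: measurable_cst | exact: measurable_id
  | apply: measurable_fun_pair | apply: measurable_funD | apply: measurable_funB
  | apply: measurable_funM | apply: measurable_funX ].

Lemma lebesgue_shift (R : realType) (c : R) (A : set (measurableTypeR R)) : measurable A ->
  lebesgue_measure ((fun x : measurableTypeR R => x + c : measurableTypeR R) @^-1` A) =
  (1%:E * lebesgue_measure A)%E.
Proof.
move=> mA; have := @lebesgue_measure_affine R 1 c A (oner_neq0 _) mA.
rewrite normr1 invr1 => <-; congr (lebesgue_measure _).
by apply/seteqP; split => x /=; rewrite mul1r.
Qed.

Lemma lebesgue_closed_itv (R : realType) (a b : R) : a <= b ->
  @lebesgue_measure R `[a, b]%classic = (b - a)%:E.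
Proof.
move=> ab; rewrite lebesgue_measure_itv /= lte_fin lt_neqAle ab andbT.
by case: eqVneq => [->|] //=; rewrite subrr.
Qed.

Notation plane R := (measurableTypeR R * measurableTypeR R)%type.
Notation space R := (measurableTypeR R * measurableTypeR R * measurableTypeR R)%type.

Definition lebesgue2 (R : realType) : set (plane R) -> \bar R :=
  (@lebesgue_measure R \x @lebesgue_measure R)%E.

HB.instance Definition _ (R : realType) := Measure.on (@lebesgue2 R).

Lemma lebesgue2_rectangle (R : realType) (a b c d : R) : a <= b -> c <= d ->
  lebesgue2 (`[a, b]%classic `*` `[c, d]%classic) = ((b - a) * (d - c))%:E.
Proof.
move=> ab cd; rewrite /lebesgue2 product_measure1E //.
transitivity (lebesgue_measure `[a, b]%classic * lebesgue_measure `[c, d]%classic)%E => //.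
by rewrite lebesgue_closed_itv // lebesgue_closed_itv // EFinM.
Qed.

Lemma lebesgue2_sigma_finite (R : realType) : sigma_finite setT (@lebesgue2 R).
Proof.
exists (fun n : nat => `[- n%:R, n%:R]%classic `*` `[- n%:R, n%:R]%classic).
  apply/esym/seteqP; split => // -[x y] _.
  exists (Num.truncn (Num.max `|x| `|y|)).+1 => //=.
  have m0 : 0 <= Num.max `|x| `|y| by rewrite le_max normr_ge0.
  have /truncn_itv/andP[_ /ltW] := m0.
  by rewrite ge_max => /andP[hx hy]; rewrite !in_itv /= -!ler_norml.
move=> n; split; first exact: measurableX.
by rewrite lebesgue2_rectangle ?ltry // ge0_cp.
Qed.

HB.instance Definition _ (R : realType) :=
  @Measure_isSigmaFinite.Build _ _ _ (@lebesgue2 R) (@lebesgue2_sigma_finite R).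

Lemma lebesgue2_shearx (R : realType) (k c : R) :
  @scales _ (plane R) R (@lebesgue2 R) (fun p => (p.1 + (k * p.2 + c), p.2)) 1.
Proof.
apply: (@scales_fiber2 _ _ (measurableTypeR R) (measurableTypeR R) R _ _
  (fun y x => x + (k * y + c))) => //; first by measurable_poly.
by move=> y A mA; exact: lebesgue_shift.
Qed.

Lemma lebesgue2_sheary (R : realType) (k c : R) :
  @scales _ (plane R) R (@lebesgue2 R) (fun p => (p.1, p.2 + (k * p.1 + c))) 1.
Proof.
apply: (@scales_fiber1 _ _ (measurableTypeR R) (measurableTypeR R) R _ _
  (fun x y => y + (k * x + c))) => //; first by measurable_poly.
by move=> y A mA; exact: lebesgue_shift.
Qed.

Lemma lebesgue2_scale (R : realType) (k : R) : 0 < k ->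
  @scales _ (plane R) R (@lebesgue2 R) (fun p => (k * p.1, k * p.2)) (k^-1 ^+ 2).
Proof.
move=> k0; have k0' : k != 0 by rewrite gt_eqF.
have hk : 0 <= `|k|^-1 by rewrite invr_ge0.
have h A : measurable A -> lebesgue_measure ((fun x : measurableTypeR R => k * x : measurableTypeR R) @^-1` A) =
   (`|k|^-1%:E * lebesgue_measure A)%E.
  move=> mA; rewrite -(lebesgue_measure_affine 0 k0' mA).
  by congr (lebesgue_measure _); apply/seteqP; split => x /=; rewrite addr0.
have := @scales_comp _ (plane R) R (@lebesgue2 R)
  (fun p => (k * p.1, p.2)) (fun p => (p.1, k * p.2)) `|k|^-1 `|k|^-1.
rewrite -expr2 gtr0_norm //; apply.
  rewrite -[k^-1](_ : `|k|^-1 = _); last by rewrite gtr0_norm.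
  apply: (@scales_fiber2 _ _ (measurableTypeR R) (measurableTypeR R) R _ _ (fun y x => k * x)) => //.
  by measurable_poly.
rewrite -[k^-1](_ : `|k|^-1 = _); last by rewrite gtr0_norm.
apply: (@scales_fiber1 _ _ (measurableTypeR R) (measurableTypeR R) R _ _ (fun y x => k * x)) => //.
by measurable_poly.
Qed.

Lemma lebesgue3_fst (R : realType) (f : plane R -> plane R) :
  @scales _ (plane R) R (@lebesgue2 R) f 1 ->
  @scales _ (space R) R (@lebesgue3 R) (fun p => (f p.1, p.2)) 1.
Proof.
move=> [mf hf].
have mff : measurable_fun setT (fun p : space R => (f p.1, p.2)).
  by apply: measurable_fun_pair => //; apply: measurableT_comp => //; exact: measurable_fst.
exact: (@scales_fiber2 _ _ (plane R) (measurableTypeR R) R (@lebesgue2 R)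
  (@lebesgue_measure R) (fun y x => f x) 1 ler01 mff (fun _ => hf)).
Qed.

Lemma lebesgue3_shear12 (R : realType) (k : R) :
  @scales _ (space R) R (@lebesgue3 R) (fun p => (p.1.1, p.1.2 + k * p.2, p.2)) 1.
Proof.
apply: (@scales_fiber2 _ _ (plane R) (measurableTypeR R) R (@lebesgue2 R) (@lebesgue_measure R)
  (fun y x => (x.1, x.2 + k * y))) => //; first by measurable_poly.
move=> y A mA; have [_ <- //] := lebesgue2_sheary 0 (k * y).
by congr (_ _); apply/seteqP; split => x /=; rewrite mul0r add0r.
Qed.

Lemma lebesgue3_shear21 (R : realType) (k c : R) :
  @scales _ (space R) R (@lebesgue3 R) (fun p => (p.1, p.2 + (k * p.1.2 + c))) 1.
Proof.
apply: (@scales_fiber1 _ _ (plane R) (measurableTypeR R) R (@lebesgue2 R) (@lebesgue_measure R)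
  (fun x y => y + (k * x.2 + c))) => //; first by measurable_poly.
by move=> y A mA; exact: lebesgue_shift.
Qed.

(* A rotation is a product of three shears, which preserve the measure by Fubini. *)
Lemma rotation_shears (R : realType) (c s : R) : c ^+ 2 + s ^+ 2 = 1 -> 0 <= c ->
  exists p : R, forall x y : R,
    (x + p * y) + p * (y + s * (x + p * y)) = c * x - s * y /\
    y + s * (x + p * y) = s * x + c * y.
Proof.
move=> cs c0; exists (- s / (1 + c)) => x y.
have d : 1 + c != 0 by rewrite gt_eqF // ltr_pwDl.
have e2 : s * s = (1 - c) * (1 + c) by move: cs; rewrite !expr2 => cs; lra.
have e : s * (- s / (1 + c)) = c - 1.
  by apply: (mulIf d); rewrite mulrA divfK // mulrN e2; ring.
split; last by rewrite mulrDr mulrA e; ring.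
rewrite [s * (x + _)]mulrDr [s * (_ * y)]mulrA e.
have e3 : - s / (1 + c) * (1 + c) = - s by rewrite divfK.
have -> : x + - s / (1 + c) * y + - s / (1 + c) * (y + (s * x + (c - 1) * y)) =
  x + (- s / (1 + c) * (1 + c)) * y + (s * (- s / (1 + c))) * x by ring.
by rewrite e3 e; ring.
Qed.

Lemma lebesgue2_rotation (R : realType) (c s : R) : c ^+ 2 + s ^+ 2 = 1 -> 0 <= c ->
  @scales _ (plane R) R (@lebesgue2 R)
    (fun p => (c * p.1 - s * p.2, s * p.1 + c * p.2)) 1.
Proof.
move=> cs c0; have [p hp] := rotation_shears cs c0.
have := scales_comp (lebesgue2_shearx p 0)
  (scales_comp (lebesgue2_sheary s 0) (lebesgue2_shearx p 0)).
rewrite !mulr1; congr (scales _ _ _); apply/funext => -[x y] /=.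
by have [e1 e2] := hp x y; rewrite !addr0 e1 e2.
Qed.

Lemma lebesgue3_rotation12 (R : realType) (c s : R) : c ^+ 2 + s ^+ 2 = 1 -> 0 <= c ->
  @scales _ (space R) R (@lebesgue3 R)
    (fun p => (p.1.1, c * p.1.2 - s * p.2, s * p.1.2 + c * p.2)) 1.
Proof.
move=> cs c0; have [p hp] := rotation_shears cs c0.
have := scales_comp (lebesgue3_shear12 p)
  (scales_comp (lebesgue3_shear21 s 0) (lebesgue3_shear12 p)).
rewrite !mulr1; congr (scales _ _ _); apply/funext => -[[w x] y] /=.
by have [e1 e2] := hp x y; rewrite !addr0 e1 e2.
Qed.

Lemma lebesgue3_translation (R : realType) (a b c : R) :
  @scales _ (space R) R (@lebesgue3 R) (fun p => (p.1.1 + a, p.1.2 + b, p.2 + c)) 1.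
Proof.
have h := scales_comp (lebesgue2_shearx 0 a) (lebesgue2_sheary 0 b).
rewrite mulr1 in h.
have := scales_comp (lebesgue3_shear21 0 c) (lebesgue3_fst h).
rewrite !mulr1; congr (scales _ _ _); apply/funext => -[[w x] y] /=.
by rewrite !mul0r !add0r.
Qed.

(** [h] may be negative, so that [c >= 0] as [rotation_shears] requires. *)
Lemma plane_vector_polar (R : realType) (u v : R) : exists h c s : R,
  [/\ c ^+ 2 + s ^+ 2 = 1, 0 <= c, u = h * s, v = h * c & h ^+ 2 = u ^+ 2 + v ^+ 2].
Proof.
pose q := Num.sqrt (u ^+ 2 + v ^+ 2).
have q2 : q ^+ 2 = u ^+ 2 + v ^+ 2 by rewrite sqr_sqrtr // addr_ge0 // sqr_ge0.
have [q0|qn] := eqVneq q 0.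
  move: q2; rewrite q0 expr0n /= => /esym/eqP.
  rewrite paddr_eq0 ?sqr_ge0 // !sqrf_eq0 => /andP[/eqP-> /eqP->].
  exists 0, 1, 0; split; rewrite ?mul0r //; ring.
have qp : 0 < q by rewrite lt_neqAle eq_sym qn sqrtr_ge0.
have e : (v / q) ^+ 2 + (u / q) ^+ 2 = 1.
  by rewrite !exprMn exprVn -mulrDl addrC -q2 divff // sqrf_eq0.
have [v0|v0] := leP 0 v.
  exists q, (v / q), (u / q); split => //; first exact: divr_ge0 v0 (ltW qp).
    by rewrite mulrC divfK.
  by rewrite mulrC divfK.
exists (- q), (v / - q), (u / - q); split.
- by rewrite !invrN !mulrN !sqrrN.
- by rewrite invrN mulrN -mulNr divr_ge0 ?(ltW qp) // oppr_ge0 ltW.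
- by rewrite mulrC divfK // oppr_eq0.
- by rewrite mulrC divfK // oppr_eq0.
- by rewrite sqrrN.
Qed.

(* Two plane rotations carry the linear form with coefficients [w] to a multiple of the last
   coordinate. *)
Lemma lebesgue3_axis (R : realType) (G : R -> R -> Prop) (w0 w1 w2 : R) :
  (forall v0 v1 v2 : R, @measurable _ (space R)
     [set t | G (v0 * t.1.1 + v1 * t.1.2 + v2 * t.2) (t.1.1 ^+ 2 + t.1.2 ^+ 2 + t.2 ^+ 2)]) ->
  exists h : R, h ^+ 2 = w0 ^+ 2 + w1 ^+ 2 + w2 ^+ 2 /\
    lebesgue3 [set t | G (w0 * t.1.1 + w1 * t.1.2 + w2 * t.2)
                         (t.1.1 ^+ 2 + t.1.2 ^+ 2 + t.2 ^+ 2)] =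
    lebesgue3 [set t | G (h * t.2) (t.1.1 ^+ 2 + t.1.2 ^+ 2 + t.2 ^+ 2)].
Proof.
move=> mG.
have [h1 [c1 [s1 [cs1 c10 e1 e2 e3]]]] := plane_vector_polar w0 w1.
have [h [c [s [cs c0 f1 f2 f3]]]] := plane_vector_polar h1 w2.
exists h; split; first by rewrite f3 e3.
have [_ R1] := lebesgue3_fst (lebesgue2_rotation cs1 c10).
have [_ R2] := lebesgue3_rotation12 cs c0.
have norm (a b x y : R) : a ^+ 2 + b ^+ 2 = 1 ->
    (a * x - b * y) ^+ 2 + (b * x + a * y) ^+ 2 = x ^+ 2 + y ^+ 2.
  by move=> ab; rewrite -[RHS]mul1r -ab; ring.
transitivity (lebesgue3 [set t | G (0 * t.1.1 + h1 * t.1.2 + w2 * t.2)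
                         (t.1.1 ^+ 2 + t.1.2 ^+ 2 + t.2 ^+ 2)]).
  have := R1 _ (mG 0 h1 w2); rewrite mul1e => <-.
  congr (lebesgue3 _); apply/seteqP; split => -[[x y] z] /=;
    rewrite norm // mul0r add0r mulrDr !mulrA -e1 -e2 //.
have := R2 _ (mG 0 0 h); rewrite mul1e => E.
transitivity (lebesgue3 [set t | G (0 * t.1.1 + 0 * t.1.2 + h * t.2)
                         (t.1.1 ^+ 2 + t.1.2 ^+ 2 + t.2 ^+ 2)]); last first.
  by congr (lebesgue3 _); apply/seteqP; split => -[[x y] z] /=; rewrite !mul0r !add0r.
rewrite -E; congr (lebesgue3 _).
apply/seteqP; split => -[[x y] z] /=; rewrite -[x ^+ 2 + _ ^+ 2 + (_ + _) ^+ 2]addrA norm // !mul0r !add0r mulrDr !mulrA -f1 -f2 addrA //.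
Qed.

(** * Areas of discs and volumes of sections *)

Definition disc (R : realType) (z : R) : set (plane R) :=
  [set p | p.1 ^+ 2 + p.2 ^+ 2 <= z].

Lemma measurable_disc (R : realType) (z : R) : measurable (@disc R z).
Proof.
have mf : measurable_fun setT (fun p : plane R => p.1 ^+ 2 + p.2 ^+ 2 : measurableTypeR R).
  by measurable_poly.
have := mf measurableT _ (measurable_itv `]-oo, z]); rewrite setTI.
by congr measurable; apply/seteqP; split => p /=; rewrite in_itv.
Qed.

(** This is the number pi, treated as an unspecified positive constant. *)
Definition disc_area (R : realType) : R := fine (lebesgue2 (@disc R 1)).

(** The disc contains a square of side 1 and is contained in a square of side 2. *)
Lemma disc_areaE (R : realType) :
  0 < disc_area R /\ lebesgue2 (@disc R 1) = (disc_area R)%:E.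
Proof.
have m1 := @measurable_disc R 1.
have up : (lebesgue2 (@disc R 1) <= 4%:E)%E.
  have -> : 4%:E = lebesgue2 (`[(-1 : R), 1]%classic `*` `[(-1 : R), 1]%classic).
    by rewrite lebesgue2_rectangle ?ge0_cp //; congr EFin; ring.
  apply: le_measure; rewrite ?inE //; first exact: measurableX.
  move=> -[x y]; rewrite /disc /= !in_itv /= => h.
  by split; nra.
have low : (1%:E <= lebesgue2 (@disc R 1))%E.
  have -> : 1%:E = lebesgue2 (`[(- 2^-1 : R), 2^-1]%classic `*` `[(- 2^-1 : R), 2^-1]%classic).
    by rewrite lebesgue2_rectangle ?ge0_cp ?invr_ge0 //; congr EFin; field.
  apply: le_measure; rewrite ?inE //; first exact: measurableX.
  move=> -[x y]; rewrite /disc /= !in_itv /= => -[/andP[a1 a2] /andP[b1 b2]].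
  by nra.
rewrite /disc_area; case: (lebesgue2 _) up low => //= r; rewrite !lee_fin => _ h.
by split => //; exact: lt_le_trans h.
Qed.

Lemma lebesgue2_disc (R : realType) (z : R) :
  lebesgue2 (disc z) = (disc_area R * Num.max z 0)%:E.
Proof.
have [a0 aE] := disc_areaE R.
have [z0|z0|z0] := ltrgtP z 0.
- rewrite mulr0 (_ : disc z = set0) ?measure0 //; apply/seteqP; split => // -[x y].
  rewrite /disc /= => h; have := sqr_ge0 x; have := sqr_ge0 y; lra.
- have q0 : 0 < Num.sqrt z by rewrite sqrtr_gt0.
  have q2 : Num.sqrt z ^+ 2 = z by rewrite sqr_sqrtr // ltW.
  have qi : 0 < (Num.sqrt z)^-1 by rewrite invr_gt0.
  have [_ /(_ _ (@measurable_disc R 1))] := lebesgue2_scale qi.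
  rewrite invrK q2 aE -EFinM mulrC => <-; congr (lebesgue2 _).
  apply/seteqP; split => -[x y]; rewrite /disc /= !exprMn exprVn q2 -mulrDr mulrC;
    by rewrite ler_pdivrMr // mul1r.
- rewrite z0 mulr0; apply/eqP; rewrite eq_le measure_ge0 andbT.
  have <- : lebesgue2 (`[(0 : R), 0]%classic `*` `[(0 : R), 0]%classic) = 0%:E.
    by rewrite lebesgue2_rectangle // subrr mul0r.
  apply: le_measure; rewrite ?inE //; [exact: measurable_disc|exact: measurableX|].
  move=> -[x y]; rewrite /disc /= !in_itv /= => h.
  have : x ^+ 2 + y ^+ 2 == 0 by rewrite eq_le h addr_ge0 // sqr_ge0.
  by rewrite paddr_eq0 ?sqr_ge0 // !sqrf_eq0 => /andP[/eqP-> /eqP->]; rewrite lexx.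
Qed.

Lemma lebesgue3_discs (R : realType) (Z : R -> R) : measurable_fun setT Z ->
  lebesgue3 [set t : R * R * R | t.1.1 ^+ 2 + t.1.2 ^+ 2 <= Z t.2] =
  (\int[@lebesgue_measure R]_x (disc_area R * Num.max (Z x) 0)%:E)%E.
Proof.
move=> mZ; set S := [set t | _].
have mS : @measurable _ (space R) S.
  have mf : measurable_fun setT (fun p : space R => p.1.1 ^+ 2 + p.1.2 ^+ 2 - Z p.2 : measurableTypeR R).
    apply: measurable_funB; first by measurable_poly.
    by apply: measurableT_comp => //; exact: measurable_snd.
  have := mf measurableT _ (measurable_itv `]-oo, 0]); rewrite setTI.
  by congr measurable; apply/seteqP; split => p /=; rewrite in_itv /= subr_le0.
have -> : lebesgue3 S = (@lebesgue2 R \x^ @lebesgue_measure R)%E S.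
  apply: (product_measure_unique (m1 := @lebesgue2 R) (m2 := @lebesgue_measure R)
    (m' := (@lebesgue2 R \x^ @lebesgue_measure R)%E)) => // X Y mX mY.
  exact: product_measure2E.
rewrite /product_measure2; apply: eq_integral => x _ /=.
by rewrite -lebesgue2_disc; congr (lebesgue2 _); apply/seteqP; split => p; rewrite /ysection /= inE.
Qed.

(** [t] stands for coordinates on a tangent hyperplane: a point [X] of it has
    [|X|^2 = 1 + |t + a|^2] and axial coordinate [c + w . (t + a)]. A translation removes [a],
    [lebesgue3_axis] aligns [w] with the last coordinate, and the slices are then discs. *)
Lemma section_volume (R : realType) (F : R -> R) (c w0 w1 w2 a0 a1 a2 : R) :
  measurable_fun setT F -> w0 ^+ 2 + w1 ^+ 2 + w2 ^+ 2 = 1 - c ^+ 2 ->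
  exists h : R, h ^+ 2 = 1 - c ^+ 2 /\
  lebesgue3 [set t : R * R * R |
    1 + ((t.1.1 + a0) ^+ 2 + (t.1.2 + a1) ^+ 2 + (t.2 + a2) ^+ 2) -
      (c + (w0 * (t.1.1 + a0) + w1 * (t.1.2 + a1) + w2 * (t.2 + a2))) ^+ 2 <=
    F (c + (w0 * (t.1.1 + a0) + w1 * (t.1.2 + a1) + w2 * (t.2 + a2)))] =
  (\int[@lebesgue_measure R]_x
     (disc_area R * Num.max (F (h * x + c) + (h * x + c) ^+ 2 - 1 - x ^+ 2) 0)%:E)%E.
Proof.
move=> mF w2E.
pose G (u n : R) : Prop := 1 + n - (c + u) ^+ 2 <= F (c + u).
have mG (v0 v1 v2 : R) : @measurable _ (space R)
     [set t | G (v0 * t.1.1 + v1 * t.1.2 + v2 * t.2) (t.1.1 ^+ 2 + t.1.2 ^+ 2 + t.2 ^+ 2)].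
  have ml : measurable_fun setT (fun t : space R => c + (v0 * t.1.1 + v1 * t.1.2 + v2 * t.2) : measurableTypeR R).
    by measurable_poly.
  have mf : measurable_fun setT (fun t : space R =>
      (1 + (t.1.1 ^+ 2 + t.1.2 ^+ 2 + t.2 ^+ 2)) -
      ((c + (v0 * t.1.1 + v1 * t.1.2 + v2 * t.2)) ^+ 2 +
       F (c + (v0 * t.1.1 + v1 * t.1.2 + v2 * t.2))) : measurableTypeR R).
    apply: measurable_funB; first by measurable_poly.
    by apply: measurable_funD; [exact: measurable_funX|exact: measurableT_comp].
  have := mf measurableT _ (measurable_itv `]-oo, 0]); rewrite setTI.
  congr measurable; apply/seteqP; split => p /=; rewrite in_itv /= /G; lra.
have [h [h2 hE]] := lebesgue3_axis w0 w1 w2 mG.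
exists h; split; first by rewrite h2.
have [_ /(_ _ (mG w0 w1 w2))] := lebesgue3_translation a0 a1 a2.
rewrite mul1e hE => E.
transitivity (lebesgue3 [set t : R * R * R | G (h * t.2) (t.1.1 ^+ 2 + t.1.2 ^+ 2 + t.2 ^+ 2)]).
  by rewrite -E; congr (lebesgue3 _).
rewrite -lebesgue3_discs; last first.
  have ml : measurable_fun setT (fun x : R => h * x + c) by measurable_poly.
  apply: measurable_funB; last by measurable_poly.
  apply: measurable_funB; last by measurable_poly.
  by apply: measurable_funD; [exact: measurableT_comp|exact: measurable_funX].
by congr (lebesgue3 _); apply/seteqP; split => -[[x y] z]; rewrite /G /= [c + _]addrC; lra.
Qed.

(** * From section areas to the section relation *)

Lemma integral_quadratic (R : realType) (u v w a b : R) : a <= b ->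
  (\int[@lebesgue_measure R]_(x in `[a, b]) (u + v * x + w * x ^+ 2)%:E =
   (u * (b - a) + v * (b ^+ 2 - a ^+ 2) / 2 + w * (b ^+ 3 - a ^+ 3) / 3)%:E)%E.
Proof.
rewrite le_eqVlt => /predU1P[<-|ab].
  by rewrite set_itv1 integral_set1 !subrr !mulr0 !mul0r !addr0.
pose p : {poly R} := u%:P + v *: 'X + w *: 'X^2.
pose q : {poly R} := u *: 'X + (v / 2) *: 'X^2 + (w / 3) *: 'X^3.
have pE x : u + v * x + w * x ^+ 2 = p.[x] by rewrite !hornerE.
have dq : q^`()%R = p.
  rewrite /q /p !derivD !derivZ derivX !derivXn /= -mul_polyC mulr1.
  rewrite -(scaler_nat 2 'X^1) -(scaler_nat 3 'X^2) !scalerA.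
  by congr (_ + _ *: _ + _ *: _); field.
rewrite (_ : (fun x => _) = (fun x => (p.[x])%:E)); last by apply/funext => x; rewrite pE.
rewrite (@continuous_FTC2 R (horner p) (horner q) a b ab).
- have qE x : q.[x] = u * x + v / 2 * x ^+ 2 + w / 3 * x ^+ 3 by rewrite /q !(hornerE, hornerXn).
  by rewrite -EFinB !qE; congr EFin; field.
- by apply: continuous_subspaceT => x; exact: continuous_horner.
- split; first by move=> x _; exact: derivable_horner.
  + by apply: cvg_at_right_filter; exact: continuous_horner.
  + by apply: cvg_at_left_filter; exact: continuous_horner.
- by move=> x _; rewrite -derivE dq.
Qed.

(** First-order condition at an interior minimum, for the polynomial that remains once the area
    inequality is cleared of denominators. *)
Lemma cubic_ge0_linear_eq0 (R : realType) (a1 a2 a3 e : R) : 0 < e ->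
  (forall t, `|t| <= e -> 0 <= a1 * t + a2 * t ^+ 2 + a3 * t ^+ 3) -> a1 = 0.
Proof.
have pos (b1 b2 b3 d : R) : 0 < d ->
    (forall t, `|t| <= d -> 0 <= b1 * t + b2 * t ^+ 2 + b3 * t ^+ 3) -> b1 <= 0.
  move=> d0 H; rewrite leNgt; apply/negP => b10.
  pose m := `|b2| + `|b3| + 1.
  have m0 : 0 < m by rewrite ltr_wpDl // addr_ge0.
  (* [t] is so small that at [-t] the quadratic and cubic terms stay below half of the linear
     one. *)
  pose t := Num.min (Num.min d 1) (b1 / (2 * m)).
  have bm : 0 < b1 / (2 * m) by rewrite divr_gt0 // mulr_gt0.
  have t0 : 0 < t by rewrite !lt_min d0 ltr01 bm.
  have td : t <= d by rewrite !ge_min lexx.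
  have t1 : t <= 1 by rewrite !ge_min lexx orbT.
  have tb : t <= b1 / (2 * m) by rewrite ge_min lexx orbT.
  have := H (- t); rewrite normrN gtr0_norm // => /(_ td).
  have tm : t * m <= b1 / 2.
    have : t * m <= b1 / (2 * m) * m by rewrite ler_pM2r.
    by rewrite [leRHS](_ : _ = b1 / 2) //; field; rewrite gt_eqF.
  have h2 : b2 <= `|b2| := ler_norm _.
  have h3 : - b3 <= `|b3| by rewrite -normrN ler_norm.
  have n2 := normr_ge0 b2; have n3 := normr_ge0 b3.
  have : b2 * t <= `|b2| * t by rewrite ler_pM2r.
  have h4 : - b3 * t * t <= `|b3| * t.
    apply: (@le_trans _ _ (`|b3| * t * t)).
      by rewrite ler_pM2r // ler_pM2r.
    by rewrite -[leRHS]mulr1 ler_wpM2l // mulr_ge0 // ltW.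
  move=> h5 h6.
  have : 0 <= - b1 + b2 * t + - b3 * t * t.
    have := h6; rewrite (_ : _ + _ = t * (- b1 + b2 * t + - b3 * t * t)); last by ring.
    by rewrite pmulr_rge0.
  rewrite /m in tm; lra.
move=> e0 H; apply/eqP; rewrite eq_le (pos _ _ _ _ e0 H) /=.
rewrite -oppr_le0; apply: (pos _ a2 (- a3) _ e0) => t te.
have := H (- t); rewrite normrN => /(_ te); rewrite sqrrN.
by rewrite (_ : a1 * - t + _ + _ = - a1 * t + a2 * t ^+ 2 + - a3 * t ^+ 3) //; ring.
Qed.

Lemma integral_chord (R : realType) (F g : R -> R) (x1 x2 : R) :
  (forall x, g x <= F x <-> x1 <= x <= x2) ->
  (\int[@lebesgue_measure R]_x (Num.max (F x - g x) 0)%:E =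
   \int[@lebesgue_measure R]_(x in `[x1, x2]) (Num.max (F x - g x) 0)%:E)%E.
Proof.
move=> H; rewrite [RHS]integral_mkcond; apply: eq_integral => x _.
rewrite patchE; case: ifPn => //; rewrite notin_setE /= in_itv /= => hx.
congr EFin; apply/max_idPr; rewrite subr_le0 leNgt; apply/negP => h.
by apply: hx; apply/H; exact: ltW.
Qed.

(** The left side is the integral of [F] over [[x1, x2]], where [F >= g]; the right side is at least
    that, since [max (F - g') 0 + g' >= F]. *)
Lemma section_comparison (R : realType) (F g g' : R -> R) (x1 x2 I I' J J' : R) :
  measurable_fun setT F -> measurable_fun setT g -> measurable_fun setT g' ->
  (forall x, 0 <= g x) -> (forall x, 0 <= g' x) ->
  (forall x, g x <= F x <-> x1 <= x <= x2) ->
  (\int[@lebesgue_measure R]_x (Num.max (F x - g x) 0)%:E = I%:E)%E ->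
  (\int[@lebesgue_measure R]_x (Num.max (F x - g' x) 0)%:E = I'%:E)%E ->
  (\int[@lebesgue_measure R]_(x in `[x1, x2]) (g x)%:E = J%:E)%E ->
  (\int[@lebesgue_measure R]_(x in `[x1, x2]) (g' x)%:E = J'%:E)%E ->
  I + J <= I' + J'.
Proof.
move=> mF mg mg' g0 g0' H EI EI' EJ EJ'.
have mm (f : R -> R) : measurable_fun setT f ->
    measurable_fun setT (fun x => (Num.max (F x - f x) 0)%:E).
  move=> mf; apply/measurable_EFinP; apply: measurable_maxr => //.
  exact: measurable_funB.
have mE (f : R -> R) : measurable_fun setT f -> measurable_fun setT (fun x => (f x)%:E).
  by move=> mf; exact/measurable_EFinP.
have n0 (f : R -> R) x : (0 <= (Num.max (F x - f x) 0)%:E)%E.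
  by rewrite lee_fin le_max lexx orbT.
rewrite -lee_fin !EFinD -EI -EJ -EJ' (integral_chord H).
have sub : (\int[@lebesgue_measure R]_(x in `[x1, x2]) (Num.max (F x - g' x) 0)%:E <= I'%:E)%E.
  rewrite -EI'; apply: ge0_subset_integral => //; exact: mm.
apply: le_trans (leeD2r _ sub).
have mi : measurable (`[x1, x2]%classic : set R) by exact: measurable_itv.
rewrite -!ge0_integralD //; try (by move=> x _; rewrite lee_fin);
  try (by apply: measurable_funTS; exact: mm); try (by apply: measurable_funTS; exact: mE).
apply: ge0_le_integral => //;
  try (by move=> ? ?; rewrite adde_ge0 // lee_fin);
  try (by apply: measurable_funTS; apply: emeasurable_funD; [exact: mm|exact: mE]).
move=> x /=; rewrite in_itv /= => /H h; rewrite -!EFinD lee_fin.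
rewrite [X in X + _](_ : _ = F x - g x); last by apply/max_idPl; rewrite subr_ge0.
have : F x - g' x <= Num.max (F x - g' x) 0 by rewrite le_max lexx.
lra.
Qed.

(* For fixed [x1], [x2], the integral of [F - g k] over [[x1, x2]] is at most the area at [k],
   with equality at [k = c]; so the derivative in [k] of the difference vanishes at [c]. *)
Lemma section_relation_of_areas (R : realType) (F : R -> R) (r : R) :
  measurable_fun setT F ->
  (forall c, c ^+ 2 < 1 ->
    (\int[@lebesgue_measure R]_x (Num.max (F x - (1 - c * x) ^+ 2 / (1 - c ^+ 2)) 0)%:E)%E =
    (4 / 3 * r ^+ 3 * Num.sqrt (1 - c ^+ 2))%:E) ->
  section_relation (fun x y => y ^+ 2 <= F x) r.
Proof.
move=> mF HI c s a b s0 cs a0 b0 [_ _ hch].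
have s2 : s ^+ 2 = 1 - c ^+ 2 by rewrite -cs; ring.
have s20 : 0 < s ^+ 2 by rewrite exprn_gt0.
have c1 : c ^+ 2 < 1 by lra.
have sqs : Num.sqrt (1 - c ^+ 2) = s by rewrite -s2 sqrtr_sqr gtr0_norm.
set x1 := c - b * s in hch; set x2 := c + a * s in hch.
have x12 : x1 <= x2.
  have := mulr_ge0 a0 (ltW s0); have := mulr_ge0 b0 (ltW s0); rewrite /x1 /x2; lra.
pose g (k x : R) := (1 - k * x) ^+ 2 / (1 - k ^+ 2).
have mg k : measurable_fun setT (g k).
  apply: measurable_funM; last exact: measurable_cst.
  apply: measurable_funX; apply: measurable_funB; first exact: measurable_cst.
  by apply: measurable_funM; [exact: measurable_cst|exact: measurable_id].
have g0 k x : k ^+ 2 < 1 -> 0 <= g k x.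
  by move=> k1; rewrite divr_ge0 ?sqr_ge0 // subr_ge0 ltW.
pose X1 := x2 - x1; pose X2 := x2 ^+ 2 - x1 ^+ 2; pose X3 := (x2 ^+ 3 - x1 ^+ 3) / 3.
pose P k := X1 - k * X2 + k ^+ 2 * X3.
have Jk k : k ^+ 2 < 1 ->
    (\int[@lebesgue_measure R]_(x in `[x1, x2]) (g k x)%:E = (P k / (1 - k ^+ 2))%:E)%E.
  move=> k1; have d0 : 1 - k ^+ 2 != 0 by rewrite gt_eqF // subr_gt0.
  have -> : (fun x => (g k x)%:E) = (fun x => ((1 - k ^+ 2)^-1 +
      (- 2 * k / (1 - k ^+ 2)) * x + (k ^+ 2 / (1 - k ^+ 2)) * x ^+ 2)%:E).
    by apply/funext => x; congr EFin; rewrite /g; field.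
  by rewrite integral_quadratic //; congr EFin; rewrite /P /X1 /X2 /X3; field.
have cmp k : k ^+ 2 < 1 ->
    4 / 3 * r ^+ 3 * s + P c / s ^+ 2 <=
    4 / 3 * r ^+ 3 * Num.sqrt (1 - k ^+ 2) + P k / (1 - k ^+ 2).
  move=> k1.
  apply: (@section_comparison _ F (g c) (g k) x1 x2) => //.
  - by move=> x; exact: g0.
  - by move=> x; exact: g0.
  - by move=> x; rewrite -hch /g -s2 expr_div_n.
  - by rewrite HI // sqs.
  - exact: HI.
  - by rewrite Jk // s2.
  - exact: Jk.
have r0 : 0 <= r ^+ 3.
  have : (0 <= (4 / 3 * r ^+ 3 * Num.sqrt (1 - 0 ^+ 2))%:E)%E.
    rewrite -HI ?expr0n //; apply: integral_ge0 => x _.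
    by rewrite lee_fin le_max lexx orbT.
  by rewrite expr0n subr0 sqrtr1 mulr1 lee_fin; lra.
pose A := 4 / 3 * r ^+ 3.
have A0 : 0 <= A by rewrite mulr_ge0.
(* The concave function [sqrt (1 - k^2)] lies below its tangent at [c], by
   [(1 - c^2) (1 - k^2) <= (1 - c k)^2]. Replacing it makes the inequality polynomial and keeps
   equality at [k = c]. *)
have cmp2 k : k ^+ 2 < 1 ->
    (A * s + P c / s ^+ 2) * (1 - k ^+ 2) <= A * (1 - c * k) / s * (1 - k ^+ 2) + P k.
  move=> k1; have d0 : 0 < 1 - k ^+ 2 by rewrite subr_gt0.
  have h : Num.sqrt (1 - k ^+ 2) <= (1 - c * k) / s.
    rewrite ler_pdivlMr // -sqs -sqrtrM ?(ltW d0) //.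
    have ck : 0 <= 1 - c * k by nra.
    rewrite -(ger0_norm ck) -sqrtr_sqr ler_wsqrtr //.
    by have := sqr_ge0 (c - k); rewrite !expr2; lra.
  have h2 : A * Num.sqrt (1 - k ^+ 2) <= A * ((1 - c * k) / s) by rewrite ler_wpM2l.
  have := cmp k k1; rewrite -/A => h3.
  have h4 : A * s + P c / s ^+ 2 <= A * (1 - c * k) / s + P k / (1 - k ^+ 2) by lra.
  have : (A * s + P c / s ^+ 2) * (1 - k ^+ 2) <=
      (A * (1 - c * k) / s + P k / (1 - k ^+ 2)) * (1 - k ^+ 2) by rewrite ler_pM2r.
  by rewrite [leRHS]mulrDl divfK // gt_eqF.
pose B := A * s + P c / s ^+ 2.
have s0' : s != 0 by rewrite gt_eqF.
(* With [k = c + t] the difference is a cubic in [t] without constant term, whose linear coefficient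
   is the left side here; the radius [(1 - |c|) / 2] keeps [k^2 < 1]. *)
have lin : - A * c * s - X2 + 2 * c * X3 + 2 * c * P c / s ^+ 2 = 0.
  apply: (@cubic_ge0_linear_eq0 _ _ (2 * A * c ^+ 2 / s + X3 + P c / s ^+ 2) (A * c / s) ((1 - `|c|) / 2)).
    by rewrite divr_gt0 // subr_gt0 ltr_norml; apply/andP; split; nra.
  move=> t ht.
  have k1 : (c + t) ^+ 2 < 1.
    have c1' : `|c| < 1 by rewrite ltr_norml; apply/andP; split; nra.
    have : `|c + t| < 1 by apply: le_lt_trans (ler_normD _ _) _; lra.
    by rewrite ltr_norml => /andP[? ?]; nra.
  have := cmp2 _ k1; rewrite -/B -subr_ge0.
  have e1 : 1 - c * (c + t) = s ^+ 2 - c * t by rewrite s2; ring.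
  have e2 : 1 - (c + t) ^+ 2 = s ^+ 2 - 2 * c * t - t ^+ 2 by rewrite s2; ring.
  have e3 : P (c + t) = P c + t * (- X2 + 2 * c * X3) + t ^+ 2 * X3 by rewrite /P; ring.
  rewrite e1 e2 e3 /B; move: (P c) => p.
  by congr (0 <= _); field.
have s30 : s ^+ 3 != 0 by rewrite expf_neq0.
apply: (mulIf s30); rewrite mul0r.
pose L := - A * c * s - X2 + 2 * c * X3 + 2 * c * P c / s ^+ 2.
have N0 : c ^+ 2 + s ^+ 2 - 1 = 0 by rewrite cs subrr.
(* The relation times [s^3] is [3 s^2 L] up to a multiple of [c^2 + s^2 - 1]. *)
transitivity (3 * (s ^+ 2 * L) -
  3 * (c ^+ 2 + s ^+ 2 - 1) * (2 * c * X3 - X2 + s ^+ 2 * (a ^+ 2 - b ^+ 2))).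
  by rewrite /L /P /A /X1 /X2 /X3 /x1 /x2; field.
by rewrite N0 /L lin !mulr0 mul0r subr0.
Qed.

(** The substitution [X = h x + c] turns [X^2 - 1 - x^2] into [- (1 - c X)^2 / (1 - c^2)], minus the
    squared height of the tangent line at abscissa [X]; its Jacobian is the source of
    [sqrt (1 - c^2)]. *)
Lemma section_area_of_volume (R : realType) (F : R -> R) (c h A : R) :
  measurable_fun setT F -> c ^+ 2 < 1 -> h ^+ 2 = 1 - c ^+ 2 ->
  (\int[@lebesgue_measure R]_x
     (disc_area R * Num.max (F (h * x + c) + (h * x + c) ^+ 2 - 1 - x ^+ 2) 0)%:E)%E = A%:E ->
  (\int[@lebesgue_measure R]_x (Num.max (F x - (1 - c * x) ^+ 2 / (1 - c ^+ 2)) 0)%:E)%E =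
  (A / disc_area R * Num.sqrt (1 - c ^+ 2))%:E.
Proof.
move=> mF c1 h2; have [k0 _] := disc_areaE R; set k := disc_area R in k0 *.
have d0 : 1 - c ^+ 2 != 0 by rewrite gt_eqF // subr_gt0.
have h0 : h != 0 by rewrite -sqrf_eq0 h2.
pose f x := (Num.max (F x - (1 - c * x) ^+ 2 / (1 - c ^+ 2)) 0)%:E : \bar R.
have mf : measurable_fun setT f.
  apply/measurable_EFinP; apply: measurable_maxr => //; apply: measurable_funB => //.
  apply: measurable_funM; last exact: measurable_cst.
  apply: measurable_funX; apply: measurable_funB; first exact: measurable_cst.
  by apply: measurable_funM; [exact: measurable_cst|exact: measurable_id].
have f0 x : (0 <= f x)%E by rewrite lee_fin le_max lexx orbT.
have -> : (fun x => (k * Num.max (F (h * x + c) + (h * x + c) ^+ 2 - 1 - x ^+ 2) 0)%:E) =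
    (fun x => k%:E * f (h * x + c)%R)%E.
  apply/funext => x; rewrite /f -EFinM; congr (k * Num.max _ 0)%:E.
  have -> : F (h * x + c) + (h * x + c) ^+ 2 - 1 - x ^+ 2 =
      F (h * x + c) + ((h ^+ 2 - 1) * x ^+ 2 + 2 * h * c * x - (1 - c ^+ 2)) by ring.
  congr (_ + _); apply: (mulIf d0); rewrite mulNr divfK //.
  have -> : (1 - c * (h * x + c)) ^+ 2 = (1 - c ^+ 2) ^+ 2 -
      2 * (1 - c ^+ 2) * c * h * x + c ^+ 2 * h ^+ 2 * x ^+ 2 by ring.
  by rewrite h2; ring.
have mfh : measurable_fun setT (fun x : R => f (h * x + c)).
  apply: measurableT_comp => //; apply: measurable_funD; last exact: measurable_cst.
  by apply: measurable_funM; [exact: measurable_cst|exact: measurable_id].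
rewrite ge0_integralZl //; last by rewrite lee_fin ltW.
rewrite integral_affine // -/f => E.
have hn : 0 < `|h| by rewrite normr_gt0.
have -> : Num.sqrt (1 - c ^+ 2) = `|h| by rewrite -h2 sqrtr_sqr.
have -> : (A / k * `|h|)%:E = ((`|h| / k)%:E * A%:E)%E by rewrite -EFinM; congr EFin; ring.
rewrite -E !muleA -!EFinM.
have -> : `|h| / k * k * `|h|^-1 = 1 by field; rewrite ?gt_eqF.
by rewrite mul1e.
Qed.

(** This is the section orthogonal to the axis, a ball of radius [sqrt z]. *)
Lemma section_radius_of_volume (R : realType) (z A : R) : 0 <= z ->
  (\int[@lebesgue_measure R]_x (disc_area R * Num.max (z - x ^+ 2) 0)%:E)%E = A%:E ->
  A = 4 / 3 * disc_area R * Num.sqrt z ^+ 3.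
Proof.
move=> z0; have [k0 _] := disc_areaE R; set k := disc_area R in k0 *.
set q := Num.sqrt z; have q0 : 0 <= q by exact: sqrtr_ge0.
have q2 : q ^+ 2 = z by rewrite sqr_sqrtr.
have mf : measurable_fun setT (fun x : R => (Num.max (z - x ^+ 2) 0)%:E).
  apply/measurable_EFinP; apply: measurable_maxr => //; apply: measurable_funB => //.
have H x : x ^+ 2 <= z <-> - q <= x <= q.
  by rewrite -q2 -ler_norml -[x ^+ 2]real_normK ?num_real // ler_sqr ?nnegrE.
under eq_integral => x _ do rewrite EFinM.
rewrite ge0_integralZl //; last by rewrite lee_fin ltW.
  rewrite (integral_chord (F := fun=> z) H).
  have -> : (\int[@lebesgue_measure R]_(x in `[(- q)%R, q]) (Num.max (z - x ^+ 2) 0)%:E)%E =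
      (\int[@lebesgue_measure R]_(x in `[(- q)%R, q]) (z + 0 * x + (-1) * x ^+ 2)%:E)%E.
    apply: eq_integral => x; rewrite inE /= in_itv /= => /H h; congr EFin.
    by rewrite mul0r addr0 mulN1r; apply/max_idPl; rewrite subr_ge0.
  rewrite integral_quadratic; last by lra.
  by rewrite -EFinM => -[<-]; rewrite -q2; field.
by move=> x _; rewrite lee_fin le_max lexx orbT.
Qed.

(** * Bodies of revolution *)

Lemma dotrE (R : realType) n (x y : 'rV[R]_n) : dotr x y = (x *m y^T) ord0 ord0.
Proof. by rewrite mxE; apply: eq_bigr => i _; rewrite mxE. Qed.

Lemma dotrC (R : realType) n (x y : 'rV[R]_n) : dotr x y = dotr y x.
Proof. by apply: eq_bigr => i _; rewrite mulrC. Qed.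

Lemma dotrDl (R : realType) n (x y z : 'rV[R]_n) : dotr (x + y) z = dotr x z + dotr y z.
Proof. by rewrite !dotrE mulmxDl mxE. Qed.

Lemma dotrZl (R : realType) n k (x z : 'rV[R]_n) : dotr (k *: x) z = k * dotr x z.
Proof. by rewrite !dotrE -scalemxAl mxE. Qed.

Lemma dotrDr (R : realType) n (x y z : 'rV[R]_n) : dotr x (y + z) = dotr x y + dotr x z.
Proof. by rewrite dotrC dotrDl ![dotr _ x]dotrC. Qed.

Lemma dotrZr (R : realType) n k (x z : 'rV[R]_n) : dotr x (k *: z) = k * dotr x z.
Proof. by rewrite dotrC dotrZl dotrC. Qed.

Lemma dotrNl (R : realType) n (x z : 'rV[R]_n) : dotr (- x) z = - dotr x z.
Proof. by rewrite -scaleN1r dotrZl mulN1r. Qed.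

Lemma dotrNr (R : realType) n (x z : 'rV[R]_n) : dotr x (- z) = - dotr x z.
Proof. by rewrite dotrC dotrNl dotrC. Qed.

Lemma dotr0l (R : realType) n (z : 'rV[R]_n) : dotr 0 z = 0.
Proof. by rewrite -[0 in LHS](scale0r 0) dotrZl mul0r. Qed.

Definition dotrL := (dotrDl, dotrDr, dotrNl, dotrNr, dotrZl, dotrZr).

Lemma dotr_ge0 (R : realType) n (x : 'rV[R]_n) : 0 <= dotr x x.
Proof. by apply: sumr_ge0 => i _; rewrite -expr2 sqr_ge0. Qed.

Lemma dotr_eq0 (R : realType) n (x : 'rV[R]_n) : (dotr x x == 0) = (x == 0).
Proof.
apply/idP/eqP => [|->]; last by rewrite dotr0l.
rewrite psumr_eq0 => [/allP h|i _]; last by rewrite -expr2 sqr_ge0.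
apply/rowP => i; have := h i; rewrite mem_index_enum => /(_ isT).
by rewrite mulf_eq0 orbb => /eqP ->; rewrite mxE.
Qed.

Lemma dotr_gt0 (R : realType) n (x : 'rV[R]_n) : x != 0 -> 0 < dotr x x.
Proof. by move=> x0; rewrite lt_neqAle eq_sym dotr_eq0 x0 dotr_ge0. Qed.

Lemma row_scalar (R : realType) n (x y : 'rV[R]_n) : x *m y^T = (dotr x y)%:M.
Proof. by rewrite [LHS]mx11_scalar dotrE. Qed.

(** Two block factorizations of the matrix with blocks [1], [u], [v], [1] give two values of its
    determinant. *)
Lemma det_rank1_update (R : realType) n (u : 'cV[R]_n) (v : 'rV[R]_n) :
  \det (1%:M - u *m v) = 1 - (v *m u) ord0 ord0.
Proof.
pose A := block_mx (1%:M : 'M[R]_n) u v (1%:M : 'M[R]_1).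
transitivity (\det A).
  have -> : A = block_mx 1%:M u 0 1%:M *m block_mx (1%:M - u *m v) 0 v 1%:M.
    by rewrite mulmx_block !mul1mx !mul0mx !mulmx1 !add0r subrK.
  by rewrite det_mulmx det_ublock det_lblock !det1 !mul1r mulr1.
have -> : A = block_mx 1%:M 0 v 1%:M *m block_mx 1%:M u 0 (1%:M - v *m u).
  by rewrite mulmx_block !mul1mx !mul0mx !mulmx1 !addr0 addrC subrK.
by rewrite det_mulmx det_ublock det_lblock !det1 !mul1r det_mx11 !mxE eqxx.
Qed.

Definition reflection (R : realType) n (a : 'rV[R]_n) : 'M[R]_n :=
  1%:M - ((2 / dotr a a) *: a^T) *m a.

Lemma mul_reflection (R : realType) n (a x : 'rV[R]_n) :
  x *m reflection a = x - (2 * dotr x a / dotr a a) *: a.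
Proof.
rewrite mulmxBr mulmx1 mulmxA -scalemxAr row_scalar -scalemxAl mul_scalar_mx scalerA.
by congr (_ - _ *: _); ring.
Qed.

Lemma det_reflection (R : realType) n (a : 'rV[R]_n) : a != 0 -> \det (reflection a) = -1.
Proof.
move=> /dotr_gt0 a0; rewrite det_rank1_update -scalemxAr row_scalar !mxE eqxx.
by rewrite mulr1n; field; rewrite gt_eqF.
Qed.

Lemma reflection_orthogonal (R : realType) n (a : 'rV[R]_n) : a != 0 ->
  reflection a *m (reflection a)^T = 1%:M.
Proof.
move=> /dotr_gt0 a0.
have -> : (reflection a)^T = reflection a.
  by rewrite /reflection linearB /= trmx1 trmx_mul linearZ /= trmxK -scalemxAl -scalemxAr.
apply/row_matrixP => i; rewrite row_mul row1 mul_reflection rowE mul_reflection.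
set x := delta_mx _ _; rewrite dotrDl dotrNl dotrZl -addrA -opprD -scalerDl.
rewrite [X in X *: a](_ : _ = 0) ?scale0r ?subr0 //.
by field; rewrite gt_eqF.
Qed.

(** Three linear conditions in dimension 4 leave a nonzero kernel. *)
Lemma orthogonal_vector (R : realType) (a b c : 'rV[R]_4) :
  exists m : 'rV[R]_4, [/\ m != 0, dotr m a = 0, dotr m b = 0 & dotr m c = 0].
Proof.
pose B : 'M[R]_(4, 1 + (1 + 1)) := row_mx a^T (row_mx b^T c^T).
have k0 : kermx B != 0.
  rewrite -mxrank_eq0 mxrank_ker subn_eq0 -ltnNge.
  exact: leq_ltn_trans (rank_leq_col B) _.
exists (nz_row (kermx B)).
have m0 : nz_row (kermx B) *m B = 0.
  by apply/eqP; rewrite -sub_kermx nz_row_sub.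
move: m0; rewrite !mul_mx_row !row_scalar => h.
have z (d : R) : (d%:M : 'M[R]_1) = 0 -> d = 0.
  by move=> /matrixP /(_ ord0 ord0); rewrite !mxE eqxx mulr1n.
split; first by rewrite nz_row_eq0.
- by apply: z; rewrite -[LHS](row_mxKl _ (row_mx (dotr (nz_row (kermx B)) b)%:M (dotr (nz_row (kermx B)) c)%:M)) h linear0.
- apply: z; have := congr1 rsubmx h; rewrite row_mxKr linear0 => h2.
  by have := congr1 lsubmx h2; rewrite row_mxKl linear0.
- apply: z; have := congr1 rsubmx h; rewrite row_mxKr linear0 => h2.
  by have := congr1 rsubmx h2; rewrite row_mxKr linear0.
Qed.

Lemma unit_vector (R : realType) n (m : 'rV[R]_n) : m != 0 ->
  exists k : R, k != 0 /\ dotr (k *: m) (k *: m) = 1.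
Proof.
move=> m0; have d0 := dotr_gt0 m0.
have q0 : 0 < Num.sqrt (dotr m m) by rewrite sqrtr_gt0.
exists (Num.sqrt (dotr m m))^-1; rewrite invr_eq0 gt_eqF // dotrL; split=> //.
rewrite dotrZr -{3}(sqr_sqrtr (ltW d0)); field; by rewrite gt_eqF.
Qed.

Lemma orthogonal_unit (R : realType) (a b c : 'rV[R]_4) :
  exists m : 'rV[R]_4, [/\ dotr m m = 1, dotr m a = 0, dotr m b = 0 & dotr m c = 0].
Proof.
have [m [m0 ma mb mc]] := orthogonal_vector a b c.
have [k [_ k1]] := unit_vector m0; exists (k *: m).
by split; rewrite // dotrZl ?ma ?mb ?mc mulr0.
Qed.

(* Composing with a reflection in a direction orthogonal to the moved vectors makes the
   determinant 1. *)
Lemma rotation_moving (R : realType) (e z z' : 'rV[R]_4) :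
  dotr z e = 0 -> dotr z' e = 0 -> dotr z z = dotr z' z' ->
  exists Q : 'M[R]_4, [/\ rotation_mx Q, e *m Q = e & z *m Q = z'].
Proof.
move=> ze z'e zz.
have [->|nz] := eqVneq z z'.
  exists 1%:M; rewrite !mulmx1; split => //; split; last exact: det1.
  by rewrite trmx1 mulmx1.
have n0 : z - z' != 0 by rewrite subr_eq0.
have [m [m0 me mz mz']] := orthogonal_vector e z z'.
have fix_m x : dotr m x = 0 -> x *m reflection m = x.
  by move=> mx; rewrite mul_reflection dotrC mx mulr0 mul0r scale0r subr0.
exists (reflection (z - z') *m reflection m); split.
- split; last by rewrite det_mulmx !det_reflection // mulrNN mulr1.
  by rewrite trmx_mul mulmxA -[X in X *m _]mulmxA reflection_orthogonal // mulmx1 reflection_orthogonal.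
- have e0 : dotr e (z - z') = 0 by rewrite dotrC dotrDl dotrNl ze z'e subrr.
  by rewrite mulmxA (mul_reflection (z - z') e) e0 mulr0 mul0r scale0r subr0 fix_m.
- rewrite mulmxA (mul_reflection (z - z') z).
  have -> : 2 * dotr z (z - z') / dotr (z - z') (z - z') = 1.
    have d0 := dotr_gt0 n0.
    have -> : 2 * dotr z (z - z') = dotr (z - z') (z - z').
      by rewrite !dotrL -zz [dotr z' z]dotrC; ring.
    by rewrite divff // gt_eqF.
  by rewrite scale1r subKr fix_m.
Qed.

Lemma bounded_steps_eq0 (R : realType) (x d M : R) :
  (forall n : nat, `|x + n%:R * d| <= M) -> d = 0.
Proof.
move=> h; apply/eqP/negPn/negP => d0.
have dp : 0 < `|d| by rewrite normr_gt0.
have [n n0 hn] := archi_nat ((M + `|x|) / `|d|).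
move: hn; rewrite ltr_pdivrMr // ltNge => /negP; apply.
have : `|n%:R * d| <= `|x + n%:R * d| + `|x|.
  by have := ler_normB (x + n%:R * d) x; rewrite addrAC subrr add0r.
rewrite normrM (ger0_norm (ler0n _ _)) => h2; apply: le_trans h2 _.
by rewrite lerD2r.
Qed.

Lemma compact_coord_bounded (R : realType) n (C : set 'rV[R]_n) : compact C ->
  exists M, forall x i, C x -> `|x ord0 i| <= M.
Proof.
move=> /compact_bounded [M [_ hM]]; exists (M + 1) => x i Cx.
have M1 : M < M + 1 by rewrite ltrDl.
have := hM _ M1 x Cx; apply: le_trans.
have -> : `|x| = mx_norm x by [].
rewrite mx_normE -[leLHS]nngE num_le.
exact: (le_bigmax _ (fun ij => `|x ij.1 ij.2|%:nng) (ord0, i)).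
Qed.

Lemma tr_rotation (R : realType) n (Q : 'M[R]_n) : rotation_mx Q -> rotation_mx Q^T.
Proof. by move=> [h d]; split; rewrite ?det_tr // trmxK; exact: mulmx1C. Qed.

(* Conjugating a rotation about the axis by the central symmetry yields a rotation about the
   opposite axis; a composite of the two is a translation by [2 (p - p Q)], which must vanish
   since [C] is bounded. *)
Lemma revolution_axis_center (R : realType) n (C : set 'rV[R]_n) :
  compact C -> C !=set0 -> symmetric_set C -> of_revolution C ->
  exists e : 'rV[R]_n, dotr e e = 1 /\
    forall Q x, rotation_mx Q -> e *m Q = e -> C x -> C (x *m Q).
Proof.
move=> cC [x0 Cx0] sC [p [e [e0 rC]]].
have CN x : C x -> C (- x) by move=> Cx; rewrite -sC; exists x.
have [M hM] := compact_coord_bounded cC.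
have [k [k0 k1]] := unit_vector e0.
exists (k *: e); split => // Q x rQ eQ Cx.
have {}eQ : e *m Q = e.
  by apply: (scalerI k0); rewrite scalemxAl.
have eQT : e *m Q^T = e by rewrite -{1}eQ -mulmxA (proj1 rQ) mulmx1.
have rQT := tr_rotation rQ.
have act S y : rotation_mx S -> e *m S = e -> C y -> C (p + (y - p) *m S).
  by move=> rS eS Cy; rewrite -(rC S rS eS); exists y.
have pQ : p = p *m Q.
  pose d := 2 *: (p - p *m Q).
  have step y : C y -> C (y + d).
    move=> /CN /(act _ _ rQT eQT) /CN /(act _ _ rQ eQ).
    have QQ : Q^T *m Q = 1%:M by apply: mulmx1C; have [] := rQ.
    rewrite !(mulmxDl, mulNmx) -!mulmxA QQ !mulmx1.
    rewrite (_ : p + _ = y + d) //.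
    by rewrite /d; apply/rowP => i; rewrite !mxE; ring.
  have steps m : C (x0 + m%:R *: d).
    elim: m => [|m IH]; first by rewrite scale0r addr0.
    by rewrite -natr1 scalerDl scale1r addrA; exact: step.
  have d0 : d = 0.
    apply/rowP => i; rewrite [RHS]mxE; apply: (@bounded_steps_eq0 _ (x0 ord0 i) _ M) => m.
    by have := hM _ i (steps m); rewrite !mxE.
  move/eqP: d0; rewrite scaler_eq0 pnatr_eq0 /= subr_eq0 => /eqP //.
have := act Q x rQ eQ Cx.
by rewrite mulmxBl -pQ addrC subrK.
Qed.

Lemma convex_setP (R : realType) n (C : set 'rV[R]_n) (x y : 'rV[R]_n) (t : R) :
  convex_set C -> 0 <= t -> t <= 1 -> C x -> C y -> C ((1 - t) *: x + t *: y).
Proof.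
move=> cC t0 t1 Cx Cy.
have := cC y x (Itv01 t0 t1) (mem_set Cy) (mem_set Cx).
by rewrite inE /= addrC.
Qed.

(** [e] will be a unit vector of the axis and [v] a unit vector orthogonal to it. *)
Definition meridian (R : realType) (C : set 'rV[R]_4) (e v : 'rV[R]_4) (x y : R) : Prop :=
  C (x *: e + y *: v).

(** Rotations about the axis act transitively on orthogonal components of equal length, so
    membership depends only on the axial coordinate and that length. *)
Lemma revolution_transfer (R : realType) (C : set 'rV[R]_4) (e : 'rV[R]_4)
    (rC : forall Q x, rotation_mx Q -> e *m Q = e -> C x -> C (x *m Q)) x z z' :
  dotr z e = 0 -> dotr z' e = 0 ->
  dotr z z = dotr z' z' -> C (x *: e + z) -> C (x *: e + z').
Proof.
move=> ze z'e zz Cz; have [Q [rQ eQ zQ]] := rotation_moving ze z'e zz.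
by have := rC _ _ rQ eQ Cz; rewrite mulmxDl -scalemxAl eQ zQ.
Qed.

Lemma meridian_mem (R : realType) (C : set 'rV[R]_4) (e v : 'rV[R]_4)
    (e1 : dotr e e = 1) (v1 : dotr v v = 1) (ve : dotr v e = 0)
    (rC : forall Q x, rotation_mx Q -> e *m Q = e -> C x -> C (x *m Q)) X y :
  0 <= y -> y ^+ 2 = dotr X X - dotr X e ^+ 2 ->
  C X <-> meridian C e v (dotr X e) y.
Proof.
move=> y0 y2; pose z := X - dotr X e *: e.
have ze : dotr z e = 0 by rewrite dotrDl dotrNl dotrZl e1 mulr1 subrr.
have yve : dotr (y *: v) e = 0 by rewrite dotrZl ve mulr0.
have zz : dotr z z = dotr (y *: v) (y *: v).
  rewrite dotrZl dotrZr v1 mulr1 -expr2 y2 /z dotrDr dotrNr dotrZr -/z ze mulr0 subr0.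
  by rewrite dotrDl dotrNl dotrZl [dotr e X]dotrC expr2.
have XE : X = dotr X e *: e + z by rewrite addrC subrK.
split; first by rewrite {1}XE; exact: (revolution_transfer rC).
by move/(revolution_transfer rC yve ze (esym zz)); rewrite -XE.
Qed.

Lemma dotr_meridian (R : realType) (e v : 'rV[R]_4) (e1 : dotr e e = 1)
    (v1 : dotr v v = 1) (ve : dotr v e = 0) x y :
  dotr (x *: e + y *: v) (x *: e + y *: v) = x ^+ 2 + y ^+ 2.
Proof.
rewrite !(dotrDl, dotrDr, dotrZl, dotrZr) e1 v1 ve [dotr e v]dotrC ve; ring.
Qed.

Lemma meridian_planar_body (R : realType) (C : set 'rV[R]_4) (e v : 'rV[R]_4)
    (e1 : dotr e e = 1) (v1 : dotr v v = 1) (ve : dotr v e = 0)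
    (rC : forall Q x, rotation_mx Q -> e *m Q = e -> C x -> C (x *m Q)) :
  compact C -> convex_set C -> symmetric_set C -> eball 0 1 `<=` C° ->
  planar_body (meridian C e v).
Proof.
move=> cC vC sC bC.
have clC : closed C by apply: compact_closed => //; exact: norm_hausdorff.
have vN y : dotr (y *: v) e = 0 by rewrite dotrZl ve mulr0.
have negy x y : meridian C e v x y -> meridian C e v x (- y).
  by apply: (revolution_transfer rC); rewrite ?vN // !(dotrZl, dotrZr); ring.
have inC x y : x ^+ 2 + y ^+ 2 <= 1 -> C° (x *: e + y *: v).
  by move=> xy; apply: bC; rewrite /eball /enorm /= subr0 dotr_meridian // -sqrtr1 ler_wsqrtr.
split.
- move=> t x y x' y' t0 t1 K1 K2.
  have := convex_setP vC t0 t1 K1 K2; rewrite /meridian; congr C.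
  by rewrite !scalerDr !scalerA addrACA -!scalerDl.
(* Reflection in the first coordinate is the central symmetry composed with reflection in the
   second. *)
- move=> x y K1; rewrite -[y]opprK; apply: negy; rewrite /meridian -sC.
  by exists (x *: e + y *: v) => //; rewrite opprD !scaleNr.
- exact: negy.
- by move=> x y /inC; exact: interior_subset.
- move=> x y xy; have /inC nT : x ^+ 2 + y ^+ 2 <= 1 by rewrite xy.
  have ct : (fun mu : R => mu *: (x *: e + y *: v)) @ (1 : R) --> (x *: e + y *: v).
    rewrite -[X in _ --> X]scale1r.
    by apply: cvgZr_tmp.
  have : \forall mu \near (1 : R), C (mu *: (x *: e + y *: v)) by exact: ct.
  move=> /nbhs_ballP[d /= d0 hd].
  exists (1 + d / 2); first by rewrite ltrDl divr_gt0.
  have := hd (1 + d / 2); rewrite /meridian scalerDr !scalerA; apply.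
  by rewrite -ball_normE /ball_ /= opprD addrA subrr sub0r normrN gtr0_norm ?divr_gt0 // ltr_pdivrMr // ltr_pMr // ltr1n.
- have [M hM] := compact_coord_bounded cC.
  exists (M ^+ 2 *+ 4) => x y Kxy; rewrite -(dotr_meridian e1 v1 ve).
  apply: (@le_trans _ _ (\sum_(i < 4) M ^+ 2)); last by rewrite sumr_const card_ord.
  apply: ler_sum => i _; rewrite -expr2 -[leLHS]real_normK ?num_real //.
  by apply: lerXn2r; rewrite ?nnegrE ?(le_trans _ (hM _ i Kxy)) // hM.
- move=> a b a' b'.
  have ct : continuous (fun t : R => (a *: e + a' *: v) + t *: (b *: e + b' *: v)).
    move=> t; apply: cvgD; first exact: cvg_cst.
    by apply: cvgZr_tmp.
  have := preimage_closed (fun t _ => ct t) clC.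
  congr closed; apply/seteqP; split => t /=; rewrite /meridian !scalerDl !scalerDr !scalerA addrACA //.
Qed.

(** Each slice is empty or a centred closed segment, and [F] is the square of its half-length. The
    superlevel sets of [F] are intervals by convexity, hence measurable. *)
Lemma meridian_profile (R : realType) (K : R -> R -> Prop) : planar_body K ->
  exists F : R -> R, measurable_fun setT F /\ forall x y, y ^+ 2 <= F x <-> K x y.
Proof.
move=> pb; have [B hB] := pb_bounded pb.
have segment x y m : 0 <= m -> K x m -> y ^+ 2 <= m ^+ 2 -> K x y.
  rewrite le_eqVlt => /predU1P[<- Kx|m0 Kx].
    by rewrite expr0n real_exprn_even_le0 ?num_real //= => /eqP ->.
  rewrite -[y ^+ 2]real_normK ?num_real // ler_sqr ?nnegrE ?(ltW m0) // ler_norml => /andP[y1 y2].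
  have t0 : 0 <= (y + m) / (2 * m) by rewrite divr_ge0 ?mulr_ge0 ?(ltW m0) //; lra.
  have t1 : (y + m) / (2 * m) <= 1 by rewrite ler_pdivrMr ?mulr_gt0 //; lra.
  have := pb_convex pb t0 t1 (pb_negy pb Kx) Kx.
  by congr K; field; rewrite gt_eqF.
(* The value [-1] encodes an empty slice; the gap between [-1] and [0] identifies [c <= F x] with
   [K x (sqrt (max c 0))] for every [c > -1]. *)
have ex x : exists z, (z = -1 \/ 0 <= z) /\ forall y, y ^+ 2 <= z <-> K x y.
  have [[y0 Ky0]|hN] := pselect (exists y, K x y); last first.
    exists (-1); split; [by left | move=> y; split => [h|Ky]; last by case: hN; exists y].
    by have := sqr_ge0 y; lra.
  have cl : closed [set y | K x y].
    have := @pb_closed _ _ pb x 0 0 1.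
    by congr closed; apply/seteqP; split => t /=; rewrite mulr0 addr0 add0r mulr1.
  have [|y Ky|m Km hm] := closed_ub_max cl _ (B := 1 + B); first by exists y0.
    have := hB _ _ Ky; have := sqr_ge0 x; have := sqr_ge0 (y - 1); have := sqr_ge0 y.
    clear; move=> /[dup] ? ? h ? ?; have : y ^+ 2 - 2 * y + 1 = (y - 1) ^+ 2 by ring.
    lra.
  have m0 : 0 <= m by have := hm _ (pb_negy pb Km); lra.
  exists (m ^+ 2); split; first by right; exact: sqr_ge0.
  move=> y; split => [|Ky]; first exact: segment m0 Km.
  rewrite -[y ^+ 2]real_normK ?num_real // ler_sqr ?nnegrE // ler_norml hm // andbT.
  by rewrite lerNl; exact: hm (pb_negy pb Ky).
have [F hF] := choice ex.
exists F; split; last by move=> x; have [] := hF x.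
apply: (measurability (@RGenCInfty.G R)) => [|/= _ [_] [c] -> <-].
  exact: RGenCInfty.measurableE.
rewrite setTI; set c' := Num.sqrt (Num.max c 0).
have [c1|c1] := leP c (-1).
  rewrite (_ : _ @^-1` _ = setT) //; apply/seteqP; split => // x _ /=.
  rewrite in_itv /= andbT (le_trans c1) //.
  by have [[->|h] _] := hF x => //; lra.
have E x : (c <= F x) <-> K x c'.
  have [hx hK] := hF x; rewrite -hK sqr_sqrtr ?le_max ?lexx ?orbT // ge_max.
  split=> [h|/andP[]//]; rewrite h /=; case: hx => // hx; lra.
rewrite (_ : _ @^-1` _ = [set x | K x c']); last first.
  by apply/seteqP; split => x /=; rewrite in_itv /= andbT; apply E.
apply: is_interval_measurable => s t /= Ks Kt u /andP[su ut].
have [st|st] := ltP s t; last by rewrite (_ : u = s) //; lra.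
have st0 : 0 < t - s by rewrite subr_gt0.
have t0 : 0 <= (u - s) / (t - s) by rewrite divr_ge0 ?(ltW st0) // subr_ge0.
have t1 : (u - s) / (t - s) <= 1 by rewrite ler_pdivrMr // mul1r lerD2r.
have := pb_convex pb t0 t1 Ks Kt; rewrite -mulrDl subrK mul1r.
by congr (K _ _); field; rewrite gt_eqF.
Qed.

(** * Sections by tangent hyperplanes *)

(** An interior point [x] of the ball on the hyperplane could be scaled by some [mu > 1] within the
    ball, while [|x - u|^2 >= 0] gives [|x| >= 1]. *)
Lemma unit_hyperplane (R : realType) (u : 'rV[R]_4) : dotr u u = 1 ->
  hyperplane [set x | dotr x u = 1] /\ tangent_to [set x | dotr x u = 1] (eball 0 1).
Proof.
move=> u1; split.
  exists u, 1; split => //.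
  by rewrite -dotr_eq0 u1 oner_eq0.
split.
  by exists u; split => //=; rewrite /eball /enorm /= subr0 u1 sqrtr1.
apply/seteqP; split => // x [/= xu].
have ct : (fun mu : R => mu *: x) @ (1 : R) --> x.
  by rewrite -[X in _ --> X]scale1r; apply: cvgZr_tmp.
move=> hx; have : \forall mu \near (1 : R), eball 0 1 (mu *: x) by exact: ct.
move=> /nbhs_ballP[d /= d0 hd].
have : eball 0 1 ((1 + d / 2) *: x).
  apply: hd; rewrite -ball_normE /ball_ /= opprD addrA subrr sub0r normrN gtr0_norm ?divr_gt0 //.
  by rewrite ltr_pdivrMr // ltr_pMr // ltr1n.
set mu := 1 + d / 2; have mu1 : 1 < mu by rewrite ltrDl divr_gt0.
rewrite /eball /enorm /= subr0 -sqrtr1 ler_sqrt // dotrZl dotrZr => h.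
have := dotr_ge0 (x - u); rewrite !dotrL u1 [dotr u x]dotrC xu => h2.
have x1 : 1 <= dotr x x by lra.
have : mu * mu * 1 <= mu * mu * dotr x x by rewrite ler_pM2l // mulr_gt0 //; lra.
have : 1 * mu < mu * mu by rewrite ltr_pM2r //; lra.
rewrite mulrA in h; lra.
Qed.

Lemma orthonormal_frame_exists (R : realType) (u : 'rV[R]_4) : dotr u u = 1 ->
  exists F, orthonormal_frame [set x | dotr x u = 1] F.
Proof.
move=> u1.
have [m1 [n1 m1u _ _]] := orthogonal_unit u u u.
have [m2 [n2 m2u m21 _]] := orthogonal_unit u m1 u.
have [m3 [n3 m3u m31 m32]] := orthogonal_unit u m1 m2.
pose f : 'M[R]_(3, 4) := \matrix_(i < 3) [:: m1; m2; m3]`_i.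
have ff : f *m f^T = 1%:M.
  apply/matrixP => i j; transitivity (dotr ([:: m1; m2; m3]`_i) ([:: m1; m2; m3]`_j)).
    by rewrite mxE; apply: eq_bigr => k _; rewrite !mxE.
  rewrite mxE; case: i => [[|[|[|//]]] ?]; case: j => [[|[|[|//]]] ?] /=;
    by rewrite ?n1 ?n2 ?n3 // ?m21 ?m31 ?m32 // dotrC ?m21 ?m31 ?m32.
have fu : f *m u^T = 0.
  apply/matrixP => i j; rewrite (ord1 j); transitivity (dotr ([:: m1; m2; m3]`_i) u).
    by rewrite mxE; apply: eq_bigr => k _; rewrite !mxE.
  by rewrite mxE; case: i => [[|[|[|//]]] ?] /=.
exists (u, f); split => //; apply/seteqP; split => [_ [t _ <-]|x /= xu].
  by rewrite /frame_map /= dotrE mulmxDl mxE -dotrE u1 -mulmxA fu mulmx0 mxE addr0.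
(* The rows [u] and [f] form an orthogonal matrix, so the reversed product decomposes [x] along [u]
   and [f]. *)
have Mo : col_mx u f *m (col_mx u f)^T = 1%:M :> 'M[R]_(1 + 3).
  rewrite tr_col_mx mul_col_mx !mul_mx_row row_scalar u1 fu ff.
  have -> : u *m f^T = 0 by rewrite -[u]trmxK -trmx_mul fu trmx0.
  exact: esym (scalar_mx_block _ _ _).
have xE : x = u + (x *m f^T) *m f.
  have := mulmx1C Mo; rewrite tr_col_mx mul_row_col => /(congr1 (mulmx x)).
  by rewrite mulmx1 mulmxDr !mulmxA row_scalar xu mul_scalar_mx scale1r => ->.
pose a := x *m f^T.
exists (a ord0 (inord 0), a ord0 (inord 1), a ord0 (inord 2)) => //.
rewrite /frame_map /= [RHS]xE; congr (_ + _ *m _).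
apply/rowP => i; rewrite mxE -/a.
by case: i => [[|[|[|//]]] h] /=; congr (a _ _); apply: val_inj; rewrite /= inordK.
Qed.

(** The frame behind [hyperplane_measure] is an arbitrary orthonormal one, so its origin is written
    [u + a f]; in its coordinates the section is the set of [section_volume], with [w] the
    coordinates of the axis vector. *)
Lemma hyperplane_section (R : realType) (C : set 'rV[R]_4) (e u : 'rV[R]_4) (F : R -> R) :
  dotr e e = 1 -> dotr u u = 1 -> measurable_fun setT F ->
  (forall x, C x <-> dotr x x - dotr x e ^+ 2 <= F (dotr x e)) ->
  exists h, h ^+ 2 = 1 - dotr u e ^+ 2 /\
    hyperplane_measure [set x | dotr x u = 1] (C `&` [set x | dotr x u = 1]) =
    (\int[@lebesgue_measure R]_x (disc_area R *
       Num.max (F (h * x + dotr u e) + (h * x + dotr u e) ^+ 2 - 1 - x ^+ 2) 0)%:E)%E.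
Proof.
move=> e1 u1 mF CF; rewrite /hyperplane_measure.
have := xgetPex (0, 0) (orthonormal_frame_exists u1).
move: (xget _ _) => [p f] [/= ff rg].
have inH t : dotr (frame_map (p, f) t) u = 1.
  have : range (frame_map (p, f)) (frame_map (p, f) t) by exists t.
  by rewrite rg.
have ou : dotr p u = 1.
  rewrite -(inH (0, 0, 0)) /frame_map /=.
  rewrite (_ : \row_i _ = 0) ?mul0mx ?addr0 //.
  by apply/rowP => -[[|[|[|//]]] ?]; rewrite !mxE.
(* All points of the frame lie on the hyperplane, so its directions are orthogonal to [u]. *)
have fu : f *m u^T = 0.
  have fux (y : 'rV[R]_3) : y *m (f *m u^T) = 0.
    have := inH (y ord0 (inord 0), y ord0 (inord 1), y ord0 (inord 2)).
    rewrite /frame_map /= (_ : \row_i _ = y); last first.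
      apply/rowP => i; rewrite mxE.
      by case: i => [[|[|[|//]]] h] /=; congr (y _ _); apply: val_inj; rewrite /= inordK.
    rewrite dotrDl ou -[RHS]addr0 => /addrI h.
    by rewrite mulmxA row_scalar h raddf0.
  by apply/row_matrixP => i; rewrite rowE fux linear0.
have uf : u *m f^T = 0 by rewrite -[u]trmxK -trmx_mul fu trmx0.
have Mo : col_mx u f *m (col_mx u f)^T = 1%:M :> 'M[R]_(1 + 3).
  rewrite tr_col_mx mul_col_mx !mul_mx_row row_scalar u1 fu ff uf.
  exact: esym (scalar_mx_block _ _ _).
have id : u^T *m u + f^T *m f = 1%:M.
  by have := mulmx1C Mo; rewrite tr_col_mx mul_row_col.
pose a := p *m f^T; pose w := e *m f^T; pose c := dotr u e.
have oE : p = u + a *m f.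
  have /(congr1 (mulmx p)) := id.
  by rewrite mulmx1 mulmxDr !mulmxA row_scalar ou mul_scalar_mx scale1r => ->.
have w2 : dotr w w = 1 - c ^+ 2.
  have : e *m (u^T *m u + f^T *m f) *m e^T = e *m e^T by rewrite id mulmx1.
  have wT : f *m e^T = w^T by rewrite trmx_mul trmxK.
  rewrite mulmxDr mulmxDl (mulmxA e u^T) (mulmxA e f^T) -!(mulmxA _ _ e^T) wT -/w.
  rewrite !row_scalar mul_scalar_mx e1 => /matrixP /(_ ord0 ord0).
  by rewrite !mxE eqxx !mulr1n dotrC -/c expr2; lra.
have expand3 (x y : 'rV[R]_3) : dotr x y =
    x ord0 (inord 0) * y ord0 (inord 0) + x ord0 (inord 1) * y ord0 (inord 1) +
    x ord0 (inord 2) * y ord0 (inord 2).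
  rewrite /dotr !big_ord_recl big_ord0 addr0 addrA.
  by congr (_ * _ + _ * _ + _ * _); congr (_ _ _); apply: val_inj; rewrite /= inordK.
have [|h [h2 hV]] := @section_volume _ F c (w ord0 (inord 0)) (w ord0 (inord 1))
  (w ord0 (inord 2)) (a ord0 (inord 0)) (a ord0 (inord 1)) (a ord0 (inord 2)) mF.
  by rewrite -w2 expand3 !expr2.
exists h; split => //; rewrite -/c -hV; congr (lebesgue3 _).

suff E t : (C `&` [set x | dotr x u = 1]) (frame_map (p, f) t) <->
    dotr (frame_map (p, f) t) (frame_map (p, f) t) - dotr (frame_map (p, f) t) e ^+ 2 <=
    F (dotr (frame_map (p, f) t) e).
  pose s t : 'rV[R]_3 := (\row_(i < 3) [:: t.1.1; t.1.2; t.2]`_i) + a.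
  have XE t : frame_map (p, f) t = u + s t *m f.
    by rewrite /frame_map /= {1}oE mulmxDl -addrA [X in u + X]addrC.
  have Xe t : dotr (frame_map (p, f) t) e = c + dotr w (s t).
    rewrite XE dotrDl; congr (_ + _); rewrite dotrC !dotrE /w trmx_mul.
    by rewrite mulmxA.
  have XX t : dotr (frame_map (p, f) t) (frame_map (p, f) t) = 1 + dotr (s t) (s t).
    have us : dotr u (s t *m f) = 0.
      by rewrite dotrE trmx_mul mulmxA uf mul0mx mxE.
    have sq (x y : 'rV[R]_4) : dotr (x + y) (x + y) = dotr x x + 2 * dotr x y + dotr y y.
      by rewrite dotrDl !dotrDr [dotr y x]dotrC; ring.
    rewrite XE sq u1 us mulr0 addr0; congr (_ + _).
    by rewrite !dotrE trmx_mul mulmxA -(mulmxA (s t)) ff mulmx1.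
  have s0 t : s t ord0 (inord 0) = t.1.1 + a ord0 (inord 0) by rewrite !mxE inordK.
  have s1 t : s t ord0 (inord 1) = t.1.2 + a ord0 (inord 1) by rewrite !mxE inordK.
  have s2 t : s t ord0 (inord 2) = t.2 + a ord0 (inord 2) by rewrite !mxE inordK.
  apply/seteqP; split => t /=; rewrite -[_ /\ _]/((C `&` [set x | dotr x u = 1]) (frame_map (p, f) t)) E Xe XX !expand3 s0 s1 s2 !expr2 //.
rewrite -CF; split => [[]//|Ct]; split => //; exact: inH.
Qed.

(** * Hausdorff dimension *)

(** [Y] is [[a, 2 a]] without neighbourhoods of fractions. So close to [0], a denominator [q] admits
    at most [q / M] numerators; the excluded measure is thus at most [2 / M] times the sum of
    [dioph], which is below [a / 2]. *)
Lemma badly_dioph_measure (R : realType) : exists (Y : set R) (d : R),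
  [/\ measurable Y, 0 < d, (d%:E <= @lebesgue_measure R Y)%E &
      Y `<=` [set y | [/\ 0 < y, y * 100 ^+ 30 <= 1 & badly_dioph y]]].
Proof.
have [M M0 hM] := archi_nat (100 ^+ 30 : R).
have Mr : 0 < M%:R :> R by rewrite ltr0n.
pose a : R := (4 * M%:R)^-1.
have a0 : 0 < a by rewrite invr_gt0 mulr_gt0.
have aM : 4 * a * M%:R = 1 by rewrite /a; field; rewrite gt_eqF.
(* Indices are shifted: [I q p] surrounds [(p + 1) / (q + 1)]. *)
pose I q p : set R := `[(p.+1%:R - dioph R q.+1) / q.+1%:R, (p.+1%:R + dioph R q.+1) / q.+1%:R]%classic.
pose B q := \big[setU/set0]_(p < q.+1 %/ M) I q p.
have mB q : measurable (B q) by apply: bigsetU_measurable => p _; exact: measurable_itv.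
have lI q p : @lebesgue_measure R (I q p) = (2 * dioph R q.+1 / q.+1%:R)%:E.
  have d0 : 0 < dioph R q.+1 by rewrite dioph_gt0.
  rewrite lebesgue_closed_itv; first by rewrite -mulrBl; congr ((_ / _)%:E); ring.
  by rewrite ler_pM2r ?invr_gt0 //; lra.
have lB q : (@lebesgue_measure R (B q) <= (2 / M%:R * dioph R q.+1)%:E)%E.
  have d0 : 0 < dioph R q.+1 by rewrite dioph_gt0.
  have h := content_subadditive (@lebesgue_measure R) (F := I q) (fun p _ => measurable_itv _) (mB q) (@subset_refl _ _).
  apply: le_trans h _.
  rewrite (eq_bigr (fun=> (2 * dioph R q.+1 / q.+1%:R)%:E)) => [|p _]; last exact: lI.
  rewrite sumEFin lee_fin sumr_const card_ord -[leLHS]mulr_natr.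
  have : (q.+1 %/ M)%:R * M%:R <= q.+1%:R :> R by rewrite -natrM ler_nat leq_divM.
  rewrite -ler_pdivlMr // => h.
  apply: le_trans (_ : 2 * dioph R q.+1 / q.+1%:R * (q.+1%:R / M%:R) <= _).
    by apply: ler_wpM2l => //; rewrite divr_ge0 // mulr_ge0 // ltW.
  rewrite [X in X <= _](_ : _ = 2 / M%:R * dioph R q.+1) //.
  have q1 : q.+1%:R != 0 :> R by rewrite pnatr_eq0.
  by move: (q.+1%:R) q1 => x q1; field; rewrite q1 gt_eqF.
have mBB : measurable (\bigcup_q B q) by exact: bigcup_measurable.
have lBB : (@lebesgue_measure R (\bigcup_q B q) <= (a / 2)%:E)%E.
  have h := measure_sigma_subadditive (@lebesgue_measure R) mB mBB (@subset_refl _ _).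
  apply: le_trans h _.
  apply: lime_le; first by apply: is_cvg_nneseries.
  near=> n; apply: (@le_trans _ _ (\sum_(0 <= q < n.+1) (2 / M%:R * dioph R q.+1)%:E)%E).
    rewrite big_nat_recr //=; apply: (@le_trans _ _ (\sum_(0 <= q < n) (2 / M%:R * dioph R q.+1)%:E)%E).
      by apply: lee_sum => q _.
    by rewrite leeDl // lee_fin mulr_ge0 ?divr_ge0 ?(ltW Mr) // ltW // dioph_gt0.
  rewrite sumEFin lee_fin -big_distrr /=.
  have := sum_dioph R n; rewrite big_add1 /= => h.
  have k0 : 0 < cbrt_nat R n.+1 by rewrite cbrt_nat_gt0.
  have h2 : \sum_(0 <= i < n.+1) dioph R i.+1 <= 4 / 100.
    apply: le_trans h _; rewrite ler_pM2r ?invr_gt0 // gerBl divr_ge0 ?(ltW k0) //.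
  apply: le_trans (_ : 2 / M%:R * (4 / 100) <= _); first by rewrite ler_pM2l // divr_gt0.
  have -> : 2 / M%:R = 8 * a :> R by rewrite /a; field; rewrite gt_eqF.
  lra.
pose J : set R := `[a, 2 * a]%classic; have mJ : measurable J by exact: measurable_itv.
have mY : measurable (J `\` \bigcup_q B q) by exact: measurableD.
exists (J `\` \bigcup_q B q), (a / 2); split; first exact: mY.
- by rewrite divr_gt0.
- have lJ : @lebesgue_measure R J = a%:E.
    by rewrite lebesgue_closed_itv; [congr (_%:E); ring | lra].
  have h2 := measureU2 (@lebesgue_measure R) mY mBB.
  have h1 : (@lebesgue_measure R J <= @lebesgue_measure R ((J `\` \bigcup_q B q) `|` \bigcup_q B q))%E.
    apply: le_measure; rewrite ?inE //; first exact: measurableU.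
    by move=> x Jx; have [?|?] := pselect ((\bigcup_q B q) x); [right|left].
  have := le_trans h1 (le_trans h2 (leeD2l _ lBB)).
  by rewrite lJ -leeBlDr // -EFinB; congr (_%:E <= _)%E; field.
- move=> y [Jy yB]; move: Jy; rewrite /J /= in_itv /= => /andP[y1 y2]; split.
  + exact: lt_le_trans y1.
  + apply: (@le_trans _ _ (2 * a * M%:R)); last lra.
    by apply: ler_pM; rewrite ?exprn_ge0 // ltW // (lt_le_trans a0).
  + move=> p q p0 q0; rewrite leNgt; apply/negP => h; apply: yB.
    exists q.-1 => //; rewrite /B -(bigcup_mkord _ (I q.-1)).
    have d1 : dioph R q < 2^-1.
      have k1 : 1 <= cbrt_nat R q.
        have k0 : 0 < cbrt_nat R q by rewrite cbrt_nat_gt0.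
        by rewrite -(@ler_pXn2r _ 3) ?nnegrE ?(ltW k0) ?cbrt_natX ?expr1n ?ler1n.
      rewrite /dioph ltf_pV2 ?posrE // ?mulr_gt0 ?exprn_gt0 ?cbrt_nat_gt0 //.
      have : 1 <= cbrt_nat R q ^+ 4 by rewrite exprn_ege1.
      lra.
    have qr : 0 < q%:R :> R by rewrite ltr0n.
    move: h; rewrite ltr_norml => /andP[h1 h2].
    (* Since [p <= 2 (p - 1/2) < 2 q y <= 4 a q], the numerator satisfies [p <= q / M]. *)
    exists p.-1 => /=.
      rewrite prednK // prednK // leq_divRL // -(ler_nat R) natrM.
      have p1 : 1 <= p%:R :> R by rewrite ler1n.
      have : q%:R * y <= q%:R * (2 * a) by rewrite ler_pM2l.
      rewrite -(@ler_pM2r _ (4 * a)); last lra.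
      have -> : p%:R * M%:R * (4 * a) = p%:R by rewrite -mulrA [M%:R * _]mulrC aM mulr1.
      lra.
    by rewrite /I /= in_itv /= !prednK // ler_pdivrMr // ler_pdivlMr // ![y * _]mulrC; apply/andP; split; lra.
Unshelve. all: by end_near.
Qed.

(** A cover of the image by sets of diameter [e i] pulls back to a cover of [Y] by intervals of
    length [2 L e i]. For [s < 1] and [e i <= 1] one has [e i <= (e i)^s], so the sums defining the
    premeasure are at least [d / (2 L)]. *)
Lemma hausdorff_dim_image_ge1 (R : realType) (Y : set R) (f : R -> R) (d L : R) :
  measurable Y -> 0 < d -> (d%:E <= @lebesgue_measure R Y)%E -> 0 < L ->
  (forall y y', Y y -> Y y' -> `|y - y'| <= L * `|f y - f y'|) ->
  (1 <= hausdorff_dim (f @` Y))%E.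
Proof.
move=> mY d0 dY L0 fL; apply/ereal_infP => _ [s [s0 hs] <-].
rewrite lee_fin leNgt; apply/negP => s1.
have : (hausdorff_premeasure s 1 (f @` Y) < (d / (4 * L))%:E)%E.
  apply: (@le_lt_trans _ _ 0%E); last by rewrite lte_fin divr_gt0 // mulr_gt0.
  have : (hausdorff_premeasure s 1 (f @` Y) <= hausdorff_measure s (f @` Y))%E.
    by apply: ereal_sup_ubound; exists 1 => //=; exact: ltr01.
  by rewrite hs.
move=> /ereal_inf_lt[_ [U [cov dU] <-] sumU].
have diam0 i : (0 <= ediam (U i))%E by rewrite le_max lexx.
pose e i := fine (ediam (U i)).
have eE i : ediam (U i) = (e i)%:E.
  by rewrite fineK // ge0_fin_numE // (le_lt_trans (dU i)) // ltry.
have e0 i : 0 <= e i by rewrite -lee_fin -eE.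
have e1 i : e i <= 1 by rewrite -lee_fin -eE.
have centre i : exists c, forall y, Y y -> U i (f y) -> `|y - c| <= L * e i.
  have [[z [Yz Uz]]|hN] := pselect (exists z, Y z /\ U i (f z)); last first.
    by exists 0 => y Yy Uy; case: hN; exists y.
  exists z => y Yy Uy; apply: le_trans (fL _ _ Yy Yz) _; apply: ler_wpM2l; first exact: ltW.
  rewrite -lee_fin -eE le_max; apply/orP; right; apply: ereal_sup_ubound.
  by exists (f y, f z).
have [c hc] := choice centre.
pose W i : set R := `[c i - L * e i, c i + L * e i]%classic.
have lW i : @lebesgue_measure R (W i) = (2 * L * e i)%:E.
  have := mulr_ge0 (ltW L0) (e0 i) => Le.
  by rewrite lebesgue_closed_itv; [congr (_%:E); ring | lra].
have YW : Y `<=` \bigcup_i W i.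
  move=> y Yy; have [i _ Ui] : (\bigcup_i U i) (f y) by apply: cov; exists y.
  exists i => //=; have := hc i y Yy Ui; rewrite /W /= in_itv /= ler_norml => /andP[h1 h2].
  by apply/andP; split; lra.
have mW i : measurable (W i) by exact: measurable_itv.
have h := measure_sigma_subadditive (@lebesgue_measure R) mW mY YW.
have : (d%:E <= (2 * L)%:E * \sum_(0 <= i <oo) poweR (ediam (U i)) s)%E.
  rewrite -nneseriesZl; last by move=> i _; exact: poweR_ge0.
  apply: le_trans dY (le_trans h _); apply: lee_nneseries => // i _.
  rewrite [X in (X <= _)%E](lW i) eE poweR_EFin -EFinM lee_fin.
  apply: ler_wpM2l; first by rewrite mulr_ge0 // ltW.
  have [->|n0] := eqVneq (e i) 0; first exact: powR_ge0.
  by apply: ger1_powR; [rewrite e1 andbT lt_neqAle eq_sym n0 e0 | exact: ltW].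
apply/negP; rewrite -ltNge; apply: (@le_lt_trans _ _ ((2 * L)%:E * (d / (4 * L))%:E)%E).
  by apply: lee_wpmul2l; [rewrite lee_fin mulr_ge0 // ltW | exact: ltW].
rewrite -EFinM lte_fin.
have -> : 2 * L * (d / (4 * L)) = d / 2 by field; rewrite gt_eqF.
lra.
Qed.

(** For [x <= y] the difference [cot x - cot y = sin (y - x) / (sin x sin y)] is at least
    [(y - x) / 2], and cubing does not contract, both cotangents being at least 1. *)
Lemma cot_cube_expansive (R : realType) (x y : R) : 0 < x -> x <= 10^-1 ->
  0 < y -> y <= 10^-1 ->
  `|x - y| <= 2 * `|(cos x / sin x) ^+ 3 - (cos y / sin y) ^+ 3|.
Proof.
wlog xy : x y / x <= y => [hw x0 x1 y0 y1|].
  have [xy|yx] := leP x y; first exact: hw.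
  by rewrite distrC [X in _ <= 2 * X]distrC; apply: hw => //; exact: ltW.
move=> x0 x1 y0 y1.
have [sx cx sxx cx2] := sin_cos_small x0 x1; have [sy cy syy cy2] := sin_cos_small y0 y1.
have p2 := pi_ge2 R.
set u := cos x / sin x; set v := cos y / sin y.
have cot_ge1 (z : R) : 0 < z -> z <= 10^-1 -> 1 <= cos z / sin z.
  move=> z0 z1; have [sz cz szz cz2] := sin_cos_small z0 z1.
  rewrite ler_pdivlMr // mul1r -ler_sqr ?nnegrE ?(ltW sz) ?(ltW cz) //.
  apply: le_trans cz2; apply: (@le_trans _ _ (z ^+ 2)).
    by rewrite ler_sqr ?nnegrE ?(ltW sz) ?(ltW z0).
  have : z ^+ 2 <= 10^-1 ^+ 2 by rewrite ler_sqr ?nnegrE ?(ltW z0) ?invr_ge0.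
  lra.
have u1 : 1 <= u by exact: cot_ge1.
have v1 : 1 <= v by exact: cot_ge1.
have uv : (y - x) / 2 <= u - v.
  have -> : u - v = sin (y - x) / (sin x * sin y).
    by rewrite sinB /u /v; field; rewrite !gt_eqF.
  have h : (y - x) / 2 <= sin (y - x) by apply: half_le_sin; lra.
  rewrite ler_pdivlMr ?mulr_gt0 //; apply: le_trans h.
  rewrite -[leRHS]mulr1; apply: ler_wpM2l; first lra.
  by rewrite -[leRHS]mulr1; apply: ler_pM; lra.
have -> : u ^+ 3 - v ^+ 3 = (u - v) * (u ^+ 2 + u * v + v ^+ 2) by ring.
have w1 : 1 <= u ^+ 2 + u * v + v ^+ 2.
  have := mulr_ge0 (le_trans ler01 u1) (le_trans ler01 v1); have := sqr_ge0 v.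
  have : 1 <= u ^+ 2 by rewrite exprn_ege1.
  lra.
have uv0 : 0 <= u - v by lra.
rewrite distrC ger0_norm ?subr_ge0 // ger0_norm; last by apply: mulr_ge0 => //; lra.
have : (u - v) * 1 <= (u - v) * (u ^+ 2 + u * v + v ^+ 2) by apply: ler_wpM2l.
lra.
Qed.

(** * Recovering the body from its sections *)

Lemma dotr_sqr_le (R : realType) n (x e : 'rV[R]_n) : dotr e e = 1 ->
  dotr x e ^+ 2 <= dotr x x.
Proof.
move=> e1; have := dotr_ge0 (x - dotr x e *: e).
by rewrite !dotrL e1 [dotr e x]dotrC; lra.
Qed.

(** Every [c] in [[-1, 1]] is the axial coordinate of a unit normal in the meridian plane. *)
Lemma tangent_section_integral (R : realType) (C : set 'rV[R]_4) (e v : 'rV[R]_4)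
    (F : R -> R) (A : R) :
  dotr e e = 1 -> dotr v v = 1 -> dotr v e = 0 -> measurable_fun setT F ->
  (forall x, C x <-> dotr x x - dotr x e ^+ 2 <= F (dotr x e)) ->
  (forall H : set 'rV[R]_4, hyperplane H -> tangent_to H (eball 0 1) ->
     hyperplane_measure H (C `&` H) = A%:E) ->
  forall c, c ^+ 2 <= 1 -> exists h, h ^+ 2 = 1 - c ^+ 2 /\
    (\int[@lebesgue_measure R]_x (disc_area R *
       Num.max (F (h * x + c) + (h * x + c) ^+ 2 - 1 - x ^+ 2) 0)%:E)%E = A%:E.
Proof.
move=> e1 v1 ve mF CF CA c c1; pose u := c *: e + Num.sqrt (1 - c ^+ 2) *: v.
have u1 : dotr u u = 1 by rewrite dotr_meridian // sqr_sqrtr ?subr_ge0 // addrC subrK.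
have ue : dotr u e = c by rewrite dotrDl !dotrZl e1 ve mulr1 mulr0 addr0.
have [h [h2 hV]] := hyperplane_section e1 u1 mF CF.
have [hp tg] := unit_hyperplane u1.
by exists h; rewrite -ue; split => //; rewrite -hV; exact: CA.
Qed.

Lemma small_half_angle (R : realType) (y : R) : 0 < y -> y * 100 ^+ 30 <= 1 ->
  0 < pi * y / 2 /\ pi * y / 2 <= 10^-1.
Proof.
move=> y0 yM; have p0 := pi_gt0 R; split; first by rewrite divr_gt0 // mulr_gt0.
have : y * 100 <= y * 100 ^+ 30.
  by rewrite ler_pM2l // -[leLHS]expr1 ler_weXn2l // ler1n.
have : pi * y <= 4 * y by rewrite ler_pM2r // ltW // pi_lt4.
by clear -yM; lra.
Qed.

(** The given volume is that of a three-dimensional ball of radius [r = cot (pi y / 2)]. It fixes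
    the profile at abscissa 1, hence the starting point, and yields the section relation, so
    [planar_rigidity] applies to the meridian. *)
Lemma revolution_body_rigidity (R : realType) (C : set 'rV[R]_4) (y : R) :
  convex_body C -> symmetric_set C -> of_revolution C -> eball 0 1 `<=` C° ->
  0 < y -> y * 100 ^+ 30 <= 1 -> badly_dioph y ->
  (forall H : set 'rV[R]_4, hyperplane H -> tangent_to H (eball 0 1) ->
     hyperplane_measure H (C `&` H) =
     (4 / 3 * disc_area R * (cos (pi * y / 2) / sin (pi * y / 2)) ^+ 3)%:E) ->
  euclidean_ball C.
Proof.
move=> [cC vC [x0 /interior_subset Cx0]] sC rC bC y0 yM yb CA.
have [e [e1 {}rC]] := revolution_axis_center cC (ex_intro _ x0 Cx0) sC rC.
have [v [v1 ve _ _]] := orthogonal_unit e e e.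
have pb := meridian_planar_body e1 v1 ve rC cC vC sC bC.
have mem := meridian_mem e1 v1 ve rC.
move: pb mem; set K := meridian C e v => pb mem.
have [F [mF FK]] := meridian_profile pb.
have CF x : C x <-> dotr x x - dotr x e ^+ 2 <= F (dotr x e).
  have d0 : 0 <= dotr x x - dotr x e ^+ 2 by rewrite subr_ge0 dotr_sqr_le.
  by rewrite (mem x (Num.sqrt (dotr x x - dotr x e ^+ 2))) ?sqrtr_ge0 ?sqr_sqrtr // -FK sqr_sqrtr.
have [k0 _] := disc_areaE R.
have [t0 t10] := small_half_angle y0 yM.
set t := pi * y / 2 in CA t0 t10 *.
have [s0 c0 _ _] := sin_cos_small t0 t10.
set r := cos t / sin t in CA *.
have r0 : 0 < r by rewrite divr_gt0.
have sec := tangent_section_integral e1 v1 ve mF CF CA.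
(* At [c = 1] the hyperplane is orthogonal to the axis and [h = 0]. *)
have F1 : F 1 = r ^+ 2.
  have F10 : 0 <= F 1.
    have /FK : K 1 0 by apply: (pb_disc pb); rewrite expr1n expr0n addr0.
    by rewrite expr0n.
  have [|h [h2]] := sec 1; first by rewrite expr1n.
  have -> : h = 0 by apply/eqP; rewrite -sqrf_eq0 h2 expr1n subrr.
  under eq_integral => x _.
    rewrite mul0r add0r expr1n addrK. over.
  move=> /(section_radius_of_volume F10) /mulfI h3.
  have {}h3 : r ^+ 3 = Num.sqrt (F 1) ^+ 3.
    by apply: h3; rewrite mulf_neq0 // gt_eqF // divr_gt0.
  rewrite -[LHS]sqr_sqrtr //; congr (_ ^+ 2).
  by apply/eqP; rewrite -(@eqrXn2 _ 3) ?sqrtr_ge0 ?(ltW r0) // h3.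
have rel : section_relation K r.
  have -> : K = fun x y => y ^+ 2 <= F x.
    by apply/funext => x; apply/funext => z; apply/propext; rewrite FK.
  apply: section_relation_of_areas => // c c1.
  have [h [h2 hI]] := sec _ (ltW c1).
  rewrite (section_area_of_volume mF c1 h2 hI); congr (_%:E); congr (_ * _).
  by field; rewrite gt_eqF.
(* The point [(1, r)] is on the boundary: a point of [K] beyond it on its ray, joined to [(0, 1)],
   would give a point of abscissa 1 and height above [r]. *)
have start : boundary_at K (sin t)^-1 t.
  rewrite /boundary_at mulVf ?gt_eqF // mulrC -/r; split; first by rewrite -FK F1.
  move=> l sl Kl.
  have l1 : 1 < l * sin t by rewrite -ltr_pdivrMr // mul1r.
  have l0 : 0 < l by apply: lt_trans sl; rewrite invr_gt0.
  have K01 : K 0 1 by apply: (pb_disc pb); rewrite expr1n expr0n add0r.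
  pose m := (l * sin t)^-1.
  have m0 : 0 <= m by rewrite invr_ge0 mulr_ge0 // ltW.
  have m1 : m < 1 by rewrite invf_lt1 //; lra.
  have := pb_convex pb m0 (ltW m1) K01 Kl.
  have -> : (1 - m) * 0 + m * (l * sin t) = 1.
    by rewrite mulr0 add0r mulVf // gt_eqF //; lra.
  have -> : (1 - m) * 1 + m * (l * cos t) = (1 - m) + r.
    by rewrite mulr1 /m /r; field; rewrite !gt_eqF.
  have mr : 0 <= (1 - m) + r by apply: addr_ge0; [rewrite subr_ge0; exact: ltW | exact: ltW].
  rewrite -FK F1 ler_sqr ?nnegrE ?(ltW r0) //.
  by rewrite gerDr subr_le0 leNgt m1.
have all_dir := planar_rigidity pb y0 yM yb rel start.
have disc := boundary_disc pb (_ : 0 < (sin t)^-1) all_dir.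
have rho0 : 0 < (sin t)^-1 by rewrite invr_gt0.
exists 0, (sin t)^-1; split => //.
apply/seteqP; rewrite /eball /enorm; suff E x : C x <-> Num.sqrt (dotr x x) <= (sin t)^-1.
  by split => x /=; rewrite subr0 E.
have d0 : 0 <= dotr x x - dotr x e ^+ 2 by rewrite subr_ge0 dotr_sqr_le.
rewrite (mem x (Num.sqrt (dotr x x - dotr x e ^+ 2))) ?sqrtr_ge0 ?sqr_sqrtr //.
rewrite disc // sqr_sqrtr // addrC subrK.
by rewrite -[in X in _ <-> X](ger0_norm (ltW rho0)) -sqrtr_sqr ler_sqrt // exprn_ge0 // ltW.
Qed.

Theorem theorem1 (R : realType) :
  exists AA : set R,
    [/\ infinite_set AA,
        AA `<=` [set a | 0 < a],
        (0 < hausdorff_dim AA)%E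
      & forall (C : set 'rV[R]_4) (A : R),
          convex_body C ->
          symmetric_set C ->
          of_revolution C ->
          eball 0 1 `<=` C° ->
          (forall H : set 'rV[R]_4, hyperplane H -> tangent_to H (eball 0 1) ->
             hyperplane_measure H (C `&` H) = A%:E) ->
          AA A ->
          euclidean_ball C].
Proof.
have [Y [d [mY d0 dY hY]]] := badly_dioph_measure R.
have [k0 _] := disc_areaE R.
pose f (y : R) := 4 / 3 * disc_area R * (cos (pi * y / 2) / sin (pi * y / 2)) ^+ 3.
(* [L] is the constant [2] of [cot_cube_expansive] divided by the factor [4 / 3 * disc_area R] of
   [f]; the change of variable contributes [pi / 2 >= 1]. *)
pose L := 3 / (2 * disc_area R).
have L0 : 0 < L by rewrite divr_gt0 // mulr_gt0.
have fL y y' : Y y -> Y y' -> `|y - y'| <= L * `|f y - f y'|.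
  move=> /hY[y0 yM _] /hY[y'0 y'M _].
  have [t0 t1] := small_half_angle y0 yM; have [t'0 t'1] := small_half_angle y'0 y'M.
  have := cot_cube_expansive t0 t1 t'0 t'1.
  rewrite /f -mulrBr normrM (gtr0_norm (_ : 0 < 4 / 3 * disc_area R)); last first.
    by rewrite mulr_gt0 // divr_gt0.
  rewrite mulrA (_ : L * (4 / 3 * disc_area R) = 2); last first.
    by rewrite /L; field; rewrite gt_eqF.
  apply: le_trans.
  have -> : pi * y / 2 - pi * y' / 2 = pi / 2 * (y - y') by field.
  rewrite normrM gtr0_norm ?divr_gt0 ?pi_gt0 // ler_peMl //.
  by have := pi_ge2 R; lra.
have f_inj y y' : Y y -> Y y' -> f y = f y' -> y = y'.
  move=> Yy Yy' e; have := fL _ _ Yy Yy'.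
  by rewrite e subrr normr0 mulr0 normr_le0 subr_eq0 => /eqP.
exists (f @` Y); split.
(* If the image were finite, so would be [Y], through the inverse [g] with default value [0] off the
   image, and [Y] would have measure zero. *)
- pose g a := xget 0 [set y | Y y /\ f y = a].
  move=> /(finite_image g) fin.
  have YfY : Y `<=` g @` (f @` Y).
    move=> y Yy; exists (f y); first by exists y.
    have [Yg] : [set z | Y z /\ f z = f y] (g (f y)) by apply: xgetPex; exists y.
    by apply: f_inj.
  have := countable_lebesgue_measure0 (finite_set_countable (sub_finite_set YfY fin)).
  by move=> Y0; move: dY; rewrite Y0 lee_fin leNgt d0.
- move=> _ [y /hY[y0 yM _] <-] /=.
  have [t0 t1] := small_half_angle y0 yM; have [s0 c0 _ _] := sin_cos_small t0 t1.
  by rewrite mulr_gt0 ?exprn_gt0 ?divr_gt0 // mulr_gt0 // divr_gt0.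
- exact: lt_le_trans lte01 (hausdorff_dim_image_ge1 mY d0 dY L0 fL).
- move=> C A bC sC rC ballC CA [y /hY[y0 yM yb] fy].
  by apply: (revolution_body_rigidity bC sC rC ballC y0 yM yb); rewrite -/(f y) fy.
Qed.
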